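(* Let $\mathcal{K}$ be a field of characteristic $p$ ($p$ a prime), $q\in\mathcal{K}$ and $1\le k\le n$. With the specific choice of the two distinguished elements $h:=x^{(\epsilon_k)}D_k$ and $e:=2x^{(2\epsilon_k)}D_k$, with $[h,e]=e$, there is a noncommutative and noncocommutative Hopf algebra $(\mathbf{u}_{t,q}(\mathbf{W}(n;\underline1)),m,\iota,\Delta,S,\varepsilon)$ over $\mathcal{K}[t]_p^{(q)}$ with its algebra structure undeformed, whose coalgebra structure (and antipode) is given, for $0\le\alpha\le\tau$ and $1\le i\le n$, by $$\Delta(x^{(\alpha)}D_i)=x^{(\alpha)}D_i\otimes(1-et)^{\alpha_k-\delta_{ik}}+\sum_{\ell=0}^{p-1}(-1)^\ell h^{\langle\ell\rangle}\otimes(1-et)^{-\ell}\cdot d^{(\ell)}(x^{(\alpha)}D_i)t^\ell,$$ $$S(x^{(\alpha)}D_i)=-(1-et)^{\delta_{ik}-\alpha_k}\Bigl(\sum_{\ell=0}^{p-1}d^{(\ell)}(x^{(\alpha)}D_i)\cdot h_1^{\langle\ell\rangle}t^\ell\Bigr),$$ $$\varepsilon(x^{(\alpha)}D_i)=0.$$ It is finite dimensional and $\dim_{\mathcal{K}}\mathbf{u}_{t,q}(\mathbf{W}(n;\underline1))=p^{1+np^n}$.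
   Context: $\mathcal{O}(n;\underline1)$ is the restricted divided power algebra with $\mathcal{K}$-basis $\{x^{(\alpha)}\mid0\le\alpha\le\tau\}$, $\tau=(p-1,\dots,p-1)$, product $x^{(\alpha)}x^{(\beta)}=\binom{\alpha+\beta}{\alpha}x^{(\alpha+\beta)}$, $\binom{\alpha+\beta}{\alpha}=\prod_i\binom{\alpha_i+\beta_i}{\alpha_i}$, with $x^{(\alpha)}=0$ if some component $\alpha_j<0$ or $\alpha_j\ge p$. $\epsilon_i$ is the $i$-th standard basis vector and $D_j$ is the derivation $D_j(x^{(\alpha)})=x^{(\alpha-\epsilon_j)}$. The Jacobson-Witt algebra $\mathbf{W}(n;\underline1)\cong\mathrm{Der}_{\mathcal{K}}(\mathcal{O}(n;\underline1))$ has basis $\{x^{(\alpha)}D_j\mid1\le j\le n,0\le\alpha\le\tau\}$ and is a restricted Lie algebra with $D^{[p]}=D^p$. Its restricted universal enveloping algebra is $\mathbf{u}(\mathbf{W}(n;\underline1))=U(\mathbf{W}(n;\underline1))/I$, where $I$ is the ideal generated by $(x^{(\epsilon_i)}D_i)^p-x^{(\epsilon_i)}D_i$ and $(x^{(\alpha)}D_i)^p$ for $\alpha\ne\epsilon_i$ ($0\le\alpha\le\tau$, $1\le i\le n$); it has dimension $p^{np^n}$. $\mathcal{K}[t]_p^{(q)}$ denotes the $p$-truncated polynomial ring obtained as the quotient $\mathcal{K}[[t]]/(t^p-qt)$, and $\mathbf{u}_{t,q}(\mathbf{W}(n;\underline1))\cong\mathbf{u}(\mathbf{W}(n;\underline1))\otimes_{\mathcal{K}}\mathcal{K}[t]_p^{(q)}$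 as an algebra. In it $e^p=0$, so $1-et$ is invertible. For an element $x$ of a unital algebra and a scalar $a$, $x_a^{\langle\ell\rangle}:=(x+a)(x+a+1)\cdots(x+a+\ell-1)$, $x_a^{\langle0\rangle}=1$, $x^{\langle\ell\rangle}:=x_0^{\langle\ell\rangle}$. $d^{(\ell)}:=\frac1{\ell!}(\mathrm{ad}\,e)^\ell$ for $0\le\ell\le p-1$.
   Formalization: Noncocommutativity is claimed only for p ≠ 2 (for p = 2, e = 0 and Δ is cocommutative); K[t]_p^(q) is read as K[t]/(t^p − qt), since for q ≠ 0 the quotient K[[t]]/(t^p − qt) is just K, contradicting the stated dimension. *)

(* Defs.v *)
From HB Require Import structures.
From mathcomp Require Import all_boot all_order all_algebra.
From mathcomp Require Import finmap boolp monalg.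

Set Implicit Arguments.
Unset Strict Implicit.
Unset Printing Implicit Defensive.

Import GRing.Theory.
Local Open Scope ring_scope.
Local Open Scope quotient_scope.

(* A quotient B/(S) may be zero, hence is only a pzRingType in general. *)
Section QuotientAlgebra.
Variables (R : comNzRingType) (B : algType R) (S : B -> Prop).

Inductive in_ideal : B -> Prop :=
| in_ideal0 : in_ideal 0
| in_ideal_add a s b x : S s -> in_ideal x -> in_ideal (a * s * b + x).

Lemma in_idealD x y : in_ideal x -> in_ideal y -> in_ideal (x + y).
Proof.
by elim=> [|a s b z Ss _ IH] Iy; rewrite ?add0r // -addrA; constructor; auto.
Qed.

Lemma in_idealM c d x : in_ideal x -> in_ideal (c * x * d).
Proof.
elim=> [|a s b z Ss _ IH]; first by rewrite mulr0 mul0r; constructor.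
by rewrite mulrDr mulrDl !mulrA -(mulrA (c * a * s)); constructor.
Qed.

Lemma in_idealN x : in_ideal x -> in_ideal (- x).
Proof. by move/(in_idealM (- 1) 1); rewrite mulr1 mulN1r. Qed.

Lemma in_idealZ k x : in_ideal x -> in_ideal (k *: x).
Proof. by move/(in_idealM k%:A 1); rewrite mulr1 mulr_algl. Qed.

Definition ideal_of : {pred B} := [pred x | `[< in_ideal x >]].

Lemma ideal_ofP x : reflect (in_ideal x) (x \in ideal_of).
Proof. exact: asboolP. Qed.

Fact ideal_of_zmod_closed : zmod_closed ideal_of.
Proof.
split=> [|x y /ideal_ofP Ix /ideal_ofP Iy]; apply/ideal_ofP; first by constructor.
exact/in_idealD/in_idealN.
Qed.
HB.instance Definition _ := GRing.isZmodClosed.Build B ideal_of ideal_of_zmod_closed.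

Definition quot_alg := Quotient.quot ideal_of.
HB.instance Definition _ := GRing.Zmodule.on quot_alg.

Definition qpi : B -> quot_alg := locked \pi_(Quotient.quot ideal_of).

Lemma qpi_eq x y : reflect (qpi x = qpi y) (x - y \in ideal_of).
Proof. by rewrite /qpi -lock Quotient.idealrBE; apply: eqP. Qed.

Lemma qpi_repr (u : quot_alg) : qpi (repr (u : Quotient.quot ideal_of)) = u.
Proof. by rewrite /qpi -lock; apply: reprK. Qed.

Lemma qpiP (P : quot_alg -> Prop) : (forall x, P (qpi x)) -> forall u, P u.
Proof. by move=> H u; rewrite -(qpi_repr u). Qed.

Lemma qpiB : {morph qpi : x y / x - y}.
Proof. by move=> x y; rewrite /qpi -lock raddfB. Qed.
HB.instance Definition _ := GRing.isZmodMorphism.Build _ _ qpi qpiB.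

Definition quot_mul : quot_alg -> quot_alg -> quot_alg := locked (fun u v =>
  qpi (repr (u : Quotient.quot ideal_of) * repr (v : Quotient.quot ideal_of))).
Definition quot_scale : R -> quot_alg -> quot_alg := locked (fun k u =>
  qpi (k *: repr (u : Quotient.quot ideal_of))).

Lemma qpi_mul x y : quot_mul (qpi x) (qpi y) = qpi (x * y).
Proof.
rewrite /quot_mul -lock; set x' := repr _; set y' := repr _.
have Ix : x' - x \in ideal_of by apply/qpi_eq; rewrite qpi_repr.
have Iy : y' - y \in ideal_of by apply/qpi_eq; rewrite qpi_repr.
apply/qpi_eq/ideal_ofP.
have -> : x' * y' - x * y = 1 * (x' - x) * y' + x * (y' - y) * 1.
  by rewrite mul1r mulr1 mulrBl mulrBr addrA subrK.
by apply: in_idealD; apply: in_idealM; apply/ideal_ofP.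
Qed.

Lemma qpi_scale k x : quot_scale k (qpi x) = qpi (k *: x).
Proof.
rewrite /quot_scale -lock; set x' := repr _.
have Ix : x' - x \in ideal_of by apply/qpi_eq; rewrite qpi_repr.
by apply/qpi_eq/ideal_ofP; rewrite -scalerBr; apply/in_idealZ/ideal_ofP.
Qed.

Fact quot_mulA : associative quot_mul.
Proof. by do 3!elim/qpiP=> ?; rewrite !qpi_mul mulrA. Qed.
Fact quot_mul1l : left_id (qpi 1) quot_mul.
Proof. by elim/qpiP=> x; rewrite qpi_mul mul1r. Qed.
Fact quot_mul1r : right_id (qpi 1) quot_mul.
Proof. by elim/qpiP=> x; rewrite qpi_mul mulr1. Qed.
Fact quot_mulDl : left_distributive quot_mul +%R.
Proof. by do 3!elim/qpiP=> ?; rewrite -raddfD !qpi_mul -raddfD mulrDl. Qed.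
Fact quot_mulDr : right_distributive quot_mul +%R.
Proof. by do 3!elim/qpiP=> ?; rewrite -raddfD !qpi_mul -raddfD mulrDr. Qed.
HB.instance Definition _ := GRing.Zmodule_isPzRing.Build quot_alg
  quot_mulA quot_mul1l quot_mul1r quot_mulDl quot_mulDr.

Fact quot_scaleA a b v : quot_scale a (quot_scale b v) = quot_scale (a * b) v.
Proof. by elim/qpiP: v => x; rewrite !qpi_scale scalerA. Qed.
Fact quot_scale1 : left_id 1 quot_scale.
Proof. by elim/qpiP=> x; rewrite qpi_scale scale1r. Qed.
Fact quot_scaleDr : right_distributive quot_scale +%R.
Proof. by move=> a; do 2!elim/qpiP=> ?; rewrite -raddfD !qpi_scale -raddfD scalerDr. Qed.
Fact quot_scaleDl v : {morph quot_scale^~ v : a b / a + b}.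
Proof. by elim/qpiP: v => x a b; rewrite !qpi_scale -raddfD scalerDl. Qed.
HB.instance Definition _ := GRing.Zmodule_isLmodule.Build R quot_alg
  quot_scaleA quot_scale1 quot_scaleDr quot_scaleDl.

Lemma qpiM x y : qpi (x * y) = qpi x * qpi y.
Proof. by rewrite -qpi_mul. Qed.
Lemma qpiZ k x : qpi (k *: x) = k *: qpi x.
Proof. by rewrite -qpi_scale. Qed.

Lemma quot_scaleAl (k : R) (u v : quot_alg) : k *: (u * v) = (k *: u) * v.
Proof.
by elim/qpiP: u => x; elim/qpiP: v => y; rewrite -(qpiM x) -(qpiZ k x) -(qpiM (k *: x)) -qpiZ scalerAl.
Qed.
Lemma quot_scaleAr (k : R) (u v : quot_alg) : k *: (u * v) = u * (k *: v).
Proof.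
by elim/qpiP: u => x; elim/qpiP: v => y; rewrite -(qpiM x y) -(qpiZ k y) -(qpiM x) -qpiZ scalerAr.
Qed.

Section Augmentation.
Variable f : {rmorphism B -> R}.
Hypotheses (fZ : forall k x, f (k *: x) = k * f x) (fS : forall s, S s -> f s = 0).

Definition quot_aug : quot_alg -> R :=
  locked (fun u => f (repr (u : Quotient.quot ideal_of))).

Lemma quot_augE x : quot_aug (qpi x) = f x.
Proof.
rewrite /quot_aug -lock; set x' := repr _; apply/eqP; rewrite -subr_eq0 -rmorphB.
have /qpi_eq/ideal_ofP : qpi x' = qpi x by rewrite qpi_repr.
elim=> [|a s b y Ss _ IH]; first by rewrite rmorph0.
by rewrite rmorphD !rmorphM /= (fS Ss) mulr0 mul0r add0r.
Qed.

Lemma quot_augB : {morph quot_aug : u v / u - v}.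
Proof. by do 2!elim/qpiP=> ?; rewrite -raddfB !quot_augE rmorphB. Qed.

Lemma quot_augD : {morph quot_aug : u v / u + v}.
Proof. by do 2!elim/qpiP=> ?; rewrite -raddfD !quot_augE rmorphD. Qed.

Lemma quot_augM : monoid_morphism quot_aug.
Proof.
split=> [|]; first by rewrite quot_augE rmorph1.
by elim/qpiP=> x; elim/qpiP=> y; rewrite -qpiM !quot_augE rmorphM.
Qed.

Lemma quot_augZ k u : quot_aug (k *: u) = k * quot_aug u.
Proof. by elim/qpiP: u => x; rewrite -qpiZ !quot_augE fZ. Qed.

Lemma quot_neq0 : (1 : quot_alg) != 0.
Proof.
apply/eqP=> /(congr1 quot_aug); rewrite -(raddf0 qpi) !quot_augE.
by rewrite rmorph1 rmorph0 => /eqP; rewrite oner_eq0.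
Qed.
End Augmentation.
End QuotientAlgebra.

HB.instance Definition _ (R : comNzRingType) (B : algType R) (S : B -> Prop) :=
  GRing.isScalable.Build R B (quot_alg S) *:%R (qpi S) (@qpiZ R B S).
HB.instance Definition _ (R : comNzRingType) (B : algType R) (S : B -> Prop) :=
  GRing.isMonoidMorphism.Build B (quot_alg S) (qpi S) (erefl, @qpiM R B S).

Section FreeAlgebra.
Variables (R : comNzRingType) (X : choiceType).

Local Notation mono_alg := {malg R[{fmonom X}]}.

(* Locking the product keeps unification from unfolding it. *)
Definition free_alg := mono_alg.
HB.instance Definition _ := GRing.Lmodule.on free_alg.

Definition free_mul : free_alg -> free_alg -> free_alg :=
  locked (fun x y : mono_alg => x * y).

Lemma free_mulE (x y : free_alg) : free_mul x y = (x : mono_alg) * y.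
Proof. by rewrite /free_mul -lock. Qed.

Fact free_mulA : associative free_mul.
Proof. by move=> x y z; rewrite !free_mulE mulrA. Qed.
Fact free_mul1l : left_id (1 : mono_alg) free_mul.
Proof. by move=> x; rewrite free_mulE mul1r. Qed.
Fact free_mul1r : right_id (1 : mono_alg) free_mul.
Proof. by move=> x; rewrite free_mulE mulr1. Qed.
Fact free_mulDl : left_distributive free_mul +%R.
Proof. by move=> x y z; rewrite !free_mulE; apply: mulrDl. Qed.
Fact free_mulDr : right_distributive free_mul +%R.
Proof. by move=> x y z; rewrite !free_mulE; apply: mulrDr. Qed.
Fact free_1neq0 : (1 : mono_alg) != 0.
Proof. exact: oner_neq0. Qed.
HB.instance Definition _ := GRing.Zmodule_isNzRing.Build free_alg
  free_mulA free_mul1l free_mul1r free_mulDl free_mulDr free_1neq0.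

Fact free_scaleAl (k : R) (x y : free_alg) :
  k *: free_mul x y = free_mul (k *: x) y.
Proof.
by rewrite !free_mulE; apply: scalerAl.
Qed.
HB.instance Definition _ := GRing.Lmodule_isLalgebra.Build R free_alg free_scaleAl.

Fact free_scaleAr (k : R) (x y : free_alg) :
  k *: free_mul x y = free_mul x (k *: y).
Proof.
rewrite !free_mulE.
pose c : mono_alg := malgC k.
have cE (z : mono_alg) : k *: z = c * z by exact/esym/mul_malgC.
suff cC (z : mono_alg) : z * c = c * z.
  by rewrite [LHS]cE [k *: y]cE !mulrA cC.
rewrite [LHS](fgmulgU k (@mone _) z) [RHS](fgmulUg k (@mone _) z).
by apply: eq_bigr => m _; rewrite mulrC mul1m mulm1.
Qed.
HB.instance Definition _ := GRing.Lalgebra_isAlgebra.Build R free_alg free_scaleAr.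

Definition free_gen : X -> free_alg := locked (fun x => << fmu x >>).

Definition free_aug : free_alg -> R := locked (mcoeff (@mone _)).

Lemma free_aug_gen x : free_aug (free_gen x) = 0.
Proof. by rewrite /free_aug /free_gen -!lock mcoeffU1 fmP fm1 /= fmuE. Qed.

Lemma free_augB : {morph free_aug : x y / x - y}.
Proof. by rewrite /free_aug -lock; apply: raddfB. Qed.
HB.instance Definition _ := GRing.isZmodMorphism.Build free_alg R free_aug free_augB.

Lemma free_augM : monoid_morphism free_aug.
Proof.
rewrite /free_aug -lock; split=> [|x y]; first exact: rmorph1.
by rewrite -[_ * _]/(free_mul _ _) free_mulE; apply: rmorphM.
Qed.
HB.instance Definition _ := GRing.isMonoidMorphism.Build free_alg R free_aug free_augM.

Lemma free_augZ k x : free_aug (k *: x) = k * free_aug x.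
Proof. by rewrite /free_aug -lock; apply: mcoeffZ. Qed.
End FreeAlgebra.

(* U(g) = R<g> / ([a x + y] - a[x] - [y], [x][y] - [y][x] - [br x y]) *)
Section EnvelopingAlgebra.
Variables (R : comNzRingType) (g : lmodType R) (br : g -> g -> g).
Local Notation gen := (@free_gen R g).

Variant env_rel : free_alg R g -> Prop :=
| env_rel_lin a x y : env_rel (gen (a *: x + y) - (a *: gen x + gen y))
| env_rel_br x y : env_rel (gen x * gen y - gen y * gen x - gen (br x y)).

Definition env_alg := quot_alg env_rel.
HB.instance Definition _ := GRing.PzRing.on env_alg.
HB.instance Definition _ := GRing.Lmodule.on env_alg.

Lemma env_rel_aug s : env_rel s -> free_aug s = 0.
Proof.
case=> [a x y|x y].
  rewrite free_augB raddfD /= free_augZ !free_aug_gen.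
  by rewrite mulr0 addr0 subr0.
have M u v := (free_augM R g).2 (gen u) (gen v).
by rewrite 2!free_augB (M x y) (M y x) !free_aug_gen mulr0 !subr0.
Qed.

HB.instance Definition _ := GRing.PzSemiRing_isNonZero.Build env_alg
  (quot_neq0 env_rel_aug).
HB.instance Definition _ :=
  GRing.Lmodule_isLalgebra.Build R env_alg (@quot_scaleAl _ _ env_rel).
HB.instance Definition _ :=
  GRing.Lalgebra_isAlgebra.Build R env_alg (@quot_scaleAr _ _ env_rel).

Definition env_in (x : g) : env_alg := qpi env_rel (gen x).

Definition env_aug : env_alg -> R := quot_aug (@free_aug R g).
HB.instance Definition _ :=
  GRing.isZmodMorphism.Build env_alg R env_aug (quot_augB env_rel_aug).
HB.instance Definition _ :=
  GRing.isMonoidMorphism.Build env_alg R env_aug (quot_augM env_rel_aug).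

Lemma env_augZ k u : env_aug (k *: u) = k * env_aug u.
Proof. exact: (quot_augZ (@free_augZ _ _) env_rel_aug). Qed.

Lemma env_aug_in x : env_aug (env_in x) = 0.
Proof. by rewrite /env_aug (quot_augE env_rel_aug) /= free_aug_gen. Qed.
End EnvelopingAlgebra.

Section TensorProduct.
Variables (R : comNzRingType) (M N : lmodType R).
Local Notation free := {malg R[(M * N)%type]}.

Variant tens_rel : free -> Prop :=
| tens_rel_l a x x' y :
    tens_rel (<< (a *: x + x', y) >> - (a *: << (x, y) >> + << (x', y) >>))
| tens_rel_r a x y y' :
    tens_rel (<< (x, a *: y + y') >> - (a *: << (x, y) >> + << (x, y') >>)).

Inductive in_tens_span : free -> Prop :=
| in_tens_span0 : in_tens_span 0
| in_tens_span_add k s x :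
    tens_rel s -> in_tens_span x -> in_tens_span (k *: s + x).

Lemma in_tens_spanD x y :
  in_tens_span x -> in_tens_span y -> in_tens_span (x + y).
Proof.
by elim=> [|k s z Ss _ IH] Iy; rewrite ?add0r // -addrA; constructor; auto.
Qed.

Lemma in_tens_spanZ c x : in_tens_span x -> in_tens_span (c *: x).
Proof.
elim=> [|k s z Ss _ IH]; first by rewrite scaler0; constructor.
by rewrite scalerDr scalerA; constructor.
Qed.

Definition tens_span : {pred free} := [pred x | `[< in_tens_span x >]].

Lemma tens_spanP x : reflect (in_tens_span x) (x \in tens_span).
Proof. exact: asboolP. Qed.

Fact tens_span_zmod_closed : zmod_closed tens_span.
Proof.
split=> [|x y /tens_spanP Ix /tens_spanP Iy]; apply/tens_spanP; first by constructor.
by apply/in_tens_spanD => //; rewrite -scaleN1r; apply: in_tens_spanZ.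
Qed.
HB.instance Definition _ :=
  GRing.isZmodClosed.Build free tens_span tens_span_zmod_closed.

Definition tensor := Quotient.quot tens_span.
HB.instance Definition _ := GRing.Zmodule.on tensor.

Definition tpi : free -> tensor := locked \pi_(Quotient.quot tens_span).

Lemma tpi_eq x y : reflect (tpi x = tpi y) (x - y \in tens_span).
Proof. by rewrite /tpi -lock Quotient.idealrBE; apply: eqP. Qed.

Lemma tpi_repr (u : tensor) : tpi (repr (u : Quotient.quot tens_span)) = u.
Proof. by rewrite /tpi -lock; apply: reprK. Qed.

Lemma tpiP (P : tensor -> Prop) : (forall x, P (tpi x)) -> forall u, P u.
Proof. by move=> H u; rewrite -(tpi_repr u). Qed.

Lemma tpiB : {morph tpi : x y / x - y}.
Proof. by move=> x y; rewrite /tpi -lock raddfB. Qed.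
HB.instance Definition _ := GRing.isZmodMorphism.Build _ _ tpi tpiB.

Definition tens_scale : R -> tensor -> tensor := locked (fun k u =>
  tpi (k *: repr (u : Quotient.quot tens_span))).

Lemma tpi_scale k x : tens_scale k (tpi x) = tpi (k *: x).
Proof.
rewrite /tens_scale -lock; set x' := repr _.
have Ix : x' - x \in tens_span by apply/tpi_eq; rewrite tpi_repr.
by apply/tpi_eq/tens_spanP; rewrite -scalerBr; apply/in_tens_spanZ/tens_spanP.
Qed.

Fact tens_scaleA a b v : tens_scale a (tens_scale b v) = tens_scale (a * b) v.
Proof. by elim/tpiP: v => x; rewrite !tpi_scale scalerA. Qed.
Fact tens_scale1 : left_id 1 tens_scale.
Proof. by elim/tpiP=> x; rewrite tpi_scale scale1r. Qed.
Fact tens_scaleDr : right_distributive tens_scale +%R.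
Proof. by move=> a; do 2!elim/tpiP=> ?; rewrite -raddfD !tpi_scale -raddfD scalerDr. Qed.
Fact tens_scaleDl v : {morph tens_scale^~ v : a b / a + b}.
Proof. by elim/tpiP: v => x a b; rewrite !tpi_scale -raddfD scalerDl. Qed.
HB.instance Definition _ := GRing.Zmodule_isLmodule.Build R tensor
  tens_scaleA tens_scale1 tens_scaleDr tens_scaleDl.

Lemma tpiZ : scalable tpi.
Proof. by move=> k x; rewrite -tpi_scale. Qed.
HB.instance Definition _ := GRing.isScalable.Build R free tensor *:%R tpi tpiZ.

Definition tens : M -> N -> tensor := locked (fun x y => tpi << (x, y) >>).

Lemma tens_linearl y : linear (tens^~ y).
Proof.
move=> a x x'; rewrite /tens -lock -linearP; apply/tpi_eq/tens_spanP.
rewrite -[X in in_tens_span X]addr0 -[X in in_tens_span (X + _)]scale1r.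
exact: (in_tens_span_add 1 (tens_rel_l a x x' y) in_tens_span0).
Qed.

Lemma tens_linearr x : linear (tens x).
Proof.
move=> a y y'; rewrite /tens -lock -linearP; apply/tpi_eq/tens_spanP.
rewrite -[X in in_tens_span X]addr0 -[X in in_tens_span (X + _)]scale1r.
exact: (in_tens_span_add 1 (tens_rel_r a x y y') in_tens_span0).
Qed.

(* The linear map induced by a bilinear f (see tliftE and tlift_linear); it is
   meaningless when f is not bilinear. *)
Definition tlift (P : lmodType R) (f : M -> N -> P) : tensor -> P :=
  locked (fun u => let x := repr (u : Quotient.quot tens_span) in
    \sum_(k <- msupp x) x@_k *: f k.1 k.2).

Section Lift.
Variables (P : lmodType R) (f : M -> N -> P).
Hypotheses (fl : forall y, linear (f^~ y)) (fr : forall x, linear (f x)).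

Let ext (x : free) : P := \sum_(k <- msupp x) x@_k *: f k.1 k.2.

Let extEw (d : {fset (M * N)%type}) (x : free) : (msupp x `<=` d)%fset ->
  ext x = \sum_(k <- d) x@_k *: f k.1 k.2.
Proof.
move=> le; rewrite [LHS](big_fset_incl _ le) => //= k kd /mcoeff_outdom ->.
by rewrite scale0r.
Qed.

Let ext_linear : linear ext.
Proof.
move=> a x y; have dz := msuppD_le (a *: x) y.
have dx : (msupp x `<=` msupp x `|` msupp y)%fset by exact: fsubsetUl.
have dy : (msupp y `<=` msupp x `|` msupp y)%fset by exact: fsubsetUr.
have dax : (msupp (a *: x + y) `<=` msupp x `|` msupp y)%fset.
  apply: (fsubset_trans dz); rewrite fsubUset dy andbT.
  exact: fsubset_trans (msuppZ_le _ _) dx.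
rewrite (extEw dax) (extEw dx) (extEw dy) scaler_sumr -big_split /=.
by apply: eq_bigr => k _; rewrite mcoeffD mcoeffZ scalerDl scalerA.
Qed.

Let extU k : ext << k >> = f k.1 k.2.
Proof. by rewrite (extEw (msuppU_le)) big_seq_fset1 mcoeffUU scale1r. Qed.

Let extB x y : ext (x - y) = ext x - ext y.
Proof. by rewrite -[- y]scaleN1r [_ + _]addrC ext_linear scaleN1r addrC. Qed.

Let ext0 x : in_tens_span x -> ext x = 0.
Proof.
elim=> [|k s {}x Ss _ IH]; first by rewrite /ext msupp0 big_seq_fset0.
rewrite ext_linear IH addr0.
case: Ss => [a y y' z|a y z z']; rewrite extB ext_linear !extU /=.
  by rewrite fl subrr scaler0.
by rewrite fr subrr scaler0.
Qed.

Let tlift_pi x : tlift f (tpi x) = ext x.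
Proof.
rewrite /tlift -lock -/(ext _); set x' := repr _.
have /tpi_eq/tens_spanP/ext0 : tpi x' = tpi x by rewrite tpi_repr.
by rewrite extB => /subr0_eq.
Qed.

Lemma tliftE x y : tlift f (tens x y) = f x y.
Proof. by rewrite /tens -lock tlift_pi extU. Qed.

Lemma tlift_linear : linear (tlift f).
Proof.
by move=> a; do 2!elim/tpiP=> ?; rewrite -linearP !tlift_pi ext_linear.
Qed.
End Lift.
End TensorProduct.

Notation "x ⊗ y" := (tens x y) (at level 40, no associativity) : ring_scope.

Section TensorInduction.
Variables (R : comNzRingType) (M N : lmodType R).

Lemma tens_ind (P : tensor M N -> Prop) :
  P 0 -> (forall x y u, P u -> P (x ⊗ y + u)) -> forall u, P u.
Proof.
move=> P0 PD; elim/tpiP=> x; rewrite [x]monalgE raddf_sum /=.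
elim: (finmap.enum_fset _) => [|k s IH]; first by rewrite big_nil.
rewrite big_cons.
suff -> : tpi << x@_k *g k >> = (x@_k *: k.1) ⊗ k.2 by apply: PD.
have -> : (x@_k *: k.1) ⊗ k.2 = x@_k *: (k.1 ⊗ k.2).
  have L := tens_linearl k.2.
  have L0 : (0 : M) ⊗ k.2 = 0.
    by apply: (addIr (0 ⊗ k.2)); rewrite add0r -{1}[0 ⊗ k.2]scale1r -L scaler0 addr0.
  by rewrite -{1}[_ *: k.1]addr0 L L0 addr0.
rewrite /tens -lock -linearZ /=; congr tpi; rewrite -surjective_pairing.
by apply/malgP=> k'; rewrite mcoeffZ !mcoeffU mulrnAr mulr1.
Qed.
End TensorInduction.

Section TensorAlgebra.
Variables (R : comNzRingType) (B C : algType R).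
Local Notation T := (tensor B C).

(* (b ⊗ c) (b' ⊗ c') = b b' ⊗ c c', see tens_mulE *)
Definition tens_mul : T -> T -> T := locked (fun u v =>
  tlift (fun b c => tlift (fun b' c' => (b * b') ⊗ (c * c')) v) u).

Let tmll (b : B) (c c' : C) : linear (fun b' : B => (b * b') ⊗ (c * c')).
Proof. by move=> a x y; rewrite mulrDr -scalerAr tens_linearl. Qed.
Let tmlr (b : B) (c : C) (b' : B) : linear (fun c' : C => (b * b') ⊗ (c * c')).
Proof. by move=> a x y; rewrite mulrDr -scalerAr tens_linearr. Qed.

Let tm (b : B) (c : C) (v : T) : T := tlift (fun b' c' => (b * b') ⊗ (c * c')) v.
Let tmE b c b' c' : tm b c (b' ⊗ c') = (b * b') ⊗ (c * c').
Proof. exact: (tliftE (tmll b c) (tmlr b c)). Qed.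
Let tm_lin b c : linear (tm b c).
Proof. exact: (tlift_linear (tmll b c) (tmlr b c)). Qed.
Let tm0 b c : tm b c 0 = 0.
Proof. by apply: (addIr (tm b c 0)); rewrite add0r -{1}[tm b c 0]scale1r -tm_lin scaler0 addr0. Qed.
Let tmD b c u v : tm b c (u + v) = tm b c u + tm b c v.
Proof. by rewrite -[u]scale1r tm_lin !scale1r. Qed.

Let tm_linl v c : linear (fun b => tm b c v).
Proof.
move=> a x y; elim/tens_ind: v => [|b' c' u IH]; first by rewrite !tm0 scaler0 addr0.
rewrite !tmD IH !tmE mulrDl -scalerAl tens_linearl scalerDr.
by rewrite -!addrA; congr (_ + _); rewrite addrCA.
Qed.
Let tm_linr v b : linear (fun c => tm b c v).
Proof.
move=> a x y; elim/tens_ind: v => [|b' c' u IH]; first by rewrite !tm0 scaler0 addr0.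
rewrite !tmD IH !tmE mulrDl -scalerAl tens_linearr scalerDr.
by rewrite -!addrA; congr (_ + _); rewrite addrCA.
Qed.

Let tmulE b c v : tens_mul (b ⊗ c) v = tm b c v.
Proof. by rewrite /tens_mul -lock; apply: (tliftE (tm_linl v) (tm_linr v)). Qed.
Let tmul_lin v : linear (tens_mul^~ v).
Proof.
by rewrite /tens_mul -lock; apply: (tlift_linear (tm_linl v) (tm_linr v)).
Qed.

Lemma tens_mulE b c b' c' : tens_mul (b ⊗ c) (b' ⊗ c') = (b * b') ⊗ (c * c').
Proof. by rewrite tmulE tmE. Qed.

Fact tens_mulDl : left_distributive tens_mul +%R.
Proof. by move=> u v w; rewrite -[u]scale1r tmul_lin !scale1r. Qed.

Let tens_mul0l v : tens_mul 0 v = 0.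
Proof. by apply: (addIr (tens_mul 0 v)); rewrite add0r -tens_mulDl addr0. Qed.

Fact tens_mulDr : right_distributive tens_mul +%R.
Proof.
move=> w u v; elim/tens_ind: w => [|b c w IH]; first by rewrite !tens_mul0l addr0.
by rewrite !tens_mulDl IH !tmulE tmD addrACA.
Qed.

Let tens_mul0r v : tens_mul v 0 = 0.
Proof. by apply: (addIr (tens_mul v 0)); rewrite add0r -tens_mulDr addr0. Qed.

Fact tens_mulA : associative tens_mul.
Proof.
move=> u v w; elim/tens_ind: u => [|b c u IH]; first by rewrite !tens_mul0l.
rewrite !tens_mulDl {}IH; congr (_ + _).
elim/tens_ind: v => [|b1 c1 v IH]; first by rewrite !(tens_mul0l, tens_mul0r).
rewrite !(tens_mulDl, tens_mulDr) {}IH; congr (_ + _).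
elim/tens_ind: w => [|b2 c2 w IH]; first by rewrite !tens_mul0r.
by rewrite !tens_mulDr {}IH; congr (_ + _); rewrite !tens_mulE !mulrA.
Qed.

Fact tens_mul1l : left_id (1 ⊗ 1) tens_mul.
Proof.
elim/tens_ind=> [|b c u IH]; first by rewrite tens_mul0r.
by rewrite tens_mulDr IH tens_mulE !mul1r.
Qed.

Fact tens_mul1r : right_id (1 ⊗ 1) tens_mul.
Proof.
elim/tens_ind=> [|b c u IH]; first by rewrite tens_mul0l.
by rewrite tens_mulDl IH tens_mulE !mulr1.
Qed.

HB.instance Definition _ := GRing.Zmodule_isPzRing.Build T
  tens_mulA tens_mul1l tens_mul1r tens_mulDl tens_mulDr.
End TensorAlgebra.

Definition noncommutative (H : pzRingType) := exists x y : H, x * y <> y * x.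

Section Hopf.
Variables (A : comNzRingType) (H : algType A).

(* tensor (tensor H H) H -> tensor H (tensor H H) *)
Definition tens_assoc : tensor (tensor H H) H -> tensor H (tensor H H) :=
  tlift (fun u z => tlift (fun x y => x ⊗ (y ⊗ z)) u).

Definition tens_flip : tensor H H -> tensor H H := tlift (fun x y => y ⊗ x).

Record is_hopf_algebra
    (Delta : H -> tensor H H) (eps : H -> A) (S : H -> H) : Prop := {
  hopf_Delta_linear : linear Delta;
  hopf_Delta_mul : monoid_morphism Delta;
  hopf_eps_linear : scalar eps;
  hopf_eps_mul : monoid_morphism eps;
  hopf_S_linear : linear S;
  hopf_coassoc : forall x,
    tens_assoc (tlift (fun y z => Delta y ⊗ z) (Delta x))
    = tlift (fun y z => y ⊗ Delta z) (Delta x);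
  hopf_counitl : forall x, tlift (fun y z => eps y *: z) (Delta x) = x;
  hopf_counitr : forall x, tlift (fun y z => eps z *: y) (Delta x) = x;
  hopf_antipodel : forall x, tlift (fun y z => S y * z) (Delta x) = (eps x)%:A;
  hopf_antipoder : forall x, tlift (fun y z => y * S z) (Delta x) = (eps x)%:A
}.

Definition noncocommutative (Delta : H -> tensor H H) :=
  exists x, tens_flip (Delta x) <> Delta x.

(* rising a x l is x_a^<l> *)
Definition rising (a : A) (x : H) (l : nat) : H :=
  \prod_(j < l) (x + a%:A + j%:R).
End Hopf.

Section JacobsonWitt.
Variables (K : fieldType) (p n : nat).

Definition midx := {ffun 'I_n -> 'I_p}.

(* The divided power algebra O(n;1), in coordinates on the basis x^(a). The
   copy of the function space hides its pointwise product. *)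
Definition dpow := {ffun midx -> K^o}.
HB.instance Definition _ := GRing.Lmodule.on dpow.

(* x^(a), which is 0 as soon as some a i >= p *)
Definition dmon (a : 'I_n -> nat) : dpow :=
  [ffun g : midx => [forall i, g i == a i :> nat]%:R].

Definition dmul (f g : dpow) : dpow :=
  \sum_(a : midx) \sum_(b : midx)
    (f a * g b * (\prod_i 'C(a i + b i, a i))%:R) *: dmon (fun i => a i + b i)%N.

Definition dder (j : 'I_n) (f : dpow) : dpow :=
  \sum_(a : midx | (0 < a j)%N) f a *: dmon (fun i => a i - (i == j))%N.

(* E : jw stands for the derivation \sum_i E i * D_i *)
Definition jw := {ffun 'I_n -> dpow}.
HB.instance Definition _ := GRing.Lmodule.on jw.

Definition jw_act (E : jw) (f : dpow) : dpow := \sum_i dmul (E i) (dder i f).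

(* the D_j-coordinate of the commutator E F - F E *)
Definition jw_br (E F : jw) : jw :=
  [ffun j => jw_act E (F j) - jw_act F (E j)].

Definition xD (a : 'I_n -> nat) (i : 'I_n) : jw :=
  [ffun j => if j == i then dmon a else 0].

Definition ei (i : 'I_n) : 'I_n -> nat := fun j => (j == i).

(* the operator d^(l) = (ad e)^l / l! *)
Definition ad_div (e : jw) (l : nat) (x : jw) : jw :=
  (l`!%:R)^-1 *: iter l (jw_br e) x.

Variant res_rel : env_alg jw_br -> Prop :=
| res_rel_toral i :
    res_rel (env_in jw_br (xD (ei i) i) ^+ p - env_in jw_br (xD (ei i) i))
| res_rel_nil (a : midx) i :
    ~ (forall j, a j = ei i j :> nat) -> res_rel (env_in jw_br (xD (fun j => a j) i) ^+ p).

Lemma res_rel_aug s : (0 < p)%N -> res_rel s -> env_aug s = 0.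
Proof.
move=> p0; case=> [i|a i _]; rewrite ?rmorphB rmorphXn /= !env_aug_in ?subr0;
  by rewrite expr0n gtn_eqF.
Qed.
End JacobsonWitt.

Arguments jw_br {K p n}.
Arguments res_rel {K p n}.

(* The proof argument is only there to make the quotient provably nonzero. *)
Definition ujw (K : fieldType) (p n : nat) of p \in [pchar K] :=
  quot_alg (@res_rel K p n).

(* The quotient is that of the polynomial ring: it has dimension p for all q,
   whereas t^(p-1) - q is a unit of K[[t]] when q != 0. *)
Definition ktrunc (K : fieldType) (p : nat) (q : K) := {poly %/ 'X^p - q *: 'X}.
HB.instance Definition _ K p q := GRing.ComNzRing.on (@ktrunc K p q).
HB.instance Definition _ K p q := GRing.Algebra.on (@ktrunc K p q).

Definition ktrunc_t (K : fieldType) (p : nat) (q : K) : ktrunc p q := in_qpoly _ 'X.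

Section RestrictedEnveloping.
Variables (K : fieldType) (p n : nat) (charK : p \in [pchar K]) (A : comAlgType K).
Local Notation u := (ujw n charK).

HB.instance Definition _ := GRing.PzRing.on u.
HB.instance Definition _ := GRing.Lmodule.on u.

Let rel_aug s : @res_rel K p n s -> env_aug s = 0.
Proof. exact/res_rel_aug/prime_gt0/(pcharf_prime charK). Qed.

HB.instance Definition _ := GRing.PzSemiRing_isNonZero.Build u (quot_neq0 rel_aug).
HB.instance Definition _ :=
  GRing.Lmodule_isLalgebra.Build K u (@quot_scaleAl _ _ res_rel).
HB.instance Definition _ :=
  GRing.Lalgebra_isAlgebra.Build K u (@quot_scaleAr _ _ res_rel).

Definition ujw_in (x : jw K p n) : u := qpi res_rel (env_in jw_br x).

(* The scalar extension of u to A. Its canonical module structure is the one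
   over A; the one over K is that of tensor u A. *)
Definition ujwA := tensor u A.
HB.instance Definition _ := GRing.PzRing.on ujwA.

Let aug : u -> K := quot_aug (@env_aug _ _ (@jw_br K p n)).
Let augE (x : u) (a : A) : tlift (fun (x : u) (a : A) => aug x *: a) (x ⊗ a) = aug x *: a.
Proof.
apply: (tliftE (f := fun (x : u) (a : A) => aug x *: a)) => [b k y z|y k b c].
  have -> : aug (k *: y + z) = k * aug y + aug z.
    by rewrite /aug (quot_augD rel_aug) (quot_augZ (@env_augZ _ _ _) rel_aug).
  by rewrite scalerDl scalerA.
by rewrite scalerDr !scalerA mulrC.
Qed.

Fact ujwA_neq0 : (1 : ujwA) != 0.
Proof.
apply/eqP=> /(congr1 (tlift (fun (x : u) (a : A) => aug x *: a))).
rewrite [X in _ = X](_ : _ = 0) => [|].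
  rewrite [X in X = _](augE 1 1) /aug (quot_augM rel_aug).1 scale1r => /eqP.
  by rewrite oner_eq0.
have -> : (0 : ujwA) = (0 : u) ⊗ (0 : A).
  apply: (addIr ((0 : u) ⊗ (0 : A))); rewrite add0r.
  by have := tens_linearl (0 : A) 1 (0 : u) 0; rewrite !scale1r addr0 => /esym.
by rewrite augE scaler0.
Qed.
HB.instance Definition _ := GRing.PzSemiRing_isNonZero.Build ujwA ujwA_neq0.

Definition ujwA_scale (a : A) (z : ujwA) : ujwA := ((1 : u) ⊗ a : ujwA) * z.

Let tmulE (x y : u) (a b : A) : (x ⊗ a : ujwA) * (y ⊗ b : ujwA) = (x * y) ⊗ (a * b).
Proof. exact: tens_mulE. Qed.

Fact ujwA_scaleA a b z : ujwA_scale a (ujwA_scale b z) = ujwA_scale (a * b) z.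
Proof. by rewrite /ujwA_scale mulrA tmulE mulr1. Qed.
Fact ujwA_scale1 : left_id 1 ujwA_scale.
Proof. by move=> z; rewrite /ujwA_scale mul1r. Qed.
Fact ujwA_scaleDr : right_distributive ujwA_scale +%R.
Proof. by move=> a z w; rewrite /ujwA_scale mulrDr. Qed.
Fact ujwA_scaleDl z : {morph ujwA_scale^~ z : a b / a + b}.
Proof.
move=> a b; rewrite /ujwA_scale -mulrDl; congr (_ * _).
by have := tens_linearr (1 : u) 1 a b; rewrite !scale1r.
Qed.
HB.instance Definition _ := GRing.Zmodule_isLmodule.Build A ujwA
  ujwA_scaleA ujwA_scale1 ujwA_scaleDr ujwA_scaleDl.

Fact ujwA_scaleAl (a : A) (z w : ujwA) :
  ujwA_scale a (z * w) = ujwA_scale a z * w.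
Proof. exact: mulrA. Qed.
HB.instance Definition _ := GRing.Lmodule_isLalgebra.Build A ujwA ujwA_scaleAl.

Fact ujwA_scaleAr (a : A) (z w : ujwA) :
  ujwA_scale a (z * w) = z * ujwA_scale a w.
Proof.
suff aC : ((1 : u) ⊗ a : ujwA) * z = z * ((1 : u) ⊗ a : ujwA).
  by rewrite /ujwA_scale !mulrA aC.
elim/tens_ind: z => [|x b z IH]; first by rewrite [LHS]mulr0 [RHS]mul0r.
rewrite [LHS]mulrDr [RHS]mulrDl IH; congr (_ + _).
by rewrite [LHS]tmulE [RHS]tmulE mul1r mulr1 mulrC.
Qed.
HB.instance Definition _ := GRing.Lalgebra_isAlgebra.Build A ujwA ujwA_scaleAr.

(* Inverses are chosen classically, so that z ^ m makes sense for m : int. *)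
Let invertible (z : ujwA) := exists w, w * z = 1 /\ z * w = 1.
Definition ujwA_unit : pred ujwA := fun z => `[< invertible z >].
Definition ujwA_inv (z : ujwA) : ujwA :=
  if pselect (invertible z) is left P then projT1 (cid P) else z.

Let ujwA_invP z : z \in ujwA_unit -> ujwA_inv z * z = 1 /\ z * ujwA_inv z = 1.
Proof.
move=> /asboolP P; rewrite /ujwA_inv; case: pselect => // P'.
by case: (cid P').
Qed.
Fact ujwA_mulVr : {in ujwA_unit, left_inverse 1 ujwA_inv *%R}.
Proof. by move=> z /ujwA_invP[]. Qed.
Fact ujwA_divrr : {in ujwA_unit, right_inverse 1 ujwA_inv *%R}.
Proof. by move=> z /ujwA_invP[]. Qed.
Fact ujwA_unitP z w : w * z = 1 /\ z * w = 1 -> ujwA_unit z.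
Proof. by move=> P; apply/asboolP; exists w. Qed.
Fact ujwA_inv_out : {in [predC ujwA_unit], ujwA_inv =1 id}.
Proof.
move=> z; rewrite /ujwA_inv; case: pselect => // P /negP[]; exact/asboolP.
Qed.
HB.instance Definition _ := GRing.NzRing_hasMulInverse.Build ujwA
  ujwA_mulVr ujwA_divrr ujwA_unitP ujwA_inv_out.

Definition ujwA_in (x : jw K p n) : ujwA := ujw_in x ⊗ (1 : A).
End RestrictedEnveloping.

(* Main.v *)
Require Import Defs.
From HB Require Import structures.
From mathcomp Require Import all_boot all_order all_algebra.
From mathcomp Require Import finfield finmap boolp monalg.
From mathcomp Require Import ring zify.

Set Implicit Arguments.
Unset Strict Implicit.
Unset Printing Implicit Defensive.

Import GRing.Theory.
Local Open Scope ring_scope.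

(** The Hopf structure is the Drinfeld twist of the usual cocommutative one, and the
    twist becomes elementary once it is diagonalised.

    Put [T = t e], so that [T ^+ p = 0] and [[h, T] = T]. The element [g = 1 - T]
    ([grp], with powers [grpX]) satisfies [g ^+ p = 1], and [h ^+ p = h] makes [h]
    diagonalisable with eigenvalues in the prime field: the projectors [π_a = 1 - (h - a) ^+ p.-1], for [a] in ['F_p],
    are orthogonal idempotents of sum [1] ([eigproj_sum], [eigproj_mul]). The twist,
    formally [(1 ⊗ g) ^ (h ⊗ 1)], is therefore the finite sum [\sum_a π_a ⊗ g ^ a],
    with inverse [\sum_a π_a ⊗ g ^ (- a)]; no division by a factorial is involved.
    Conjugating the primitive coproduct by it sends [x] of weight [m] for [ad h] to
    [x ⊗ g ^ m + \sum_a π_a ⊗ g ^ a x g ^ (- a)] ([coproduct_prim]). It makes [g]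
    grouplike and sends [π_c] to [\sum_a π_a ⊗ g ^ a π_(c - a) g ^ (- a)], which is all
    that coassociativity on the generators needs ([coproduct_coassoc]). The antipode is
    the primitive one conjugated by [w = \sum_a π_a g ^ a], which is invertible because
    it behaves as the binomial series [(1 - T) ^ h] ([antipode_elt_inv_r]). Since all
    the axioms are compatible with products, they are checked on generators only
    ([twist_hopf]).

    The closed formulas are binomial expansions: right multiplication by [g] is left
    multiplication by [g] plus [ad T], and these two commute ([mul_expr_ad]); the rising
    factorials of [h] are the binomial coefficients read on the eigenspaces of [h]
    ([coproduct_formula], [antipode_formula]).

    Everything above requires algebra maps out of the restricted enveloping algebra [u],
    obtained from its presentation ([ujw_lift], [ujwA_lift]), and tensor products that
    can be iterated ([AugAlgebra]). Non-triviality comes from the action on the divided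
    powers ([ujw_rep]), which has to respect the [p]-th power relations: its matrix
    coefficients show that [[h, D_k] <> 0] and that [T <> 0] when [p <> 2], and [T <> 0]
    prevents the coproduct of [h] from being symmetric ([coproduct_noncocommutative]).

    The dimension is the restricted Poincare-Birkhoff-Witt theorem. Reordering letters
    and using [y ^+ p = y] or [y ^+ p = 0] shows that the ordered monomials with
    exponents less than [p] span ([pbw_surj]). For their independence, let [xi_i] be
    linear forms on [u] which vanish at [1] and are dual to the generators; again they
    are matrix coefficients. The convolution product of [N] of these forms kills the
    words of length less than [N], and on words of length [N] it is the indicator
    function of a permutation class times the factorials of the multiplicities
    ([xis_word]). These are less than [p] in an ordered monomial, so the convolution
    product of the forms of a monomial of maximal length in a relation isolates the
    coefficient of that monomial ([pbw_inj]). *)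

(** * Tensor products of modules and of augmented algebras *)

Section TensorModule.
Variables (R : comNzRingType) (M N : lmodType R).
Implicit Types (x : M) (y : N).

Lemma tensDl x x' y : (x + x') ⊗ y = x ⊗ y + x' ⊗ y.
Proof. by have := tens_linearl y 1 x x'; rewrite !scale1r. Qed.
Lemma tensDr x y y' : x ⊗ (y + y') = x ⊗ y + x ⊗ y'.
Proof. by have := tens_linearr x 1 y y'; rewrite !scale1r. Qed.
Lemma tens0l y : (0 : M) ⊗ y = 0.
Proof. by apply: (addIr (0 ⊗ y)); rewrite add0r -tensDl addr0. Qed.
Lemma tens0r x : x ⊗ (0 : N) = 0.
Proof. by apply: (addIr (x ⊗ 0)); rewrite add0r -tensDr addr0. Qed.
Lemma tensZl a x y : (a *: x) ⊗ y = a *: (x ⊗ y).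
Proof. by have := tens_linearl y a x 0; rewrite !addr0 tens0l addr0. Qed.
Lemma tensZr a x y : x ⊗ (a *: y) = a *: (x ⊗ y).
Proof. by have := tens_linearr x a y 0; rewrite !addr0 tens0r addr0. Qed.
Lemma tensNl x y : (- x) ⊗ y = - (x ⊗ y).
Proof. by rewrite -scaleN1r tensZl scaleN1r. Qed.
Lemma tensNr x y : x ⊗ (- y) = - (x ⊗ y).
Proof. by rewrite -scaleN1r tensZr scaleN1r. Qed.
Lemma tens_suml I (r : seq I) (P : pred I) (F : I -> M) y :
  (\sum_(i <- r | P i) F i) ⊗ y = \sum_(i <- r | P i) F i ⊗ y.
Proof. by elim/big_rec2: _ => [|i z x _ <-]; rewrite ?tens0l ?tensDl. Qed.
Lemma tens_sumr I (r : seq I) (P : pred I) (F : I -> N) x :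
  x ⊗ (\sum_(i <- r | P i) F i) = \sum_(i <- r | P i) x ⊗ F i.
Proof. by elim/big_rec2: _ => [|i z y _ <-]; rewrite ?tens0r ?tensDr. Qed.
End TensorModule.

Section LinearProp.
Variables (R : comNzRingType) (M N : lmodType R) (f : M -> N).
Hypothesis fl : linear f.
Lemma lin0 : f 0 = 0.
Proof. by rewrite -[0](addNr 0) -scaleN1r fl !scaleN1r addNr. Qed.
Lemma linD x y : f (x + y) = f x + f y.
Proof. by have := fl 1 x y; rewrite !scale1r. Qed.
Lemma linZ a x : f (a *: x) = a *: f x.
Proof. by have := fl a x 0; rewrite !addr0 lin0 addr0. Qed.
Lemma linN x : f (- x) = - f x.
Proof. by rewrite -scaleN1r linZ scaleN1r. Qed.
Lemma linB x y : f (x - y) = f x - f y.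
Proof. by rewrite linD linN. Qed.
Lemma lin_sum I (r : seq I) (P : pred I) (F : I -> M) :
  f (\sum_(i <- r | P i) F i) = \sum_(i <- r | P i) f (F i).
Proof. by elim/big_rec2: _ => [|i z x _ <-]; rewrite ?lin0 ?linD. Qed.
End LinearProp.

(** An augmentation is what forces [1 <> 0] in a tensor product of algebras, so
    that the tensor product is an algebra again and can be iterated. *)
HB.mixin Record isAugmented (R : comNzRingType) B of GRing.Algebra R B := {
  aug : B -> R;
  aug_scalar : scalar aug;
  aug_monoid : monoid_morphism aug
}.
#[short(type="augAlgType")]
HB.structure Definition AugAlgebra (R : comNzRingType) :=
  {B of GRing.Algebra R B & isAugmented R B}.

Section TensorAlgebra.
Variables (R : comNzRingType).

Section Ring.
Variables B C : algType R.
Lemma tensM (x x' : B) (y y' : C) : (x ⊗ y) * (x' ⊗ y') = (x * x') ⊗ (y * y').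
Proof. exact: tens_mulE. Qed.
Lemma tens1 : (1 : tensor B C) = 1 ⊗ 1. Proof. by []. Qed.

Fact tens_scaleAl (k : R) (u v : tensor B C) : k *: (u * v) = (k *: u) * v.
Proof.
elim/tens_ind: u => [|x y u IH]; first by rewrite mul0r !scaler0 mul0r.
rewrite mulrDl !scalerDr {}IH mulrDl; congr (_ + _).
elim/tens_ind: v => [|x' y' v IHv]; first by rewrite !mulr0 scaler0.
by rewrite !mulrDr scalerDr IHv -tensZl !tensM -tensZl scalerAl.
Qed.
Fact tens_scaleAr (k : R) (u v : tensor B C) : k *: (u * v) = u * (k *: v).
Proof.
elim/tens_ind: u => [|x y u IH]; first by rewrite !mul0r scaler0.
rewrite mulrDl !scalerDr {}IH mulrDl; congr (_ + _).
elim/tens_ind: v => [|x' y' v IHv]; first by rewrite !(mulr0, scaler0).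
by rewrite !mulrDr !scalerDr !mulrDr IHv -!tensZl !tensM -tensZl scalerAr.
Qed.

(** Morphisms out of a tensor product of algebras are checked on pure tensors. *)
Lemma tliftM (P : algType R) (f : B -> C -> P) :
  (forall y, linear (f^~ y)) -> (forall x, linear (f x)) -> f 1 1 = 1 ->
  (forall x y x' y', f (x * x') (y * y') = f x y * f x' y') ->
  monoid_morphism (tlift f).
Proof.
move=> fl fr f1 fM; have L := tlift_linear fl fr; split.
  by rewrite tens1 tliftE.
move=> u v; elim/tens_ind: u => [|x y u IH]; first by rewrite mul0r (lin0 L) mul0r.
rewrite mulrDl !(linD L) mulrDl {}IH; congr (_ + _).
elim/tens_ind: v => [|x' y' v IHv]; first by rewrite mulr0 (lin0 L) mulr0.
by rewrite mulrDr !(linD L) mulrDr IHv tensM !tliftE // fM.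
Qed.
End Ring.

Section Aug.
Variables B C : augAlgType R.
Local Notation T := (tensor B C).
Definition tens_aug : T -> R := tlift (fun (x : B) (y : C) => aug x * aug y : R^o).

Let al (y : C) : linear (fun x : B => aug x * aug y : R^o).
Proof. by move=> a x x'; rewrite aug_scalar mulrDl scalerAl. Qed.
Let ar (x : B) : linear (fun y : C => aug x * aug y : R^o).
Proof. by move=> a y y'; rewrite aug_scalar mulrDr scalerAr. Qed.

Lemma tens_aug_scalar : scalar tens_aug.
Proof. exact: (tlift_linear al ar). Qed.
Lemma tens_aug_monoid : monoid_morphism tens_aug.
Proof.
apply: (@tliftM B C R^o _ al ar) => [|x y x' y'].
  by rewrite !aug_monoid.1 mulr1.
by rewrite !aug_monoid.2 mulrACA.
Qed.
Lemma tens_neq0 : (1 : T) != 0.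
Proof.
apply/eqP=> /(congr1 tens_aug); rewrite tens_aug_monoid.1.
by rewrite (@lin0 R T R^o tens_aug tens_aug_scalar) => /eqP; rewrite oner_eq0.
Qed.
HB.instance Definition _ := GRing.PzSemiRing_isNonZero.Build T tens_neq0.
HB.instance Definition _ := GRing.Lmodule_isLalgebra.Build R T (@tens_scaleAl B C).
HB.instance Definition _ := GRing.Lalgebra_isAlgebra.Build R T (@tens_scaleAr B C).
HB.instance Definition _ := isAugmented.Build R T tens_aug_scalar tens_aug_monoid.
End Aug.
End TensorAlgebra.

(** * Universal properties of the enveloping algebras *)

Section Lifts.
Variable R : comNzRingType.

Lemma quot_lift (B C : algType R) (S : B -> Prop) (f : B -> C) :
    linear f -> monoid_morphism f -> (forall s, S s -> f s = 0) ->
  exists F : quot_alg S -> C,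
    [/\ linear F, monoid_morphism F & forall x, F (qpi S x) = f x].
Proof.
move=> fl [f1 fM] fS.
pose F (u : quot_alg S) := f (repr (u : Quotient.quot (ideal_of S))).
have FE x : F (qpi S x) = f x.
  apply/eqP; rewrite -subr_eq0 /F -(linB fl).
  have /qpi_eq/ideal_ofP : qpi S (repr (qpi S x : Quotient.quot (ideal_of S))) = qpi S x.
    by rewrite qpi_repr.
  elim=> [|a s b y Ss _ IH]; first by rewrite (lin0 fl).
  by rewrite (linD fl) !fM (fS _ Ss) mulr0 mul0r add0r.
exists F; split=> //.
  by move=> k; do 2!elim/qpiP=> ?; rewrite -qpiZ -raddfD !FE fl.
split; first by rewrite -[1]/(qpi S 1) FE.
by elim/qpiP=> x; elim/qpiP=> y; rewrite -qpiM !FE.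
Qed.

(** Words are sent to products; the scalars of the target are central, which makes
    this multiplicative. *)
Lemma free_lift (X : choiceType) (C : algType R) (f : X -> C) :
  exists F : free_alg R X -> C,
    [/\ linear F, monoid_morphism F & forall x, F (free_gen R x) = f x].
Proof.
pose h (m : {fmonom X}) : C := \prod_(x <- (m : seq X)) f x.
have h1 : h (@mone _) = 1 by rewrite /h fm1 big_nil.
have hM a b : h (mmul a b) = h a * h b by rewrite /h fmM big_cat.
have hm : mmorphism h by split.
pose h' : {mmorphism {fmonom X} -> C} := HB.pack h (monalg.isMultiplicative.Build _ _ h hm).
pose F : free_alg R X -> C := mmap (in_alg C) h'.
have FD x y : F (x + y) = F x + F y by exact: mmapD.
have FZ k x : F (k *: x) = k *: F x.
  by rewrite /F; have := @mmapZ _ _ _ (in_alg C) h' k x; rewrite mulr_algl.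
exists F; split.
- by move=> k x y; rewrite FD FZ.
- have cF (g : {malg R[{fmonom X}]}) m m' : GRing.comm (in_alg C g@_m) (h' m').
    by rewrite /GRing.comm /= mulr_algl mulr_algr.
  have [FM F1] := @commr_mmap_is_multiplicative _ _ _ (in_alg C) h' cF.
  by split=> [|x y]; [exact: F1 | rewrite -[x * y]/(free_mul _ _) free_mulE; exact: FM].
- move=> x; rewrite /F /free_gen -lock [LHS]mmapU /= scale1r mul1r /h.
  by rewrite fmU big_seq1.
Qed.

Lemma free_ind (X : choiceType) (P : free_alg R X -> Prop) :
  P 0 -> (forall k s y, P y -> P (k *: \prod_(x <- s) free_gen R x + y)) ->
  forall y, P y.
Proof.
move=> P0 PD y.
have W (s : seq X) : \prod_(x <- s) free_gen R x
    = << FMonom s >> :> {malg R[{fmonom X}]}.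
  elim: s => [|x s IH]; first by rewrite big_nil -[1]/(<< mone >>) /mone /= fmoneE.
  rewrite big_cons -[_ * _]/(free_mul _ _) free_mulE IH /free_gen -lock.
  rewrite -[LHS]/(fgmul _ _) fgmulUU mulr1; congr (<< _ >>).
  by apply/eqP; rewrite fmP fmM fmuE.
rewrite [y]monalgE; elim: (finmap.enum_fset _) => [|m s IH]; first by rewrite big_nil.
rewrite big_cons; have -> : << y@_m *g m >> = y@_m *: \prod_(x <- m) free_gen R x.
  rewrite W; apply/malgP=> m'; rewrite mcoeffZ !mcoeffU fmK.
  by rewrite mulrnAr mulr1.
exact: PD.
Qed.

Section Env.
Variables (g : lmodType R) (br : g -> g -> g).
Local Notation U := (env_alg br).

Lemma env_in_linear : linear (env_in br).
Proof.
move=> a x y; rewrite /env_in -qpiZ -raddfD; apply/qpi_eq/ideal_ofP.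
have := in_ideal_add 1 1 (env_rel_lin br a x y) (in_ideal0 _).
by rewrite mul1r mulr1 addr0.
Qed.

Lemma env_in_br x y : env_in br (br x y) = env_in br x * env_in br y - env_in br y * env_in br x.
Proof.
apply/esym; rewrite /env_in -!qpiM -raddfB; apply/qpi_eq/ideal_ofP.
have := in_ideal_add 1 1 (env_rel_br br x y) (in_ideal0 _).
by rewrite mul1r mulr1 addr0.
Qed.

Lemma env_lift (C : algType R) (f : g -> C) :
    linear f -> (forall x y, f (br x y) = f x * f y - f y * f x) ->
  exists F : U -> C,
    [/\ linear F, monoid_morphism F & forall x, F (env_in br x) = f x].
Proof.
move=> fl fbr; have [F [Fl FM FE]] := free_lift f.
have [|G [Gl GM GE]] := @quot_lift (free_alg R g) C (env_rel br) F Fl FM.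
  move=> s [a x y|x y]; rewrite !(linB Fl) ?(linD Fl) ?(linZ Fl) ?FM.2 !FE.
    by rewrite fl subrr.
  by rewrite fbr subrr.
by exists G; split=> // x; rewrite GE FE.
Qed.

Lemma env_ind (P : U -> Prop) :
  P 0 -> (forall k s y, P y -> P (k *: \prod_(x <- s) env_in br x + y)) ->
  forall y, P y.
Proof.
move=> P0 PD; elim/qpiP; elim/free_ind=> [|k s y IH]; first by rewrite raddf0.
rewrite raddfD /= qpiZ.
suff -> : qpi (env_rel br) (\prod_(x <- s) free_gen R x) = \prod_(x <- s) env_in br x.
  exact: PD.
elim: s => [|x s IHs]; first by rewrite !big_nil.
by rewrite !big_cons qpiM IHs.
Qed.
End Env.
End Lifts.

Section Restricted.
Variables (K : fieldType) (p n : nat) (charK : p \in [pchar K]).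
Local Notation g := (jw K p n).
Local Notation u := (ujw n charK).
Local Notation y := (@ujw_in K p n charK).

Lemma ujw_in_linear : linear y.
Proof. by move=> a x z; rewrite /ujw_in env_in_linear raddfD /= qpiZ. Qed.

Lemma ujw_in_br E F : y (jw_br E F) = y E * y F - y F * y E.
Proof. by rewrite /ujw_in env_in_br raddfB /= !qpiM. Qed.

Lemma qpiX (m : nat) (x : env_alg (@jw_br K p n)) :
  (qpi res_rel x : u) ^+ m = qpi res_rel (x ^+ m).
Proof. by elim: m => [|m IH]; rewrite ?expr0 // !exprS IH -qpiM. Qed.

Lemma ujw_in_toral i : y (xD K p (ei i) i) ^+ p = y (xD K p (ei i) i).
Proof.
rewrite /ujw_in qpiX; apply/qpi_eq/ideal_ofP.
have := in_ideal_add 1 1 (res_rel_toral K p i) (in_ideal0 _).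
by rewrite mul1r mulr1 addr0.
Qed.

Lemma ujw_in_nil (a : midx p n) i : ~ (forall j, a j = ei i j :> nat) ->
  y (xD K p (fun j => a j) i) ^+ p = 0.
Proof.
move=> ai; rewrite /ujw_in qpiX -(raddf0 (qpi res_rel)); apply/qpi_eq/ideal_ofP.
have := in_ideal_add 1 1 (res_rel_nil K ai) (in_ideal0 _).
by rewrite mul1r mulr1 addr0 subr0.
Qed.

Lemma ujw_lift (C : algType K) (f : g -> C) :
    linear f -> (forall E F, f (jw_br E F) = f E * f F - f F * f E) ->
    (forall i, f (xD K p (ei i) i) ^+ p = f (xD K p (ei i) i)) ->
    (forall (a : midx p n) i, ~ (forall j, a j = ei i j :> nat) ->
       f (xD K p (fun j => a j) i) ^+ p = 0) ->
  exists F : u -> C,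
    [/\ linear F, monoid_morphism F & forall x, F (y x) = f x].
Proof.
move=> fl fbr ft fn; have [F [Fl FM FE]] := env_lift fl fbr.
have FX m x : F (x ^+ m) = F x ^+ m.
  by elim: m => [|m IH]; rewrite ?FM.1 // !exprS FM.2 IH.
have [|G [Gl GM GE]] := @quot_lift K (env_alg jw_br) C (@res_rel K p n) F Fl FM.
  by move=> s [i|a i ai]; rewrite ?(linB Fl) FX FE ?ft ?fn // subrr.
by exists G; split=> // x; rewrite GE FE.
Qed.

Lemma ujw_ind (P : u -> Prop) :
  P 0 -> (forall k s z, P z -> P (k *: \prod_(x <- s) y x + z)) -> forall z, P z.
Proof.
move=> P0 PD; elim/qpiP; elim/env_ind=> [|k s z IH]; first by rewrite raddf0.
rewrite raddfD /= qpiZ.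
suff -> : qpi res_rel (\prod_(x <- s) env_in jw_br x) = \prod_(x <- s) y x :> u.
  exact: PD.
elim: s => [|x s IHs]; first by rewrite !big_nil.
by rewrite !big_cons qpiM IHs.
Qed.
End Restricted.

(** * Scalar extension to a commutative algebra *)

(** The type of a [K]-algebra obtained from an [A]-algebra: maps out of [u ⊗ A] are
    built from [K]-linear maps on [u] and on [A]. *)
Definition restrict_scalars (K : comNzRingType) (A : comAlgType K) (B : algType A) : Type := B.
Section RestrictScalars.
Variables (K : comNzRingType) (A : comAlgType K) (B : algType A).
Local Notation rB := (restrict_scalars B).
HB.instance Definition _ := GRing.NzRing.on rB.
Definition restrict_scale (k : K) (b : rB) : rB := (k%:A : A) *: (b : B).
Fact restrict_scaleA a b v : restrict_scale a (restrict_scale b v) = restrict_scale (a * b) v.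
Proof. by rewrite /restrict_scale scalerA -scalerAl mul1r scalerA. Qed.
Fact restrict_scale1 : left_id 1 restrict_scale.
Proof. by move=> b; rewrite /restrict_scale !scale1r. Qed.
Fact restrict_scaleDr : right_distributive restrict_scale +%R.
Proof. by move=> a x y; rewrite /restrict_scale; exact: (@scalerDr A B). Qed.
Fact restrict_scaleDl v : {morph restrict_scale^~ v : a b / a + b}.
Proof. by move=> a b; rewrite /restrict_scale scalerDl; exact: (@scalerDl A B). Qed.
HB.instance Definition _ := GRing.Zmodule_isLmodule.Build K rB
  restrict_scaleA restrict_scale1 restrict_scaleDr restrict_scaleDl.
Fact restrict_scaleAl (k : K) (x y : rB) : k *: (x * y) = (k *: x) * y.
Proof. exact: (@scalerAl A B). Qed.
HB.instance Definition _ := GRing.Lmodule_isLalgebra.Build K rB restrict_scaleAl.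
Fact restrict_scaleAr (k : K) (x y : rB) : k *: (x * y) = x * (k *: y).
Proof. exact: (@scalerAr A B). Qed.
HB.instance Definition _ := GRing.Lalgebra_isAlgebra.Build K rB restrict_scaleAr.
Lemma restrict_scaleE (k : K) (x : B) : k *: (x : rB) = ((k%:A : A) *: x : B).
Proof. by []. Qed.
End RestrictScalars.

(** The opposite algebra, so that antipodes are algebra maps into it. *)
Definition opp_alg (A : comNzRingType) (B : algType A) : Type := B^c.
Section OppAlg.
Variables (A : comNzRingType) (B : algType A).
Local Notation oB := (opp_alg B).
HB.instance Definition _ := GRing.NzRing.copy oB B^c.
Definition opp_scale (k : A) (b : oB) : oB := k *: (b : B).
Fact opp_scaleA a b v : opp_scale a (opp_scale b v) = opp_scale (a * b) v.
Proof. exact: (@scalerA A B). Qed.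
Fact opp_scale1 : left_id 1 opp_scale.
Proof. exact: (@scale1r A B). Qed.
Fact opp_scaleDr : right_distributive opp_scale +%R.
Proof. exact: (@scalerDr A B). Qed.
Fact opp_scaleDl v : {morph opp_scale^~ v : a b / a + b}.
Proof. by move=> a b; exact: (@scalerDl A B). Qed.
HB.instance Definition _ := GRing.Zmodule_isLmodule.Build A oB
  opp_scaleA opp_scale1 opp_scaleDr opp_scaleDl.
Fact opp_scaleAl (k : A) (x y : oB) : k *: (x * y) = (k *: x) * y.
Proof. exact: (@scalerAr A B). Qed.
HB.instance Definition _ := GRing.Lmodule_isLalgebra.Build A oB opp_scaleAl.
Fact opp_scaleAr (k : A) (x y : oB) : k *: (x * y) = x * (k *: y).
Proof. exact: (@scalerAl A B). Qed.
HB.instance Definition _ := GRing.Lalgebra_isAlgebra.Build A oB opp_scaleAr.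
Lemma opp_mulE (x y : B) : (x : oB) * y = (y * x : B).
Proof. by []. Qed.
Lemma opp_expE (x : B) m : (x : oB) ^+ m = (x ^+ m : B).
Proof. by elim: m => [|m IH]; rewrite ?expr0 // exprS IH opp_mulE -exprSr. Qed.
End OppAlg.

(** The augmentations are the lifts of the zero map; they make the enveloping algebra
    and its scalar extension augmented algebras. *)
Section Scalars.
Variables (K : fieldType) (p n : nat) (charK : p \in [pchar K]).
Local Notation g := (jw K p n).
Local Notation u := (ujw n charK).

Let p_gt0 : (0 < p)%N := prime_gt0 (pcharf_prime charK).

Fact ujw_aug_ex : exists F : u -> K^o,
  [/\ linear F, monoid_morphism F & forall x, F (ujw_in charK x) = 0].
Proof.
apply: ujw_lift => [a x y|x y|i|a i _]; rewrite ?expr0n ?gtn_eqF //.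
  by rewrite scaler0 addr0.
by rewrite mulr0 subr0.
Qed.
Definition ujw_aug : u -> K := projT1 (cid ujw_aug_ex).
Let ujw_augP : [/\ scalar ujw_aug, monoid_morphism ujw_aug &
  forall x, ujw_aug (ujw_in charK x) = 0] := projT2 (cid ujw_aug_ex).
Lemma ujw_aug_scalar : scalar ujw_aug. Proof. by case: ujw_augP. Qed.
Lemma ujw_aug_monoid : monoid_morphism ujw_aug. Proof. by case: ujw_augP. Qed.
HB.instance Definition _ := isAugmented.Build K u ujw_aug_scalar ujw_aug_monoid.
Lemma ujw_aug_in x : aug (ujw_in charK x) = 0.
Proof. by case: ujw_augP. Qed.

Variable A : comAlgType K.
Local Notation H := (ujwA n charK A).
Local Notation j := (@ujwA_in K p n charK A).

Lemma ujwA_scaleE (a : A) (z : H) : a *: z = ((1 : u) ⊗ a : H) * z.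
Proof. by []. Qed.

Lemma ujwA_mulE (x y : u) (a b : A) : (x ⊗ a : H) * (y ⊗ b) = (x * y) ⊗ (a * b).
Proof. exact: tens_mulE. Qed.

Lemma ujwA_in_semilinear k x y : j (k *: x + y) = (k%:A : A) *: j x + j y.
Proof.
rewrite /ujwA_in ujw_in_linear tensDl tensZl; congr (_ + _).
by rewrite ujwA_scaleE ujwA_mulE mul1r mulr1 tensZr.
Qed.

(** A map that is [K]-linear on the Lie algebra extends to the scalar extension by
    [x ⊗ a |-> a F(x)], where [F] is its lift to the enveloping algebra. *)
Lemma ujwA_lift (C : algType A) (f : g -> C) :
    (forall k x y, f (k *: x + y) = (k%:A : A) *: f x + f y) ->
    (forall E F, f (jw_br E F) = f E * f F - f F * f E) ->
    (forall i, f (xD K p (ei i) i) ^+ p = f (xD K p (ei i) i)) ->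
    (forall (a : midx p n) i, ~ (forall j, a j = ei i j :> nat) ->
       f (xD K p (fun j => a j) i) ^+ p = 0) ->
  exists F : H -> C,
    [/\ linear F, monoid_morphism F & forall x, F (j x) = f x].
Proof.
move=> fl fbr ft fn; have [G [Gl GM GE]] :=
  @ujw_lift K p n charK (restrict_scalars C) f fl fbr ft fn.
pose f2 (x : u) (a : A) : restrict_scalars C := a *: (G x : C).
have f2l a : linear (f2^~ a).
  move=> k x y; rewrite /f2 Gl [LHS](@scalerDr A C); congr (_ + _).
  by rewrite !restrict_scaleE !scalerA mulrC.
have f2r x : linear (f2 x).
  move=> k a b; rewrite /f2 restrict_scaleE scalerA -scalerAl mul1r.
  exact: (@scalerDl A C).
have f21 : f2 1 1 = 1 by rewrite /f2 GM.1 scale1r.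
have f2M x a y b : f2 (x * y) (a * b) = f2 x a * f2 y b.
  have E (v w : C) : (a *: v) * (b *: w) = (a * b) *: (v * w).
    by rewrite -scalerAl -scalerAr scalerA.
  by rewrite /f2 GM.2; apply/esym/E.
have F2 : linear (tlift f2) by exact: tlift_linear.
have FM : monoid_morphism (tlift f2).
  exact: (@tliftM K u A (restrict_scalars C)).
exists (tlift f2 : H -> C); split.
- move=> a x y; rewrite [LHS](linD F2); congr (_ + _).
  rewrite ujwA_scaleE [LHS]FM.2 tliftE // /f2 GM.1.
  by rewrite -[LHS](@scalerAl A C) mul1r.
- exact: FM.
- by move=> x; rewrite /ujwA_in tliftE // /f2 scale1r GE.
Qed.

Lemma ujwA_ind (P : H -> Prop) :
  P 0 -> (forall a s z, P z -> P (a *: \prod_(x <- s) j x + z)) -> forall z, P z.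
Proof.
move=> P0 PD; suff PD' x a z : P z -> P (x ⊗ a + z).
  by elim/tens_ind=> // x a z; apply: PD'.
elim/ujw_ind: x z => [|k s y IH] z Pz; first by rewrite tens0l add0r.
rewrite tensDl -addrA tensZl -tensZr.
suff -> : (\prod_(x <- s) ujw_in charK x : u) ⊗ (k *: a) = (k *: a) *: (\prod_(x <- s) j x : H).
  exact/PD/IH.
rewrite ujwA_scaleE; have -> : \prod_(x <- s) j x = (\prod_(x <- s) ujw_in charK x : u) ⊗ (1 : A).
  elim: s => [|x s IHs]; first by rewrite !big_nil.
  by rewrite !big_cons IHs ujwA_mulE mulr1.
by rewrite ujwA_mulE mul1r mulr1.
Qed.

Fact ujwA_aug_ex : exists F : H -> A^o,
  [/\ linear F, monoid_morphism F & forall x, F (j x) = 0].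
Proof.
apply: ujwA_lift => [k x y|x y|i|a i _]; rewrite ?expr0n ?gtn_eqF //.
  by rewrite scaler0 addr0.
by rewrite mulr0 subr0.
Qed.
Definition ujwA_aug : H -> A := projT1 (cid ujwA_aug_ex).
Let ujwA_augP : [/\ scalar ujwA_aug, monoid_morphism ujwA_aug &
  forall x, ujwA_aug (j x) = 0] := projT2 (cid ujwA_aug_ex).
Lemma ujwA_aug_scalar : scalar ujwA_aug. Proof. by case: ujwA_augP. Qed.
Lemma ujwA_aug_monoid : monoid_morphism ujwA_aug. Proof. by case: ujwA_augP. Qed.
HB.instance Definition _ := isAugmented.Build A H ujwA_aug_scalar ujwA_aug_monoid.
Lemma ujwA_aug_in x : aug (j x) = 0.
Proof. by case: ujwA_augP. Qed.

Lemma ujwA_in_br E F : j (jw_br E F) = j E * j F - j F * j E.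
Proof. by rewrite /ujwA_in ujw_in_br !ujwA_mulE !mulr1 -tensNl -tensDl. Qed.
Lemma ujwA_inX x m : j x ^+ m = (ujw_in charK x ^+ m) ⊗ 1.
Proof. by elim: m => [|m IH]; rewrite ?expr0 // !exprS IH ujwA_mulE mulr1. Qed.
Lemma ujwA_in_toral i : j (xD K p (ei i) i) ^+ p = j (xD K p (ei i) i).
Proof. by rewrite ujwA_inX ujw_in_toral. Qed.
Lemma ujwA_in_nil (a : midx p n) i : ~ (forall l, a l = ei i l :> nat) ->
  j (xD K p (fun l => a l) i) ^+ p = 0.
Proof. by move=> ai; rewrite ujwA_inX ujw_in_nil // tens0l. Qed.
End Scalars.

(** * The prime field and the eigenspaces of a root of [X^p - X] *)

Lemma prime_ndvd_fact p l : prime p -> (l < p)%N -> (p %| l`!)%N = false.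
Proof.
move=> pr_p; elim: l => [|l IH] lp; first by rewrite Euclid_dvd1.
by rewrite factS Euclid_dvdM // gtnNdvd //= IH // ltnW.
Qed.

Section PrimeField.
Variables (A : comNzRingType) (p : nat).
Hypothesis charA : p \in [pchar A].
Let pr_p : prime p := pcharf_prime charA.

Definition of_Fp (a : 'F_p) : A := (a : nat)%:R.

Lemma natr_modp (B : pzSemiRingType) m : p%:R = 0 :> B -> (m %% p)%:R = m%:R :> B.
Proof. by move=> p0; rewrite {2}(divn_eq m p) natrD natrM p0 mulr0 add0r. Qed.

Lemma Fp_lt (a : 'F_p) : (a < p)%N.
Proof. by rewrite -[X in (_ < X)%N](Fp_cast pr_p). Qed.
Lemma Fp_natE m : (m%:R : 'F_p) = (m %% p)%N :> nat.
Proof. by rewrite val_Fp_nat. Qed.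
Lemma Fp_valK (a : 'F_p) : (a : nat)%:R = a.
Proof. by apply/val_inj; rewrite /= Fp_natE modn_small // Fp_lt. Qed.
Lemma Fp_addE (a b : 'F_p) : (a + b)%R = ((a + b) %% p)%N :> nat.
Proof. by rewrite -{1}(Fp_valK a) -{1}(Fp_valK b) -natrD Fp_natE. Qed.
Lemma Fp_mulE (a b : 'F_p) : (a * b)%R = ((a * b) %% p)%N :> nat.
Proof. by rewrite -{1}(Fp_valK a) -{1}(Fp_valK b) -natrM Fp_natE. Qed.

Let pA : p%:R = 0 :> A := pcharf0 charA.

Lemma of_Fp_nat m : of_Fp m%:R = m%:R.
Proof. by rewrite /of_Fp Fp_natE natr_modp. Qed.
Lemma of_Fp1 : of_Fp 1 = 1.
Proof. exact: of_Fp_nat 1. Qed.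
Lemma of_FpD a b : of_Fp (a + b) = of_Fp a + of_Fp b.
Proof. by rewrite /of_Fp Fp_addE natr_modp // natrD. Qed.
Lemma of_FpM a b : of_Fp (a * b) = of_Fp a * of_Fp b.
Proof. by rewrite /of_Fp Fp_mulE natr_modp // natrM. Qed.
Lemma of_Fp0 : of_Fp 0 = 0.
Proof. exact: of_Fp_nat 0. Qed.
Lemma of_FpN a : of_Fp (- a) = - of_Fp a.
Proof. by apply: (addIr (of_Fp a)); rewrite -of_FpD !addNr of_Fp0. Qed.
Lemma of_FpB a b : of_Fp (a - b) = of_Fp a - of_Fp b.
Proof. by rewrite of_FpD of_FpN. Qed.
Lemma of_FpX a m : of_Fp (a ^+ m) = of_Fp a ^+ m.
Proof. by elim: m => [|m IH]; rewrite ?of_Fp1 // !exprS of_FpM IH. Qed.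
Lemma of_Fp_int (m : int) : of_Fp m%:~R = m%:~R.
Proof. by case: m => m; rewrite ?NegzE ?mulrNz ?of_FpN -!pmulrn of_Fp_nat. Qed.

Lemma Fp_fermat (a : 'F_p) : a ^+ p.-1 = (a != 0)%:R.
Proof.
have [->|a0] := eqVneq; first by rewrite expr0n -subn1 subn_eq0 leqNgt prime_gt1.
apply: (mulIf a0); rewrite mul1r -exprSr prednK ?prime_gt0 //.
by have := expf_card a; rewrite card_Fp.
Qed.

(** Both sides have degree less than [p] and agree at the [p] points of the prime field:
    at [b] the only vanishing summand is the one of index [b], so the sum is [p - 1]. *)
Lemma Fp_power_sum : \sum_(a : 'F_p) ('X - a%:P) ^+ p.-1 = -1 :> {poly 'F_p}.
Proof.
apply/eqP; rewrite -subr_eq0 opprK; set Q := _ + 1.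
have szQ : (size Q <= p)%N.
  apply: (leq_trans (size_polyD _ _)); rewrite geq_max size_poly1 prime_gt0 // andbT.
  apply: (leq_trans (size_sum _ _ _)); apply/bigmax_leqP => a _.
  by rewrite size_exp_XsubC prednK // prime_gt0.
apply: contraLR szQ => Q0; rewrite -ltnNge.
have := @max_poly_roots _ Q (enum 'F_p) Q0 _ (enum_uniq _).
rewrite -cardE card_Fp // => -> //; apply/allP => b _.
rewrite /root /Q hornerD horner_sum hornerC.
under eq_bigr => a _ do rewrite horner_exp hornerXsubC Fp_fermat subr_eq0.
rewrite (bigD1 b) //= eqxx add0r (eq_bigr (fun=> 1)) => [|a /negPf]; last first.
  by rewrite eq_sym => ->.
rewrite sumr_const cardC1 card_Fp // -[1 in X in _ + X]/(1%:R) -natrD addn1.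
by rewrite prednK ?prime_gt0 // -val_eqE /= Fp_natE modnn.
Qed.

Section Projectors.
Variable B : algType A.
Implicit Types (y z : B) (a b : 'F_p).

(** The projector onto the [a]-eigenspace of an element [y] with [y ^+ p = y]:
    by Fermat, [1 - (s - a) ^+ p.-1] is the indicator function of [s = a]. *)
Definition eigproj a y : B := 1 - (y - (of_Fp a)%:A) ^+ p.-1.

Lemma pB : p%:R = 0 :> B.
Proof. by rewrite -(scaler_nat p (1 : B)) pA scale0r. Qed.

Lemma signp : (-1) ^+ p.-1 = 1 :> B.
Proof.
have -> : (-1 : B) = (of_Fp (-1))%:A by rewrite of_FpN of_Fp1 scaleN1r.
rewrite -[_%:A]mul1r mulr_algr exprZn expr1n -of_FpX Fp_fermat oppr_eq0 oner_eq0.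
by rewrite of_Fp1 scale1r.
Qed.

(** The polynomial identity [Fp_power_sum], evaluated at [y]. *)
Lemma eigproj_sum y : \sum_a eigproj a y = 1.
Proof.
rewrite sumrB sumr_const card_Fp // -[1 *+ p]/(p%:R) pB add0r.
have fB : zmod_morphism of_Fp by move=> a b; rewrite of_FpB.
have fM : monoid_morphism of_Fp by split; [exact: of_Fp1 | exact: of_FpM].
pose f : {rmorphism 'F_p -> A} :=
  HB.pack of_Fp (GRing.isZmodMorphism.Build _ _ of_Fp fB) (GRing.isMonoidMorphism.Build _ _ of_Fp fM).
have := congr1 (fun P => horner_alg y (map_poly f P)) Fp_power_sum.
rewrite !rmorph_sum rmorphN1 rmorphN1 => E; rewrite -[RHS]opprK -E.
congr (- _); apply: eq_bigr => a _.
rewrite !rmorphXn; congr (_ ^+ _).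
rewrite [X in _ = _ X](_ : _ = 'X - (of_Fp a)%:P).
  by rewrite rmorphB /= horner_algX horner_algC.
by rewrite rmorphB [X in X - _](map_polyX f) [X in _ - X](map_polyC f).
Qed.

Lemma eigproj_eigen y z a b :
  y * z = of_Fp a *: z -> eigproj b y * z = (a == b)%:R *: z.
Proof.
move=> yz; have E m : (y - (of_Fp b)%:A) ^+ m * z = of_Fp ((a - b) ^+ m) *: z.
  elim: m => [|m IH]; first by rewrite of_Fp1 mul1r scale1r.
  rewrite exprS -mulrA IH -scalerAr mulrBl yz mulr_algl -scalerBl -of_FpB scalerA.
  by rewrite -of_FpM -exprSr.
rewrite mulrBl mul1r E Fp_fermat subr_eq0.
by case: (a == b); rewrite ?of_Fp1 ?of_Fp0 ?scale1r ?scale0r ?subr0 ?subrr.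
Qed.

(** [(y - a) * eigproj a y] equals [(y - a) - (y - a) ^+ p], and the Frobenius map
    turns the last term into [y - a]. *)
Lemma mul_eigproj y a : y ^+ p = y -> y * eigproj a y = of_Fp a *: eigproj a y.
Proof.
move=> yp; apply/eqP; rewrite -subr_eq0 -mulr_algl -mulrBl /eigproj mulrBr mulr1.
rewrite -exprS prednK ?prime_gt0 //.
have cy : GRing.comm y (- (of_Fp a)%:A).
  by rewrite /GRing.comm mulrN mulNr mulr_algr mulr_algl.
have charB : p \in [pchar B] by rewrite inE pr_p pB /=.
rewrite -[X in _ - X]/(pFrobenius_aut charB (y - (of_Fp a)%:A)).
rewrite pFrobenius_autD_comm // pFrobenius_autN !pFrobenius_autE yp.
rewrite -[_%:A]mul1r mulr_algr exprZn expr1n -of_FpX.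
by have := expf_card a; rewrite card_Fp // => ->; rewrite subrr.
Qed.

Lemma eigproj_mul y a b : y ^+ p = y ->
  eigproj a y * eigproj b y = (a == b)%:R *: eigproj b y.
Proof. by move=> yp; rewrite (eigproj_eigen _ (mul_eigproj b yp)) eq_sym. Qed.

(** If [y x = x (y + m)] then [(y - a) x = x (y - (a - m))], hence the same for powers. *)
Lemma eigproj_weight y x m a :
  y * x = x * (y + (of_Fp m)%:A) -> eigproj a y * x = x * eigproj (a - m) y.
Proof.
move=> yx; rewrite mulrBl mulrBr mul1r mulr1; congr (_ - _).
elim: p.-1 => [|r IH]; first by rewrite mul1r mulr1.
rewrite exprSr -mulrA mulrBl yx exprS mulrA.
have -> : x * (y + (of_Fp m)%:A) - (of_Fp a)%:A * x = x * (y - (of_Fp (a - m))%:A).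
  rewrite mulr_algl -[X in _ - X]mulr_algr -mulrBr; congr (_ * _).
  by rewrite of_FpB scalerBl opprB -addrA.
by rewrite mulrA IH -!mulrA -exprSr exprS.
Qed.

(** [y + z] acts as [b + c] on the joint eigenspace of index [(b, c)], so its projector
    collects those with [b + c = a]. *)
Lemma eigproj_add y z a : y ^+ p = y -> z ^+ p = z -> y * z = z * y ->
  eigproj a (y + z) = \sum_b eigproj b y * eigproj (a - b) z.
Proof.
move=> yp zp yz; rewrite -[LHS]mulr1 -(eigproj_sum y) mulr_sumr.
apply: eq_bigr => b _.
rewrite -[LHS]mulr1 -{1}(eigproj_sum z) mulr_sumr (bigD1 (a - b)) //=.
have E c : eigproj a (y + z) * eigproj b y * eigproj c z
    = (b + c == a)%:R *: (eigproj b y * eigproj c z).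
  rewrite -mulrA; apply: eigproj_eigen; rewrite mulrDl mulrA mul_eigproj //.
  have yb : z * eigproj b y = eigproj b y * z.
    have : GRing.comm z (eigproj b y).
      apply: commrB; first exact: commr1.
      apply: commrX; apply: commrB; first by rewrite /GRing.comm yz.
      by rewrite /GRing.comm mulr_algr mulr_algl.
    by [].
  by rewrite mulrA yb -mulrA mul_eigproj // -scalerAl -scalerAr -scalerDl -of_FpD.
rewrite E [b + _]addrC subrK eqxx scale1r big1 ?addr0 // => c ca.
rewrite E (_ : _ == _ = false) ?scale0r //.
by apply: contraNF ca => /eqP <-; rewrite [b + c]addrC addrK.
Qed.
End Projectors.
End PrimeField.

(** * Twisting a cocommutative Hopf algebra *)

(** A sum over the triangle [i + l < p], along its antidiagonals and along its rows. *)
Lemma sum_antidiagonal (V : nmodType) p (G : nat -> nat -> V) :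
    (forall i l, (p <= i + l)%N -> G i l = 0) ->
  \sum_(r < p) \sum_(l < r.+1) G (r - l)%N l = \sum_(i < p) \sum_(l < p) G i l.
Proof.
move=> G0; rewrite [RHS]exchange_big /=.
under eq_bigr => r _ do rewrite (big_ord_widen p (fun l => G (r - l)%N l)) // big_mkcond.
rewrite exchange_big; apply: eq_bigr => l _ /=.
rewrite -(big_mkord xpredT (fun r => if (l < r.+1)%N then G (r - l)%N l else 0)).
rewrite -(big_mkord xpredT (fun i => G i l)).
rewrite (big_cat_nat (n := l)) ?(ltnW (ltn_ord l)) //= big_nat_cond big1 ?add0r; last first.
  by move=> r /andP[/andP[_ rl] _]; rewrite ltnS leqNgt rl.
rewrite [RHS](big_cat_nat (n := (p - l)%N)) ?leq_subr //=.
rewrite [X in _ = _ + X]big_nat_cond [X in _ = _ + X]big1 ?addr0; last first.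
  by move=> i /andP[/andP[pi _] _]; apply: G0; rewrite addnC -leq_subLR.
rewrite -{1}[l : nat]add0n big_addn; apply: eq_big_nat => i _.
by rewrite addnK ltnS leq_addl.
Qed.

Section TensorMaps.
Variables (A : comNzRingType) (H : augAlgType A).

Section Bilinear.
Variables (f1 : H -> tensor H H).
Hypotheses (fl : linear f1) (fM : monoid_morphism f1).

Lemma tens_mapl_bil :
  (forall z : H, linear (fun y => f1 y ⊗ z)) /\ (forall y, linear (fun z : H => f1 y ⊗ z)).
Proof. by split=> [z|y] a v w; rewrite ?fl ?tens_linearl ?tens_linearr. Qed.
Lemma tens_mapr_bil :
  (forall z, linear (fun y : H => y ⊗ f1 z)) /\ (forall y : H, linear (fun z => y ⊗ f1 z)).
Proof. by split=> [z|y] a v w; rewrite ?fl ?tens_linearl ?tens_linearr. Qed.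

Lemma tens_mapl_monoid : monoid_morphism (tlift (fun y z => f1 y ⊗ (z : H))).
Proof.
have [bl br] := tens_mapl_bil; apply: tliftM => //; first by rewrite fM.1.
by move=> *; rewrite fM.2 tensM.
Qed.
Lemma tens_mapr_monoid : monoid_morphism (tlift (fun (y : H) z => y ⊗ f1 z)).
Proof.
have [bl br] := tens_mapr_bil; apply: tliftM => //; first by rewrite fM.1.
by move=> *; rewrite fM.2 tensM.
Qed.
End Bilinear.

Let asc (u : tensor H H) (z : H) : tensor H (tensor H H) :=
  tlift (fun x y => x ⊗ (y ⊗ z)) u.

Let asc_bil (z : H) : (forall y : H, linear (fun x : H => x ⊗ (y ⊗ z))) /\
  (forall x : H, linear (fun y : H => x ⊗ (y ⊗ z))).
Proof. by split=> [y|x] a v w; rewrite tens_linearl ?tens_linearr. Qed.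
Let ascE x y z : asc (x ⊗ y) z = x ⊗ (y ⊗ z).
Proof. by have [bl br] := asc_bil z; rewrite /asc tliftE. Qed.
Let ascl z : linear (asc^~ z).
Proof. by have [bl br] := asc_bil z; apply: tlift_linear. Qed.
Let ascr u : linear (asc u).
Proof.
move=> a z z'; elim/tens_ind: u => [|x y u IH].
  by rewrite !(lin0 (ascl _)) scaler0 addr0.
rewrite !(linD (ascl _)) IH !ascE !(tensDr, tensZr) scalerDr.
by rewrite addrACA.
Qed.

Lemma tens_assocE x y z : tens_assoc ((x ⊗ y) ⊗ z) = x ⊗ (y ⊗ z) :> tensor H (tensor H H).
Proof. by rewrite /tens_assoc (tliftE ascl ascr) ascE. Qed.
Lemma tens_assoc_linear : linear (@tens_assoc A H).
Proof. exact: (tlift_linear ascl ascr). Qed.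
Lemma tens_assoc_monoid : monoid_morphism (@tens_assoc A H).
Proof.
apply: (tliftM ascl ascr) => [|u z v z']; first exact: ascE.
elim/tens_ind: u => [|x y u IH]; first by rewrite mul0r !(lin0 (ascl _)) mul0r.
rewrite mulrDl !(linD (ascl _)) mulrDl {}IH; congr (_ + _).
elim/tens_ind: v => [|x' y' v IH]; first by rewrite mulr0 !(lin0 (ascl _)) mulr0.
by rewrite mulrDr !(linD (ascl _)) mulrDr {}IH tensM !ascE !tensM.
Qed.
End TensorMaps.

(** [D0] and [S0] are the coproduct and the antipode before the twist; the algebra is
    generated by elements [x i] which are primitive and homogeneous for [ad h]. *)
Section Twist.
Variables (A : comNzRingType) (p : nat) (charA : p \in [pchar A]).
Variable H : augAlgType A.
Let pr_p : prime p := pcharf_prime charA.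

Local Notation π a y := (@eigproj A p _ a y).

Variables (D0 : H -> tensor H H) (S0 : H -> H).
Hypotheses (D0l : linear D0) (D0M : monoid_morphism D0).
Hypotheses (S0l : linear S0) (S01 : S0 1 = 1) (S0M : forall y z, S0 (y * z) = S0 z * S0 y).

Definition primitive (z : H) :=
  [/\ D0 z = z ⊗ 1 + 1 ⊗ z, S0 z = - z & aug z = 0].

Variables (h T : H).
Hypotheses (hp : h ^+ p = h) (Tp : T ^+ p = 0) (hT : h * T = T * (h + (of_Fp A (1 : 'F_p))%:A)).
Hypotheses (h_prim : primitive h) (T_prim : primitive T).

Definition weight (m : 'F_p) (z : H) := h * z = z * (h + (of_Fp A m)%:A).

Variables (I : Type) (x : I -> H) (wt : I -> 'F_p).
Hypotheses (x_prim : forall i, primitive (x i)) (x_wt : forall i, weight (wt i) (x i)).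
Hypothesis gen_ind : forall P : H -> Prop, P 0 -> P 1 ->
  (forall a y z, P y -> P z -> P (a *: y + z)) ->
  (forall i y, P y -> P (x i * y)) -> forall y, P y.

Let augD : {morph (@aug A H) : y z / y + z}.
Proof. by move=> y z; apply: (@linD A H A^o _ (@aug_scalar A H)). Qed.
Let augB : {morph (@aug A H) : y z / y - z}.
Proof. by move=> y z; apply: (@linB A H A^o _ (@aug_scalar A H)). Qed.
Let augM : {morph (@aug A H) : y z / y * z} := (@aug_monoid A H).2.
Let aug1 : aug (1 : H) = 1 := (@aug_monoid A H).1.
Let augZ a y : aug (a *: y : H) = a * aug y.
Proof. exact: (@linZ A H A^o _ (@aug_scalar A H)). Qed.
Let augX y m : aug (y ^+ m : H) = aug y ^+ m.
Proof. by elim: m => [|m IH]; rewrite ?aug1 // !exprS augM IH. Qed.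

Lemma linear_monoidX (B C : algType A) (f : B -> C) y m :
  monoid_morphism f -> f (y ^+ m) = f y ^+ m.
Proof. by move=> fM; elim: m => [|m IH]; rewrite ?fM.1 // !exprS fM.2 IH. Qed.

Definition grp : H := 1 - T.
Definition grpX (a : 'F_p) : H := grp ^+ a.

Let charH : p \in [pchar H].
Proof. by rewrite inE pr_p (pB charA) /=. Qed.

(** The Frobenius map: [(1 - T) ^+ p = 1 - T ^+ p]. *)
Lemma grp_p : grp ^+ p = 1.
Proof.
have := pFrobenius_autB_comm charH (commr_sym (commr1 T)).
rewrite !pFrobenius_autE expr1n Tp subr0; exact.
Qed.
Lemma grpX0 : grpX 0 = 1. Proof. by []. Qed.
Lemma grpX_nat m : grpX m%:R = grp ^+ m.
Proof. by rewrite /grpX (Fp_natE charA) {2}(divn_eq m p) exprD mulnC exprM grp_p expr1n mul1r. Qed.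
Lemma grpX1 : grpX 1 = grp. Proof. exact: grpX_nat 1. Qed.
Lemma grpXD a b : grpX (a + b) = grpX a * grpX b.
Proof. by rewrite -(Fp_valK charA a) -(Fp_valK charA b) -natrD !grpX_nat exprD. Qed.
Lemma grpXVr a : grpX a * grpX (- a) = 1. Proof. by rewrite -grpXD subrr grpX0. Qed.
Lemma grpXVl a : grpX (- a) * grpX a = 1. Proof. by rewrite -grpXD addNr grpX0. Qed.
Lemma grpX_T a : grpX a * T = T * grpX a.
Proof.
have : GRing.comm T (grpX a) by apply: commrX; apply: commrB; [exact: commr1|].
by [].
Qed.

Lemma proj_sum : \sum_a π a h = 1. Proof. exact: eigproj_sum. Qed.
Lemma proj_mul a b : π a h * π b h = (a == b)%:R *: π b h.
Proof. exact: eigproj_mul. Qed.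
Lemma proj_wt m z a : weight m z -> π a h * z = z * π (a - m) h.
Proof. exact: eigproj_weight. Qed.

Lemma proj_mulsuml a (G : 'F_p -> H) : π a h * (\sum_b π b h * G b) = π a h * G a.
Proof.
rewrite mulr_sumr (bigD1 a) //= mulrA proj_mul eqxx scale1r big1 ?addr0 // => b ba.
by rewrite mulrA proj_mul eq_sym (negPf ba) scale0r mul0r.
Qed.

Lemma proj_ext y z : (forall a, π a h * y = π a h * z) -> y = z.
Proof.
by move=> E; rewrite -[y]mul1r -[z]mul1r -proj_sum !mulr_suml; apply: eq_bigr => a _.
Qed.

(** The expansion of [(1 ⊗ g) ^ (h ⊗ 1)] on the eigenspaces of [h]. *)
Definition twist := \sum_a π a h ⊗ grpX a.
Definition twistV := \sum_a π a h ⊗ grpX (- a).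

Lemma twistVr : twist * twistV = 1.
Proof.
rewrite /twist mulr_suml; under eq_bigr => a _.
  rewrite /twistV mulr_sumr (bigD1 a) //= tensM proj_mul eqxx scale1r grpXVr.
  rewrite big1 ?addr0 => [|b ba]; last by rewrite tensM proj_mul eq_sym (negPf ba) scale0r tens0l.
over.
by rewrite -tens_suml proj_sum.
Qed.
Lemma twistVl : twistV * twist = 1.
Proof.
rewrite /twistV mulr_suml; under eq_bigr => a _.
  rewrite /twist mulr_sumr (bigD1 a) //= tensM proj_mul eqxx scale1r grpXVl.
  rewrite big1 ?addr0 => [|b ba]; last by rewrite tensM proj_mul eq_sym (negPf ba) scale0r tens0l.
over.
by rewrite -tens_suml proj_sum.
Qed.

Definition twisted_coproduct y := twist * D0 y * twistV.

Lemma coproduct_linear : linear twisted_coproduct.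
Proof. by move=> a y z; rewrite /twisted_coproduct D0l mulrDr mulrDl -scalerAr -scalerAl. Qed.
Lemma coproduct_monoid : monoid_morphism twisted_coproduct.
Proof.
split; first by rewrite /twisted_coproduct D0M.1 mulr1 twistVr.
move=> y z; have E : D0 (y * z) = D0 y * (twistV * twist) * D0 z.
  by rewrite twistVl mulr1 D0M.2.
by rewrite /twisted_coproduct E !mulrA.
Qed.

Lemma twist_conj y z : twist * (y ⊗ z) * twistV
  = \sum_a \sum_b (π a h * y * π b h) ⊗ (grpX a * z * grpX (- b)).
Proof.
rewrite /twist !mulr_suml; apply: eq_bigr => a _.
by rewrite /twistV mulr_sumr; apply: eq_bigr => b _; rewrite !tensM.
Qed.

(** Moving [z] past the projectors shifts their index by [m], so on [z ⊗ 1] the two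
    exponents of [g] differ by [m]; on [1 ⊗ z] the projectors meet and the exponents
    are opposite. *)
Lemma coproduct_prim m z : primitive z -> weight m z ->
  twisted_coproduct z = z ⊗ grpX m + \sum_a π a h ⊗ (grpX a * z * grpX (- a)).
Proof.
move=> [zD _ _] zw; rewrite /twisted_coproduct zD mulrDr mulrDl !twist_conj; congr (_ + _).
  transitivity (\sum_a (z * π (a - m) h) ⊗ grpX m).
    apply: eq_bigr => a _; rewrite (bigD1 (a - m)) //= mulr1 big1 => [|b bm].
      rewrite addr0 (proj_wt _ zw) -mulrA proj_mul eqxx scale1r -grpXD.
      by rewrite opprB [m - a]addrC addrA subrr add0r.
    by rewrite (proj_wt _ zw) -mulrA proj_mul eq_sym (negPf bm) scale0r mulr0 tens0l.
  rewrite -tens_suml -mulr_sumr.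
  have -> : \sum_a π (a - m) h = 1 by rewrite -proj_sum [RHS](reindex_inj (addIr (- m))).
  by rewrite mulr1.
apply: eq_bigr => a _; rewrite (bigD1 a) //= mulr1 proj_mul eqxx scale1r.
rewrite big1 ?addr0 // => b ba.
by rewrite proj_mul eq_sym (negPf ba) scale0r tens0l.
Qed.

Lemma coproduct_grp : twisted_coproduct grp = grp ⊗ grp.
Proof.
rewrite /grp (linB coproduct_linear) coproduct_monoid.1 (coproduct_prim T_prim hT) grpX1.
have -> : \sum_a π a h ⊗ (grpX a * T * grpX (- a)) = 1 ⊗ T.
  rewrite -proj_sum tens_suml; apply: eq_bigr => a _.
  by rewrite grpX_T -mulrA grpXVr mulr1.
rewrite -[RHS]/((1 - T) ⊗ grp) [RHS]tensDl tensNl [X in _ = X - _]tensDr tensNr.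
by rewrite opprD addrA addrAC.
Qed.
Lemma coproduct_grpX a : twisted_coproduct (grpX a) = grpX a ⊗ grpX a.
Proof.
rewrite /grpX (linear_monoidX _ _ coproduct_monoid) coproduct_grp.
by elim: (a : nat) => [|m IH]; rewrite ?tens1 // !exprS IH tensM.
Qed.

(** The projector onto an eigenspace is a polynomial, so [D0] carries it to the projector
    of [h ⊗ 1 + 1 ⊗ h], which splits by [eigproj_add]. *)
Lemma D0_proj c : D0 (π c h) = \sum_a π a h ⊗ π (c - a) h.
Proof.
have tX (f : H -> tensor H H) y a : linear f -> monoid_morphism f ->
    f (π a y) = π a (f y).
  move=> fl fM; rewrite /eigproj (linB fl) fM.1 (linear_monoidX _ _ fM) (linB fl).
  by rewrite (linZ fl) fM.1.
have [inl inr] : linear (fun y : H => y ⊗ (1 : H)) /\ linear (fun y : H => (1 : H) ⊗ y).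
  by split=> a y z; rewrite ?tens_linearl ?tens_linearr.
have inlM : monoid_morphism (fun y : H => y ⊗ (1 : H)).
  by split=> // y z; rewrite tensM mulr1.
have inrM : monoid_morphism (fun y : H => (1 : H) ⊗ y).
  by split=> // y z; rewrite tensM mulr1.
have [hD _ _] := h_prim; rewrite tX // hD (eigproj_add charA).
- apply: eq_bigr => a _.
  by rewrite -(tX _ h a inl inlM) -(tX _ h _ inr inrM) tensM mul1r mulr1.
- by rewrite -(linear_monoidX h p inlM) hp.
- by rewrite -(linear_monoidX h p inrM) hp.
- by rewrite !tensM mul1r mulr1.
Qed.

Lemma coproduct_proj c : twisted_coproduct (π c h) = \sum_a π a h ⊗ (grpX a * π (c - a) h * grpX (- a)).
Proof.
have cl : linear (fun v => twist * v * twistV).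
  by move=> s u v; rewrite mulrDr mulrDl -scalerAr -scalerAl.
rewrite /twisted_coproduct D0_proj (lin_sum cl); apply: eq_bigr => a _.
rewrite twist_conj (bigD1 a) //= [X in _ + X]big1 ?addr0 => [|b ba]; last first.
  by rewrite big1 // => c' _; rewrite proj_mul (negPf ba) scale0r mul0r tens0l.
rewrite (bigD1 a) //= big1 ?addr0 => [|b ba]; rewrite proj_mul eqxx scale1r proj_mul.
  by rewrite eqxx scale1r.
by rewrite eq_sym (negPf ba) scale0r tens0l.
Qed.

Let DL := tlift (fun y z => twisted_coproduct y ⊗ (z : H)).
Let DR := tlift (fun (y : H) z => y ⊗ twisted_coproduct z).
Let DL_linear : linear DL.
Proof. by have [bl br] := tens_mapl_bil coproduct_linear; apply: tlift_linear. Qed.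
Let DR_linear : linear DR.
Proof. by have [bl br] := tens_mapr_bil coproduct_linear; apply: tlift_linear. Qed.
Let DLE y z : DL (y ⊗ z) = twisted_coproduct y ⊗ z.
Proof. by have [bl br] := tens_mapl_bil coproduct_linear; apply: tliftE. Qed.
Let DRE y z : DR (y ⊗ z) = y ⊗ twisted_coproduct z.
Proof. by have [bl br] := tens_mapr_bil coproduct_linear; apply: tliftE. Qed.
Let DLM : monoid_morphism DL := tens_mapl_monoid coproduct_linear coproduct_monoid.
Let DRM : monoid_morphism DR := tens_mapr_monoid coproduct_linear coproduct_monoid.

(** Both sides are algebra maps, so it suffices to compare them on [x i]. Writing
    [X a = g ^ a x g ^ (- a)], both are the sum of [x ⊗ g ^ m ⊗ g ^ m], of the
    [π_a ⊗ X a ⊗ g ^ m], and of the [π_a ⊗ g ^ a π_(c - a) g ^ (- a) ⊗ X c]. *)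
Lemma coproduct_coassoc y : tens_assoc (DL (twisted_coproduct y)) = DR (twisted_coproduct y).
Proof.
have AL := @tens_assoc_linear A H; have AM := @tens_assoc_monoid A H.
have DlM := coproduct_monoid; have Dl := coproduct_linear.
elim/gen_ind: y => [|| a y z IHy IHz | i y IH].
- by rewrite (lin0 Dl) (lin0 DL_linear) (lin0 DR_linear) (lin0 AL).
- by rewrite DlM.1 DLM.1 DRM.1 AM.1.
- by rewrite Dl DL_linear DR_linear AL IHy IHz.
rewrite DlM.2 DLM.2 DRM.2 AM.2 IH; congr (_ * _).
set m := wt i; pose X a := grpX a * x i * grpX (- a).
have xD : twisted_coproduct (x i) = x i ⊗ grpX m + \sum_a π a h ⊗ X a by apply: coproduct_prim (x_prim i) (x_wt i).
have XD a : twisted_coproduct (X a) = X a ⊗ grpX m + \sum_c (grpX a * π (c - a) h * grpX (- a)) ⊗ X c.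
  rewrite /X !DlM.2 !coproduct_grpX xD mulrDr mulrDl !tensM; congr (_ + _).
    by rewrite -!grpXD addrC addrA addNr add0r.
  rewrite mulr_sumr mulr_suml (reindex_inj (addIr (- a))) /=.
  apply: eq_bigr => c _; rewrite !tensM; congr (_ ⊗ _).
  rewrite /X !mulrA -grpXD -!mulrA -grpXD.
  by rewrite [a + _]addrC subrK opprB addrAC subrr add0r.
rewrite xD (linD DL_linear) (linD DR_linear) (linD AL) DLE DRE coproduct_grpX xD.
rewrite tensDl (linD AL) tens_assocE -addrA; congr (_ + _).
rewrite tens_suml !(lin_sum AL) (lin_sum DL_linear) (lin_sum DR_linear) (lin_sum AL).
under [in RHS]eq_bigr => a _ do rewrite DRE XD tensDr tens_sumr.
rewrite big_split /=; congr (_ + _).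
  by apply: eq_bigr => a _; rewrite tens_assocE.
rewrite exchange_big; apply: eq_bigr => c _ /=.
rewrite DLE coproduct_proj tens_suml (lin_sum AL); apply: eq_bigr => a _.
by rewrite tens_assocE.
Qed.

Let aug_prim z : primitive z -> aug z = 0. Proof. by case. Qed.

Lemma aug_grp : aug grp = 1.
Proof. by rewrite /grp augB aug1 (aug_prim T_prim) subr0. Qed.
Lemma aug_grpX a : aug (grpX a) = 1.
Proof. by rewrite /grpX augX aug_grp expr1n. Qed.
Lemma aug_proj a : aug (π a h) = (a == 0)%:R.
Proof.
rewrite /eigproj augB aug1 augX augB (aug_prim h_prim) augZ aug1 mulr1 sub0r.
rewrite -(of_FpN charA) -(of_FpX charA) (Fp_fermat charA) oppr_eq0.
by case: (a == 0); rewrite ?(of_Fp1 charA) ?(of_Fp0 charA) ?subr0 ?subrr.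
Qed.

Lemma coproduct_counitl c : tlift (fun y z : H => aug y *: z) (twisted_coproduct c) = c.
Proof.
have bl (z : H) : linear (fun y : H => aug y *: z).
  by move=> a v w; rewrite augD augZ scalerDl scalerA.
have br (y : H) : linear (fun z : H => aug y *: z).
  by move=> a v w; rewrite scalerDr !scalerA mulrC.
have TM : monoid_morphism (tlift (fun y z : H => aug y *: z)).
  apply: tliftM => // [|v z v' z']; first by rewrite aug1 scale1r.
  by rewrite augM -scalerAl -scalerAr scalerA.
have TL := tlift_linear bl br; have DlM := coproduct_monoid; have Dl := coproduct_linear.
elim/gen_ind: c => [|| a v z IHy IHz | i v IH].
- by rewrite (lin0 Dl) (lin0 TL).
- by rewrite DlM.1 TM.1.
- by rewrite Dl TL IHy IHz.
rewrite DlM.2 TM.2 IH (coproduct_prim (x_prim i) (x_wt i)); congr (_ * _).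
rewrite (linD TL) tliftE // (aug_prim (x_prim i)) scale0r add0r (lin_sum TL).
rewrite (bigD1 0) //= tliftE // aug_proj eqxx scale1r oppr0 grpX0 mul1r mulr1.
by rewrite big1 ?addr0 // => a /negPf a0; rewrite tliftE // aug_proj a0 scale0r.
Qed.

Lemma coproduct_counitr c : tlift (fun y z : H => aug z *: y) (twisted_coproduct c) = c.
Proof.
have bl (z : H) : linear (fun y : H => aug z *: y).
  by move=> a v w; rewrite scalerDr !scalerA mulrC.
have br (y : H) : linear (fun z : H => aug z *: y).
  by move=> a v w; rewrite augD augZ scalerDl scalerA.
have TM : monoid_morphism (tlift (fun y z : H => aug z *: y)).
  apply: tliftM => // [|v z v' z']; first by rewrite aug1 scale1r.
  by rewrite augM -scalerAl -scalerAr scalerA.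
have TL := tlift_linear bl br; have DlM := coproduct_monoid; have Dl := coproduct_linear.
elim/gen_ind: c => [|| a v z IHy IHz | i v IH].
- by rewrite (lin0 Dl) (lin0 TL).
- by rewrite DlM.1 TM.1.
- by rewrite Dl TL IHy IHz.
rewrite DlM.2 TM.2 IH (coproduct_prim (x_prim i) (x_wt i)); congr (_ * _).
rewrite (linD TL) tliftE // aug_grpX scale1r (lin_sum TL) big1 ?addr0 // => a _.
by rewrite tliftE // !augM (aug_prim (x_prim i)) mulr0 mul0r scale0r.
Qed.

(** The product of the two legs of the twist, and the inverse found below. *)
Definition antipode_elt := \sum_a π a h * grpX a.
Definition antipode_eltV := \sum_a π a h * (1 + T) ^+ a.

Let proj_T a : π a h * T = T * π (a - 1) h. Proof. exact: proj_wt. Qed.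
Let proj_TX a (s : A) r : π a h * (s *: T) ^+ r = (s *: T) ^+ r * π (a - r%:R) h.
Proof.
elim: r a => [|r IH] a; first by rewrite mul1r mulr1 subr0.
rewrite exprS mulrA -scalerAr proj_T scalerAl -[LHS]mulrA IH -[RHS]mulrA.
by rewrite -natr1 opprD addrA [a - _ - 1]addrAC.
Qed.

(** [\sum_a π_a (1 + s T) ^ a] behaves as the binomial series [(1 + s T) ^ h]: moving the
    projectors past the powers of [T] turns the [π_a] part of the product of the series
    for [s] and [- s] into [π_a ((1 - s T) + s T) ^ a]. *)
Let antipode_elt_inv (s : A) :
  (\sum_a π a h * (1 + s *: T) ^+ a) * (\sum_a π a h * (1 + (- s) *: T) ^+ a) = 1.
Proof.
set w2 := (X in _ * X); rewrite mulr_suml -[RHS]proj_sum.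
apply: eq_bigr => a _.
rewrite exprDn_comm; last exact/commr_sym/commr1.
have cT : GRing.comm (1 + (- s) *: T) (s *: T).
  apply/commr_sym/commrD; first exact: commr1.
  by rewrite /GRing.comm -!scalerAl -!scalerAr !scalerA mulrC.
transitivity (π a h * ((1 + (- s) *: T) + s *: T) ^+ a); last first.
  by rewrite scaleNr subrK expr1n mulr1.
rewrite exprDn_comm // -mulrA mulr_suml !mulr_sumr; apply: eq_bigr => r _.
rewrite expr1n mul1r mulrnAl !mulrnAr; congr (_ *+ _).
have ra : (r <= a)%N by rewrite -ltnS.
have arE : (a - r%:R : 'F_p) = (a - r)%N :> nat.
  rewrite -{1}(Fp_valK charA a) -natrB // (Fp_natE charA) modn_small //.
  by rewrite (leq_ltn_trans (leq_subr _ _)) // (Fp_lt charA).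
rewrite mulrA proj_TX -mulrA proj_mulsuml arE.
have cTX : GRing.comm ((1 + (- s) *: T) ^+ (a - r)) ((s *: T) ^+ r).
  exact/commrX/commr_sym/commrX/commr_sym.
by rewrite cTX [RHS]mulrA proj_TX -mulrA.
Qed.

Lemma antipode_elt_inv_r : antipode_elt * antipode_eltV = 1.
Proof.
have := antipode_elt_inv (-1); rewrite opprK.
have -> : \sum_a π a h * (1 + -1 *: T) ^+ a = antipode_elt.
  by apply: eq_bigr => a _; rewrite scaleN1r.
suff -> : \sum_a π a h * (1 + 1 *: T) ^+ a = antipode_eltV by [].
by apply: eq_bigr => a _; rewrite scale1r.
Qed.
Lemma antipode_elt_inv_l : antipode_eltV * antipode_elt = 1.
Proof.
have := antipode_elt_inv 1.
have -> : \sum_a π a h * (1 + -1 *: T) ^+ a = antipode_elt.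
  by apply: eq_bigr => a _; rewrite scaleN1r.
suff -> : \sum_a π a h * (1 + 1 *: T) ^+ a = antipode_eltV by [].
by apply: eq_bigr => a _; rewrite scale1r.
Qed.

Definition twisted_antipode y := antipode_eltV * S0 y * antipode_elt.

Lemma antipode_linear : linear twisted_antipode.
Proof. by move=> a y z; rewrite /twisted_antipode S0l mulrDr mulrDl -scalerAr -scalerAl. Qed.
Lemma antipode_1 : twisted_antipode 1 = 1.
Proof. by rewrite /twisted_antipode S01 mulr1 antipode_elt_inv_l. Qed.
Lemma antipode_mul y z : twisted_antipode (y * z) = twisted_antipode z * twisted_antipode y.
Proof.
have E : S0 (y * z) = S0 z * (antipode_elt * antipode_eltV) * S0 y by rewrite antipode_elt_inv_r mulr1 S0M.
by rewrite /twisted_antipode E !mulrA.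
Qed.

Lemma S0_proj a : S0 (π a h) = π (- a) h.
Proof.
have S0X y m : S0 (y ^+ m) = S0 y ^+ m.
  by elim: m => [|m IH]; rewrite ?S01 // exprSr S0M IH -exprS.
have [_ hS _] := h_prim.
rewrite /eigproj (linB S0l) S01 S0X (linB S0l) (linZ S0l) S01 hS -opprD exprNn.
by rewrite (signp charA) mul1r (of_FpN charA) scaleNr opprK.
Qed.

Lemma proj_antipode_elt a : π a h * antipode_elt = π a h * grpX a.
Proof. exact: proj_mulsuml. Qed.

(** With [w = antipode_elt], each summand is [w^-1 π_(-a) w g ^ a z g ^ (- a)], where
    [π_(-a) w g ^ a = π_(-a)] since [w] acts as [g ^ (- a)] after [π_(-a)]. What remains
    is [w^-1 z \sum_a π_(- a - m) g ^ (- a)], and the sum is [w g ^ m]. *)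
Lemma antipode_weight m z : weight m z ->
  \sum_a twisted_antipode (π a h) * (grpX a * z * grpX (- a)) = antipode_eltV * z * antipode_elt * grpX m.
Proof.
move=> zw; transitivity (\sum_a antipode_eltV * z * (π (- a - m) h * grpX (- a))).
  apply: eq_bigr => a _; rewrite /twisted_antipode S0_proj -!mulrA; congr (_ * _).
  by rewrite !mulrA proj_antipode_elt -[_ * grpX (- a) * grpX a]mulrA grpXVl mulr1 (proj_wt _ zw).
rewrite (reindex_inj oppr_inj) (reindex_inj (addIr m)) /=.
rewrite -mulrA /antipode_elt mulr_suml mulr_sumr; apply: eq_bigr => a _.
by rewrite opprK addrK grpXD !mulrA.
Qed.

Let mL := tlift (fun y z : H => twisted_antipode y * z).
Let mR := tlift (fun y z : H => y * twisted_antipode z).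
Let mLl (z : H) : linear (fun y : H => twisted_antipode y * z).
Proof. by move=> a v w; rewrite antipode_linear mulrDl -scalerAl. Qed.
Let mLr (y : H) : linear (fun z : H => twisted_antipode y * z).
Proof. by move=> a v w; rewrite mulrDr -scalerAr. Qed.
Let mRl (z : H) : linear (fun y : H => y * twisted_antipode z).
Proof. by move=> a v w; rewrite mulrDl -scalerAl. Qed.
Let mRr (y : H) : linear (fun z : H => y * twisted_antipode z).
Proof. by move=> a v w; rewrite antipode_linear mulrDr -scalerAr. Qed.
Let mL_lin : linear mL := tlift_linear mLl mLr.
Let mR_lin : linear mR := tlift_linear mRl mRr.
Let mLE y z : mL (y ⊗ z) = twisted_antipode y * z := tliftE mLl mLr y z.
Let mRE y z : mR (y ⊗ z) = y * twisted_antipode z := tliftE mRl mRr y z.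

Let mLM u y z : mL (u * (y ⊗ z)) = twisted_antipode y * mL u * z.
Proof.
elim/tens_ind: u => [|a b u IH]; first by rewrite mul0r (lin0 mL_lin) mulr0 mul0r.
by rewrite mulrDl !(linD mL_lin) mulrDr mulrDl IH tensM !mLE antipode_mul !mulrA.
Qed.
Let mRM u y z : mR ((y ⊗ z) * u) = y * mR u * twisted_antipode z.
Proof.
elim/tens_ind: u => [|a b u IH]; first by rewrite mulr0 (lin0 mR_lin) mulr0 mul0r.
by rewrite mulrDr !(linD mR_lin) mulrDr mulrDl IH tensM !mRE antipode_mul !mulrA.
Qed.

Let mL_prim m z : primitive z -> weight m z -> mL (twisted_coproduct z) = 0.
Proof.
move=> zp zw; rewrite (coproduct_prim zp zw) (linD mL_lin) mLE (lin_sum mL_lin).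
under eq_bigr => a _ do rewrite mLE.
have [_ zS _] := zp.
by rewrite (antipode_weight zw) /twisted_antipode zS mulrN !mulNr addNr.
Qed.

(** The twisted antipode reverses products, so [S(y1) y2] taken at [x i * y] contains the
    same expression at [x i], which is zero, as an inner factor. *)
Lemma antipode_l y : mL (twisted_coproduct y) = (aug y)%:A.
Proof.
have DlM := coproduct_monoid; have Dl := coproduct_linear.
elim/gen_ind: y => [|| a y z IHy IHz | i y IH].
- rewrite (lin0 Dl) (lin0 mL_lin) -[X in aug X](scale0r (1 : H)) augZ mul0r.
  by rewrite scale0r.
- by rewrite DlM.1 tens1 mLE antipode_1 mul1r aug1 scale1r.
- by rewrite Dl mL_lin IHy IHz augD augZ scalerDl scalerA.
rewrite augM (aug_prim (x_prim i)) mul0r scale0r DlM.2.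
elim/tens_ind: (twisted_coproduct y) => [|v z u IHu]; first by rewrite mulr0 (lin0 mL_lin).
rewrite mulrDr (linD mL_lin) IHu addr0 mLM.
by rewrite (mL_prim (x_prim i) (x_wt i)) mulr0 mul0r.
Qed.

(** A consequence of the left antipode axiom, [g ^ a] being grouplike and invertible. *)
Lemma antipode_grpX a : twisted_antipode (grpX a) = grpX (- a).
Proof.
have := antipode_l (grpX a); rewrite coproduct_grpX mLE aug_grpX scale1r => E.
by rewrite -[LHS]mulr1 -(grpXVr a) mulrA E mul1r.
Qed.

Let mR_prim m z : primitive z -> weight m z -> mR (twisted_coproduct z) = 0.
Proof.
move=> zp zw; rewrite (coproduct_prim zp zw) (linD mR_lin) mRE (lin_sum mR_lin) antipode_grpX.
have [_ zS _] := zp.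
under eq_bigr => a _.
  rewrite mRE !antipode_mul !antipode_grpX opprK {1}/twisted_antipode zS !(mulrN, mulNr).
  rewrite !mulrA -proj_antipode_elt -[_ * antipode_elt * antipode_eltV]mulrA antipode_elt_inv_r mulr1.
  rewrite (proj_wt _ zw) -[z * _ * antipode_elt]mulrA proj_antipode_elt -!mulrA -grpXD.
  rewrite addrAC subrr add0r.
over.
rewrite sumrN -mulr_sumr -mulr_suml.
have -> : \sum_a π (a - m) h = 1 by rewrite -proj_sum [RHS](reindex_inj (addIr (- m))).
by rewrite mul1r subrr.
Qed.

Lemma antipode_r y : mR (twisted_coproduct y) = (aug y)%:A.
Proof.
have DlM := coproduct_monoid; have Dl := coproduct_linear.
elim/gen_ind: y => [|| a y z IHy IHz | i y IH].
- rewrite (lin0 Dl) (lin0 mR_lin) -[X in aug X](scale0r (1 : H)) augZ mul0r.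
  by rewrite scale0r.
- by rewrite DlM.1 tens1 mRE antipode_1 mul1r aug1 scale1r.
- by rewrite Dl mR_lin IHy IHz augD augZ scalerDl scalerA.
rewrite augM (aug_prim (x_prim i)) mul0r scale0r DlM.2.
have E u : mR (u * twisted_coproduct y) = aug y *: mR u.
  elim/tens_ind: u => [|v z u IHu]; first by rewrite mul0r !(lin0 mR_lin) scaler0.
  rewrite mulrDl !(linD mR_lin) IHu mRM IH mRE scalerDr; congr (_ + _).
  by rewrite mulr_algr -scalerAl.
by rewrite E (mR_prim (x_prim i) (x_wt i)) scaler0.
Qed.

Lemma twist_hopf : is_hopf_algebra twisted_coproduct (@aug A H) twisted_antipode.
Proof.
split.
- exact: coproduct_linear.
- exact: coproduct_monoid.
- exact: aug_scalar.
- exact: aug_monoid.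
- exact: antipode_linear.
- exact: coproduct_coassoc.
- exact: coproduct_counitl.
- exact: coproduct_counitr.
- exact: antipode_l.
- exact: antipode_r.
Qed.

Definition adT (z : H) := T * z - z * T.

Lemma adT_linear : linear adT.
Proof.
move=> a y z; rewrite /adT mulrDr mulrDl -scalerAr -scalerAl scalerBr.
by rewrite opprD addrACA.
Qed.

(** Binomial expansion of [right mult by N = left mult by N + adT], two commuting
    operators. It is used for [N = g] and for [N = - T]. *)
Lemma mul_expr_ad (N z : H) c :
    (forall y, y * N = N * y + adT y) -> (forall y, adT (N * y) = N * adT y) ->
  z * N ^+ c = \sum_(l < c.+1) (N ^+ (c - l) * iter l adT z) *+ 'C(c, l).
Proof.
move=> NE NA; elim: c z => [|c IH] z.
  by rewrite big_ord1 expr0 mulr1 mul1r mulr1n.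
have IE y l : iter l adT (N * y) = N * iter l adT y by elim: l => //= l ->.
have ID y y' l : iter l adT (y + y') = iter l adT y + iter l adT y'.
  by elim: l => //= l ->; rewrite (linD adT_linear).
rewrite exprS mulrA NE IH; under eq_bigr => l _ do rewrite ID IE mulrDr mulrnDl.
rewrite big_split /= [X in X + _]big_ord_recl /= subn0 bin0 mulr1n.
rewrite [X in _ + X]big_ord_recr /= subnn binn mulr1n mul1r.
rewrite [RHS]big_ord_recl [X in _ = _ + X]big_ord_recr /= subn0 bin0 mulr1n.
rewrite subSS subnn binn mulr1n mul1r -iterSr -!addrA; congr (_ + _).
  by rewrite mulrA -exprSr.
rewrite addrA; congr (_ + _); rewrite -big_split; apply: eq_bigr => l _ /=.
rewrite /bump /= add1n subSS -iterSr binS mulrnDr; congr (_ + _).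
by rewrite mulrA -exprSr subnSK.
Qed.

Lemma weightM m m' y z : weight m y -> weight m' z -> weight (m + m') (y * z).
Proof.
rewrite /weight => yw zw; rewrite mulrA yw -!mulrA; congr (_ * _).
rewrite mulrDl zw mulr_algl -[X in _ + X]mulr_algr -mulrDr; congr (_ * _).
by rewrite (of_FpD charA) scalerDl addrAC addrA.
Qed.
Lemma weight_lin m a y z : weight m y -> weight m z -> weight m (a *: y + z).
Proof.
by rewrite /weight => yw zw; rewrite mulrDr mulrDl -scalerAr -scalerAl yw zw.
Qed.
Lemma weightZ m a y : weight m y -> weight m (a *: y).
Proof. by rewrite /weight => yw; rewrite -scalerAr -scalerAl yw. Qed.
Lemma weight_adT m z : weight m z -> weight (m + 1) (adT z).
Proof.
move=> zw; rewrite /adT [_ - _]addrC -scaleN1r; apply: weight_lin; first exact: weightM.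
by rewrite addrC; apply: weightM.
Qed.
Lemma weight_iter m z l : weight m z -> weight (m + l%:R) (iter l adT z).
Proof.
move=> zw; elim: l => [|l IH]; first by rewrite addr0.
by rewrite -natr1 addrA; apply: weight_adT.
Qed.

Lemma proj_h a : π a h * h = of_Fp A a *: π a h.
Proof.
have hw : weight 0 h by rewrite /weight (of_Fp0 charA) scale0r addr0.
by rewrite (proj_wt _ hw) subr0 (mul_eigproj charA).
Qed.

Lemma rising_projl s l b :
  rising s h l * π b h = (\prod_(i < l) (of_Fp A b + s + i%:R)) *: π b h.
Proof.
elim: l => [|l IH]; first by rewrite /rising !big_ord0 mul1r scale1r.
rewrite /rising !big_ord_recr /= -/(rising s h l) -mulrA !mulrDl (mul_eigproj charA) //.
rewrite mulr_algl -(scaler_nat l 1) mulr_algl -!scalerDl -scalerAr IH scalerA.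
by rewrite mulrC.
Qed.
Lemma rising_projr s l b :
  π b h * rising s h l = (\prod_(i < l) (of_Fp A b + s + i%:R)) *: π b h.
Proof.
elim: l => [|l IH]; first by rewrite /rising !big_ord0 mulr1 scale1r.
rewrite /rising !big_ord_recr /= -/(rising s h l) mulrA IH -scalerAl !mulrDr proj_h.
by rewrite mulr_algr -(scaler_nat l 1) mulr_algr -!scalerDl scalerA !mulrDr.
Qed.

Lemma prod_ffact (R : comNzRingType) c l :
  \prod_(i < l) (c%:R - i%:R) = (c ^_ l)%:R :> R.
Proof.
elim: l => [|l IH]; first by rewrite big_ord0 ffactn0.
rewrite big_ord_recr /= IH ffactnSr natrM; have [lc|cl] := leqP l c.
  by rewrite natrB.
by rewrite ffact_small // mul0r mul0r.
Qed.

(** [d l] plays the part of the [l]-th divided power of [ad T] applied to [z]. *)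
Section Formulas.
Variables (m : 'F_p) (z : H) (d : nat -> H).
Hypotheses (z_prim : primitive z) (z_wt : weight m z).
Hypothesis dE : forall l, (l < p)%N -> d l *+ l`! = iter l adT z.

Let g_comm y : y * grp = grp * y + adT y.
Proof. by rewrite /grp /adT mulrBr mulrBl mulr1 mul1r addrA subrK. Qed.
Let g_ad y : adT (grp * y) = grp * adT y.
Proof.
have gT : T * grp = grp * T by have := grpX_T 1; rewrite grpX1.
by rewrite /adT mulrBr !mulrA gT.
Qed.

Let ffact_d c l : (l < p)%N -> d l *+ (c ^_ l) = iter l adT z *+ 'C(c, l).
Proof. by move=> lp; rewrite -bin_ffact mulnC mulrnA dE. Qed.

(** [z g ^ c] expanded by [mul_expr_ad], then multiplied by [g ^ (- c)]; the sum may run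
    up to [p] because [c ^_ l] vanishes for [l > c]. *)
Let conj_expand (c : 'F_p) :
  grpX (- c) * z * grpX c = \sum_(l < p) (grpX (- (l : nat)%:R) * d l) *+ (c ^_ l).
Proof.
rewrite -mulrA {2}/grpX (mul_expr_ad _ _ g_comm g_ad) mulr_sumr.
rewrite (big_ord_widen p (fun l => grpX (- c) * (grp ^+ (c - l) * iter l adT z *+ 'C(c, l)))) ?(Fp_lt charA) //.
rewrite big_mkcond; apply: eq_bigr => l _ /=.
rewrite -[RHS]mulrnAr (ffact_d _ (ltn_ord l)).
case: ltnP => [lc|cl]; last by rewrite bin_small // mulr0n mulr0.
rewrite !mulrnAr mulrA; congr (_ * _ *+ _).
by rewrite -grpX_nat natrB // (Fp_valK charA) -grpXD addrA addNr add0r.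
Qed.

(** On the eigenspace of [h] of eigenvalue [- c], the rising factorial of [h] of order
    [l] takes the value [(-1) ^+ l * c ^_ l], the coefficient of [conj_expand]. *)
Lemma coproduct_formula : twisted_coproduct z = z ⊗ grpX m
  + \sum_(l < p) (-1) ^+ l *: (rising 0 h l ⊗ (grpX (- (l : nat)%:R) * d l)).
Proof.
rewrite (coproduct_prim z_prim z_wt); congr (_ + _).
rewrite (reindex_inj oppr_inj) /=.
transitivity (\sum_(l < p) \sum_(c : 'F_p)
    (π (- c) h ⊗ (grpX (- (l : nat)%:R) * d l)) *+ (c ^_ l)).
  rewrite exchange_big; apply: eq_bigr => c _ /=.
  rewrite opprK conj_expand tens_sumr; apply: eq_bigr => l _.
  by rewrite -scaler_nat tensZr scaler_nat.
apply: eq_bigr => l _; rewrite -[rising _ _ _]mulr1 -proj_sum mulr_sumr tens_suml.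
rewrite scaler_sumr [RHS](reindex_inj oppr_inj) /=; apply: eq_bigr => c _.
rewrite rising_projl tensZl scalerA -scaler_nat; congr (_ *: _).
have -> : \prod_(i < l) (of_Fp A (- c) + 0 + i%:R) = \prod_(i < l) - ((c : nat)%:R - i%:R : A).
  by apply: eq_bigr => i _; rewrite addr0 (of_FpN charA) opprB addrC.
by rewrite prodrN card_ord mulrA -expr2 sqrr_sign mul1r prod_ffact.
Qed.

Let dZ l : (l < p)%N -> exists s, d l = s *: iter l adT z.
Proof.
move=> lp; exists (of_Fp A ((l`!)%:R^-1 : 'F_p)); rewrite -dE // -scaler_nat scalerA.
rewrite -(of_Fp_nat charA) -(of_FpM charA) mulVf ?(of_Fp1 charA) ?scale1r //.
by rewrite -(dvdn_pcharf (pchar_Fp pr_p)) prime_ndvd_fact.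
Qed.

Let d_wt l : (l < p)%N -> weight (m + l%:R) (d l).
Proof. by move=> /dZ[s ->]; apply/weightZ/weight_iter. Qed.

(** The common trinomial expansion of the two sides of the identity that determines the
    twisted antipode. *)
Let f (c i l : nat) := ((- T) ^+ i * iter l adT z * π (c%:R - i%:R - l%:R) h)
  *+ ('C(c, i) * 'C(c - i, l)).

Let gE (c : 'F_p) : grpX c = \sum_(i < p) ((- T) ^+ i) *+ 'C(c, i).
Proof.
rewrite /grpX /grp exprDn_comm; last exact/commr_sym/commr1.
rewrite (big_ord_widen p (fun i => 1 ^+ (c - i) * (- T) ^+ i *+ 'C(c, i))) ?(Fp_lt charA) //.
rewrite big_mkcond; apply: eq_bigr => i _ /=.
by case: ltnP => [ic|ci]; rewrite ?expr1n ?mul1r // bin_small.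
Qed.

Let antipode_lhs (c : 'F_p) : π (c + m) h * grpX c * (\sum_(l < p) d l * rising 1 h l)
  = \sum_(i < p) \sum_(l < p) f c i l.
Proof.
rewrite gE [X in X * _]mulr_sumr mulr_suml; apply: eq_bigr => i _.
rewrite mulr_sumr; apply: eq_bigr => l _.
have [ic|ci] := leqP i c; last by rewrite /f bin_small // mulr0n mulr0 mul0r.
rewrite mulrnAr mulrnAl /f mulnC mulrnA; congr (_ *+ _); set b := c%:R - i%:R - l%:R.
have bE : c + m - i%:R - (m + l%:R) = b.
  by rewrite /b (Fp_valK charA); ring.
have -> : π (c + m) h * (- T) ^+ i * (d l * rising 1 h l)
    = (- T) ^+ i * d l * (π b h * rising 1 h l).
  rewrite -[- T]scaleN1r proj_TX -!mulrA; congr (_ * _).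
  by rewrite mulrA (proj_wt _ (d_wt (ltn_ord l))) bE mulrA.
rewrite rising_projr -scalerAr.
have -> : \prod_(k < l) (of_Fp A b + 1 + k%:R) = ((c - i) ^_ l)%:R :> A.
  rewrite -prod_ffact (reindex_inj rev_ord_inj); apply: eq_bigr => k _ /=.
  rewrite /b !(of_FpB charA) !(of_Fp_nat charA) natrB // natrB //.
  by rewrite -natr1; ring.
by rewrite scaler_nat -mulrnAl -mulrnAr (ffact_d _ (ltn_ord l)) mulrnAr mulrnAl.
Qed.

Let antipode_rhs (c : 'F_p) : z * π c h * grpX c = \sum_(i < p) \sum_(l < p) f c i l.
Proof.
rewrite -(@sum_antidiagonal _ _ (f c)) => [|i l pil]; last first.
  rewrite /f; have [ci|ic] := ltnP c i; first by rewrite bin_small.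
  rewrite [X in (_ * X)%N]bin_small ?muln0 // ltn_subLR //.
  exact: leq_trans (Fp_lt charA c) pil.
rewrite gE mulr_sumr; apply: eq_bigr => r _.
rewrite mulrnAr -[z * _ * _]mulrA -[- T]scaleN1r proj_TX scaleN1r mulrA.
rewrite (@mul_expr_ad (- T) z r) => [|y|y]; last 2 first.
- by rewrite /adT mulrN mulNr addrA addNr add0r.
- by rewrite /adT !(mulrN, mulNr) mulrBr opprB opprK !mulrA addrC.
rewrite mulr_suml -sumrMnl; apply: eq_bigr => l _; rewrite /f mulrnAl -mulrnA.
have lr : (l <= r)%N by rewrite -ltnS.
rewrite (Fp_valK charA) natrB // opprB addrA [_ - _ - _]addrAC; congr (_ *+ _).
  by rewrite addrK.
have [rc|cr] := leqP r c; last first.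
  rewrite [X in (_ * X)%N = _]bin_small // muln0.
  have [|rlc] := ltnP c (r - l); first by move/bin_small->.
  by rewrite [X in _ = (_ * X)%N]bin_small ?muln0 // ltn_subLR // subnK.
have fg (u v : nat) : (0 < u`! * v`!)%N by rewrite muln_gt0 !fact_gt0.
have rlc : (r - l <= c)%N by rewrite (leq_trans (leq_subr _ _)).
have lrc : (l <= c - (r - l))%N by rewrite leq_subRL // subnK.
have E1 : ('C(r, l) * 'C(c, r) * (l`! * (r - l)`! * (c - r)`!) = c`!)%N.
  by rewrite -(bin_fact rc) -(bin_fact lr); ring.
have E2 : ('C(c, r - l) * 'C(c - (r - l), l) * (l`! * (r - l)`! * (c - r)`!) = c`!)%N.
  rewrite -(bin_fact rlc) -(bin_fact lrc) -subnDA subnK //; ring.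
by apply/eqP; rewrite -(eqn_pmul2r (m := l`! * (r - l)`! * (c - r)`!)) ?E1 ?E2 // !muln_gt0 !fact_gt0.
Qed.

(** With [w = antipode_elt], the claim reads [z w = w g ^ (- m) (\sum_l d l (h + 1)...(h + l))].
    After multiplication by [π_a] and with [c = a - m] it becomes the equality of
    [antipode_rhs] and [antipode_lhs], that is [C(c, r) C(r, l) = C(c, r - l) C(c - (r - l), l)]. *)
Lemma antipode_formula :
  twisted_antipode z = - (grpX (- m) * \sum_(l < p) d l * rising 1 h l).
Proof.
have [_ zS _] := z_prim; rewrite /twisted_antipode zS mulrN mulNr -mulrA; congr (- _).
rewrite -[RHS]mul1r -antipode_elt_inv_l -mulrA; congr (_ * _).
apply: proj_ext => a; rewrite !mulrA (proj_wt _ z_wt) proj_antipode_elt.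
rewrite -[LHS]mulrA proj_antipode_elt mulrA antipode_rhs -[π a h * _ * _]mulrA -grpXD.
by rewrite -antipode_lhs subrK.
Qed.
End Formulas.

(** The case [z = h] of [coproduct_formula]: [ad T] maps [h] to [- T] and [T] to [0]. *)
Lemma coproduct_h : twisted_coproduct h = h ⊗ 1 + 1 ⊗ h + h ⊗ (grpX (- 1) * T).
Proof.
have hw : weight 0 h by rewrite /weight (of_Fp0 charA) scale0r addr0.
pose d l := if l is l'.+1 then (if l' is 0 then - T else 0) else h.
have adTh : adT h = - T.
  by rewrite /adT hT (of_Fp1 charA) scale1r mulrDr mulr1 opprD addrA subrr add0r.
have dE l : (l < p)%N -> d l *+ l`! = iter l adT h.
  move=> _; case: l => [|[|l]]; rewrite ?mulr1n //= ?adTh // mul0rn.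
  elim: l => [|l IH] /=; first by rewrite adTh /adT mulrN mulNr subrr.
  by rewrite -IH /adT mulr0 mul0r subrr.
rewrite (coproduct_formula h_prim hw dE) grpX0 -addrA; congr (_ + _).
have p1 := prime_gt1 pr_p.
rewrite -(big_mkord xpredT (fun l => (-1) ^+ l *: (rising 0 h l ⊗ (grpX (- l%:R) * d l)))).
rewrite big_ltn ?(ltnW p1) // big_ltn // big_nat_cond big1 ?addr0 => [|l]; last first.
  by case: l => [|[|l]] // _; rewrite /d mulr0 tens0r scaler0.
rewrite scale1r /rising !big_ord0 big_ord_recr big_ord0 /= oppr0 grpX0 !mul1r.
by rewrite scale0r !addr0 expr1 mulrN tensNr scaleN1r opprK.
Qed.

Lemma tens_flipE (y z : H) : tens_flip (y ⊗ z) = z ⊗ y.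
Proof.
by rewrite /tens_flip tliftE // => w a u v; rewrite ?tens_linearl ?tens_linearr.
Qed.
Lemma tens_flip_linear : linear (@tens_flip A H).
Proof.
by apply: tlift_linear => w a u v; rewrite ?tens_linearl ?tens_linearr.
Qed.

(** The antisymmetric part of the coproduct of [h] is [h ⊗ b - b ⊗ h] for
    [b = g^-1 T]. If it vanishes, then applying [chi] to one factor of a commutator with
    [h ⊗ 1] shows that [b] commutes with [h], and then [T = [h, T] = - b T], whereas
    [1 + b = g^-1]. *)
Lemma coproduct_noncocommutative (chi : H -> A^o) :
  linear chi -> chi h = 1 -> T != 0 -> tens_flip (twisted_coproduct h) <> twisted_coproduct h.
Proof.
move=> chil chih T0; set b := grpX (- 1) * T; have fl := tens_flip_linear.
rewrite coproduct_h -/b !(linD fl) !tens_flipE [1 ⊗ h + _]addrC => /addrI bh.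
have hb : h * b = b * h.
  pose con (u : tensor H H) : H := tlift (fun (y z : H) => (chi z : A) *: y) u.
  have cl z : linear (fun y : H => (chi z : A) *: y).
    by move=> a v w; rewrite scalerDr !scalerA mulrC.
  have cr (y : H) : linear (fun z : H => (chi z : A) *: y).
    by move=> a v w; rewrite chil scalerDl scalerA.
  have E : con ((h ⊗ 1) * (b ⊗ h)) = con ((b ⊗ h) * (h ⊗ 1)).
    by rewrite bh !tensM mul1r mulr1.
  by move: E; rewrite !tensM mul1r mulr1 /con !tliftE // chih !scale1r.
have gb : grp * b = T by rewrite -grpX1 /b mulrA grpXVr mul1r.
have bg : b * grp = T.
  have gT a : grpX a * T = T * grpX a := grpX_T a.
  by rewrite /b gT -grpX1 -mulrA grpXVl mulr1.
have E1 : h * grp = grp * h - T.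
  rewrite /grp mulrBr mulr1 hT (of_Fp1 charA) scale1r mulrBl mul1r mulrDr mulr1.
  by rewrite opprD addrA.
have E2 : T * (h + 1) = T * h - b * T.
  have <- : h * T = T * (h + 1) by rewrite hT (of_Fp1 charA) scale1r.
  by rewrite -{1}bg mulrA hb -mulrA E1 mulrBr mulrA bg.
have E3 : (1 + b) * T = 0.
  move: E2; rewrite mulrDr mulr1 => /addrI E2.
  by rewrite mulrDl mul1r {1}E2 addNr.
case/eqP: T0; rewrite -[T]mul1r.
have -> : 1 = grp * (1 + b) by rewrite mulrDr mulr1 gb /grp subrK.
by rewrite -mulrA E3 mulr0.
Qed.
End Twist.

(** * The divided power algebra and its derivations *)

Section DividedPowers.
Variables (K : fieldType) (p n : nat) (charK : p \in [pchar K]).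
Local Notation O := (dpow K p n).
Local Notation dmon := (@dmon K p n).
Implicit Types (f g : O) (a b c : 'I_n -> nat).
Let pr_p : prime p := pcharf_prime charK.

Lemma dmonE (a : 'I_n -> nat) (g : midx p n) : dmon a g = [forall i, g i == a i :> nat]%:R.
Proof. by rewrite ffunE. Qed.

Lemma eq_dmon a b : a =1 b -> dmon a = dmon b.
Proof. by move=> ab; apply/ffunP=> g; rewrite !dmonE; under eq_forallb => i do rewrite ab. Qed.

Lemma dmon_midx (g g' : midx p n) : dmon (fun i => g i) g' = (g' == g)%:R.
Proof.
rewrite dmonE; congr (_%:R); congr nat_of_bool; apply/forallP/eqP => [E|-> //].
by apply/ffunP => i; apply/val_inj/eqP/E.
Qed.

Definition valid a := [forall i, (a i < p)%N].

Lemma valid_midx a : valid a -> exists g : midx p n, a =1 (fun i => g i).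
Proof.
by move=> /forallP av; exists [ffun i => Ordinal (av i)] => i; rewrite ffunE.
Qed.
Lemma midx_valid (g : midx p n) : valid (fun i => g i).
Proof. exact/forallP. Qed.
Lemma dmon_invalid a : ~~ valid a -> dmon a = 0.
Proof.
rewrite negb_forall => /existsP[i]; rewrite -leqNgt => pa; apply/ffunP => g.
rewrite dmonE ffunE (_ : [forall _, _] = false) //; apply/negbTE.
by rewrite negb_forall; apply/existsP; exists i; rewrite neq_ltn (leq_trans (ltn_ord _) pa).
Qed.

Lemma dpow_expand f : f = \sum_(g : midx p n) f g *: dmon (fun i => g i).
Proof.
apply/ffunP => g; rewrite sum_ffunE (bigD1 g) //= ffunE dmon_midx eqxx.
rewrite [_ *: _]mulr1 big1 ?addr0 // => g' /negPf gg'.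
by rewrite ffunE dmon_midx eq_sym gg' [_ *: _]mulr0.
Qed.

Lemma linear_dmon_eq (V : lmodType K) (F G : O -> V) : linear F -> linear G ->
  (forall g : midx p n, F (dmon (fun i => g i)) = G (dmon (fun i => g i))) -> F =1 G.
Proof.
move=> Fl Gl E f; rewrite (dpow_expand f) (lin_sum Fl) (lin_sum Gl).
by apply: eq_bigr => g _; rewrite (linZ Fl) (linZ Gl) E.
Qed.

Lemma dmul_linearl g : linear (fun f => dmul f g).
Proof.
move=> k f f'; rewrite /dmul scaler_sumr -big_split; apply: eq_bigr => a _ /=.
rewrite scaler_sumr -big_split; apply: eq_bigr => b _ /=.
by rewrite !ffunE scalerA -scalerDl; congr (_ *: _); rewrite -[_ *: _]/(_ * _); ring.
Qed.
Lemma dmul_linearr f : linear (dmul f).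
Proof.
move=> k g g'; rewrite /dmul scaler_sumr -big_split; apply: eq_bigr => a _ /=.
rewrite scaler_sumr -big_split; apply: eq_bigr => b _ /=.
by rewrite !ffunE scalerA -scalerDl; congr (_ *: _); rewrite -[_ *: _]/(_ * _); ring.
Qed.
Lemma dder_linear i : linear (@dder K p n i).
Proof.
move=> k f g; rewrite /dder scaler_sumr -big_split; apply: eq_bigr => a _ /=.
by rewrite !ffunE scalerA -scalerDl.
Qed.

Lemma dmul_midx (g g' : midx p n) :
  dmul (dmon (fun i => g i)) (dmon (fun i => g' i))
  = (\prod_i 'C(g i + g' i, g i))%:R *: dmon (fun i => g i + g' i)%N.
Proof.
rewrite /dmul (bigD1 g) //= [X in _ + X]big1 ?addr0 => [|a /negPf ag]; last first.
  by rewrite big1 // => b _; rewrite dmon_midx ag !mul0r scale0r.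
rewrite (bigD1 g') //= [X in _ + X]big1 ?addr0 => [|b /negPf bg]; last first.
  by rewrite [dmon (fun i => g' i) b]dmon_midx bg mulr0 mul0r scale0r.
by rewrite !dmon_midx !eqxx !mul1r.
Qed.

(** Exponents that overflow in a factor also overflow in the product, so the product rule
    holds for all exponents. *)
Lemma dmul_dmon a b :
  dmul (dmon a) (dmon b) = (\prod_i 'C(a i + b i, a i))%:R *: dmon (fun i => a i + b i)%N.
Proof.
have [av|/[dup] an /dmon_invalid ->] := boolP (valid a); last first.
  rewrite (lin0 (dmul_linearl _)) dmon_invalid ?scaler0 //.
  by apply: contra an => /forallP v; apply/forallP => i; apply: leq_ltn_trans (v i); apply: leq_addr.
have [bv|/[dup] bn /dmon_invalid ->] := boolP (valid b); last first.
  rewrite (lin0 (dmul_linearr _)) dmon_invalid ?scaler0 //.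
  by apply: contra bn => /forallP v; apply/forallP => i; apply: leq_ltn_trans (v i); apply: leq_addl.
have [g ag] := valid_midx av; have [g' bg'] := valid_midx bv.
rewrite (eq_dmon ag) (eq_dmon bg') dmul_midx; congr (_%:R *: _).
  by apply: eq_bigr => i _; rewrite ag bg'.
by apply: eq_dmon => i; rewrite ag bg'.
Qed.

Lemma dder_dmon i a : valid a ->
  dder i (dmon a) = (0 < a i)%N%:R *: dmon (fun r => a r - (r == i))%N.
Proof.
move=> /valid_midx[g ag]; rewrite (eq_dmon ag) /dder big_mkcond (bigD1 g) //=.
rewrite big1 ?addr0 => [|g' /negPf gg']; last by rewrite dmon_midx gg' scale0r; case: ifP.
rewrite dmon_midx eqxx scale1r ag; have [gi|gi] := posnP (g i : nat).
  by rewrite scale0r.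
by rewrite scale1r; apply: eq_dmon => r; rewrite ag eq_sym.
Qed.

Lemma dmulC f g : dmul f g = dmul g f.
Proof.
move: f; apply: linear_dmon_eq => [||a]; [exact: dmul_linearl|exact: dmul_linearr|].
move: g; apply: linear_dmon_eq => [||b]; [exact: dmul_linearr|exact: dmul_linearl|].
rewrite !dmul_dmon; congr (_%:R *: _).
  by apply: eq_bigr => i _; rewrite addnC -bin_sub ?leq_addl // addnK.
by apply: eq_dmon => i; rewrite addnC.
Qed.

Lemma dmulA f g h : dmul f (dmul g h) = dmul (dmul f g) h.
Proof.
move: f; apply: linear_dmon_eq => [||a].
- exact: dmul_linearl.
- by move=> k f f'; rewrite !dmul_linearl.
move: g; apply: linear_dmon_eq => [||b].
- by move=> k f f'; rewrite dmul_linearl !dmul_linearr.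
- by move=> k f f'; rewrite dmul_linearr !dmul_linearl.
move: h; apply: linear_dmon_eq => [||c].
- by move=> k f f'; rewrite !dmul_linearr.
- exact: dmul_linearr.
rewrite !dmul_dmon (linZ (dmul_linearr _)) (linZ (dmul_linearl _)) !dmul_dmon !scalerA.
congr (_ *: _); last by apply: eq_dmon => i; rewrite addnA.
rewrite -!natrM -!big_split; congr (_%:R); apply: eq_bigr => i _ /=.
apply/eqP; rewrite -(eqn_pmul2r (m := (a i)`! * (b i)`! * (c i)`!)) ?muln_gt0 ?fact_gt0 //.
have E u v : ('C(u + v, u) * (u`! * v`!) = (u + v)`!)%N.
  by rewrite -[RHS](bin_fact (leq_addr v u)) addKn.
apply/eqP; have := E (a i) (b i); have := E (b i) (c i).
have := E (a i) (b i + c i)%N; have := E (a i + b i)%N (c i); rewrite -!addnA.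
by move=> <- E1 E2 E3; rewrite -E3 in E1 *; rewrite -E2 in E1; nia.
Qed.

Lemma dder_comm i j f : dder i (dder j f) = dder j (dder i f).
Proof.
have L u v : linear (fun f => dder u (dder v f)).
  by move=> k f1 f2; rewrite !dder_linear.
move: f; apply: (linear_dmon_eq (L i j) (L j i)) => a.
have [->//|ij] := eqVneq i j.
have av r : valid (fun s => a s - (s == r))%N.
  by apply/forallP => s; apply: leq_ltn_trans (leq_subr _ _) (ltn_ord _).
rewrite !dder_dmon ?midx_valid // !(linZ (dder_linear _)) !dder_dmon // !scalerA.
rewrite (negPf ij) eq_sym (negPf ij) !subn0 mulrC; congr (_ *: _).
by apply: eq_dmon => r; rewrite subnAC.
Qed.

(** On monomials this is Pascal's rule, except when [a i + b i = p] : the product then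
    vanishes, while the coefficient on the right is ['C(p, a i)], divisible by [p]. *)
Lemma dder_dmul i f g : dder i (dmul f g) = dmul (dder i f) g + dmul f (dder i g).
Proof.
move: f; apply: linear_dmon_eq => [||a].
- by move=> k f f'; rewrite dmul_linearl dder_linear.
- by move=> k f f'; rewrite dder_linear !dmul_linearl scalerDr addrACA.
move: g; apply: linear_dmon_eq => [||b].
- by move=> k f f'; rewrite dmul_linearr dder_linear.
- by move=> k f f'; rewrite dder_linear !dmul_linearr scalerDr addrACA.
rewrite dmul_dmon (linZ (dder_linear _)) !(dder_dmon i (midx_valid _)).
rewrite (linZ (dmul_linearl _)) (linZ (dmul_linearr _)) !dmul_dmon !scalerA.
pose s r := (a r + b r - (r == i))%N.
have Ea : (0 < a i)%N -> dmon (fun r => a r - (r == i) + b r)%N = dmon s.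
  by move=> ai; apply: eq_dmon => r; rewrite /s addnBAC //; case: eqP => // ->.
have Eb : (0 < b i)%N -> dmon (fun r => a r + (b r - (r == i)))%N = dmon s.
  by move=> bi; apply: eq_dmon => r; rewrite /s addnBA //; case: eqP => // ->.
pose P := (\prod_(r | r != i) 'C(a r + b r, a r))%N.
have PE (a' b' : 'I_n -> nat) : (forall r, r != i -> a' r = a r /\ b' r = b r) ->
    (\prod_r 'C(a' r + b' r, a' r) = 'C(a' i + b' i, a' i) * P)%N.
  move=> E; rewrite (bigD1 i) //=; congr (_ * _)%N.
  by apply: eq_bigr => r /E[-> ->].
have Ns r : r != i -> forall m, (m - (r == i) = m)%N.
  by move=> /negPf-> m; rewrite subn0.
rewrite (PE (fun r => a r) (fun r => b r)) //.
rewrite (PE (fun r => a r - (r == i))%N (fun r => b r)) => [|r /Ns->//].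
rewrite (PE (fun r => a r) (fun r => b r - (r == i))%N) => [|r /Ns->//]; rewrite eqxx.
have -> : (((0 < a i)%N)%:R * ('C(a i - 1 + b i, a i - 1) * P)%:R)
      *: dmon (fun r => a r - (r == i) + b r)%N
    = ((0 < a i) * 'C(a i - 1 + b i, a i - 1) * P)%:R *: dmon s :> O.
  by case: (posnP (a i)) => [->|/Ea->]; rewrite ?mul0n ?mul0r ?scale0r // !mul1n mul1r.
have -> : (((0 < b i)%N)%:R * ('C(a i + (b i - 1), a i) * P)%:R)
      *: dmon (fun r => a r + (b r - (r == i)))%N
    = ((0 < b i) * 'C(a i + (b i - 1), a i) * P)%:R *: dmon s :> O.
  by case: (posnP (b i)) => [->|/Eb->]; rewrite ?mul0n ?mul0r ?scale0r // !mul1n mul1r.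
rewrite -scalerDl -natrD -mulnDl.
have -> : ((0 < a i) * 'C(a i - 1 + b i, a i - 1) + (0 < b i) * 'C(a i + (b i - 1), a i)
    = (0 < a i + b i)%N * 'C(a i + b i, a i))%N.
  case: (a i : nat) (b i : nat) => [|u] [|v]; rewrite ?mul0n ?mul1n ?bin0 ?addn0 //=.
    by rewrite !subn1 /= !binn.
  by rewrite !subn1 /= [in RHS]addSn binS addnC addSnnS.
have [v|nv] := boolP (valid (fun r => a r + b r)%N).
  rewrite dder_dmon // scalerA -natrM; congr (_%:R *: _).
  by rewrite mulnC mulnA.
rewrite (dmon_invalid nv) (lin0 (dder_linear _)) scaler0.
have [sv|/dmon_invalid->] := boolP (valid s); last by rewrite scaler0.
have ab : (a i + b i = p)%N.
  move: nv; rewrite negb_forall => /existsP[r]; rewrite -leqNgt => pr.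
  have := forallP sv r; rewrite /s; have [ri|ri] := eqVneq r i; last first.
    by rewrite subn0 ltnNge pr.
  by rewrite -ri /= => lt; apply/eqP; rewrite eqn_leq pr andbT; move: lt pr; case: (_ + _)%N => //= m; rewrite subn1.
have ai : (0 < a i < p)%N.
  rewrite ltn_ord andbT lt0n; apply/eqP => a0; have := ltn_ord (b i).
  by move: ab; rewrite a0 add0n => ->; rewrite ltnn.
have C0 : ('C(a i + b i, a i))%:R = 0 :> K.
  by rewrite ab; apply/eqP; rewrite -(dvdn_pcharf charK); apply: prime_dvd_bin.
by rewrite natrM natrM C0 mulr0 mul0r scale0r.
Qed.

Lemma act_linearr (E : jw K p n) : linear (jw_act E).
Proof.
move=> k f g; rewrite /jw_act scaler_sumr -big_split; apply: eq_bigr => i _ /=.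
by rewrite dder_linear dmul_linearr.
Qed.
Lemma act_linearl f : linear (fun E : jw K p n => jw_act E f).
Proof.
move=> k E F; rewrite /jw_act scaler_sumr -big_split; apply: eq_bigr => i _ /=.
by rewrite !ffunE dmul_linearl.
Qed.

(** Expanding by the Leibniz rule, the terms with two derivatives of [f] are symmetric in
    [E] and [F] and cancel. *)
Lemma act_br (E F : jw K p n) f :
  jw_act (jw_br E F) f = jw_act E (jw_act F f) - jw_act F (jw_act E f).
Proof.
have D (G G' : jw K p n) : jw_act G (jw_act G' f)
    = \sum_j dmul (jw_act G (G' j)) (dder j f)
      + \sum_i \sum_j dmul (dmul (G i) (G' j)) (dder i (dder j f)).
  transitivity (\sum_i \sum_j (dmul (dmul (G i) (dder i (G' j))) (dder j f)
      + dmul (dmul (G i) (G' j)) (dder i (dder j f)))).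
    apply: eq_bigr => i _; rewrite (lin_sum (dder_linear _)) (lin_sum (dmul_linearr _)).
    by apply: eq_bigr => j _; rewrite dder_dmul (linD (dmul_linearr _)) !dmulA.
  under eq_bigr => i _ do rewrite big_split.
  rewrite big_split exchange_big /=; congr (_ + _); apply: eq_bigr => j _.
  by rewrite /jw_act (lin_sum (dmul_linearl _)).
rewrite !D opprD addrACA [X in _ + (X - _)]exchange_big /=.
rewrite [X in _ + (X - _)](_ : _ = \sum_i \sum_j dmul (dmul (F i) (E j)) (dder i (dder j f))).
  rewrite subrr addr0 -sumrB; apply: eq_bigr => j _.
  by rewrite ffunE (linB (dmul_linearl _)).
by apply: eq_bigr => i _; apply: eq_bigr => j _; rewrite dder_comm (dmulC (E j)).
Qed.
End DividedPowers.

(** * The natural module of the restricted enveloping algebra *)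

Section WittAlgebra.
Variables (K : fieldType) (p n : nat) (charK : p \in [pchar K]).
Local Notation O := (dpow K p n).
Local Notation dmon := (@dmon K p n).
Local Notation xD := (@xD K p n).
Implicit Types (f : O) (a b c : 'I_n -> nat).
Let pr_p : prime p := pcharf_prime charK.

Let scaleoE (s : K) (x : K^o) : s *: x = s * x. Proof. by []. Qed.

Lemma act_xD a i f : jw_act (xD a i) f = dmul (dmon a) (dder i f).
Proof.
rewrite /jw_act (bigD1 i) //= big1 ?addr0 => [|l /negPf li].
  by rewrite /xD ffunE eqxx.
by rewrite /xD ffunE li (lin0 (dmul_linearl _)).
Qed.

Lemma act_xD_dmon a i b : valid p b -> jw_act (xD a i) (dmon b) =
  ((0 < b i) * \prod_r 'C(a r + (b r - (r == i)), a r))%:R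
    *: dmon (fun r => a r + (b r - (r == i)))%N.
Proof.
move=> bv; rewrite act_xD dder_dmon // (linZ (dmul_linearr _)) dmul_dmon scalerA.
by rewrite natrM.
Qed.

Lemma act_toral k a : jw_act (xD (ei k) k) (dmon a) = (a k)%:R *: dmon a.
Proof.
have [av|/dmon_invalid->] := boolP (valid p a); last first.
  by rewrite (lin0 (act_linearr _)) scaler0.
rewrite act_xD_dmon //; have [->|ak] := posnP (a k); first by rewrite mul0n !scale0r.
rewrite mul1n (bigD1 k) //= /ei eqxx big1 ?muln1 => [|r /negPf->]; last by rewrite bin0.
rewrite subnKC // bin1; congr (_ *: _); apply: eq_dmon => r.
by case: eqP => [->|]; rewrite ?subnKC // subn0.
Qed.

Lemma ei_valid (k : 'I_n) : valid p (ei k).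
Proof. by apply/forallP => r; rewrite /ei; case: (_ == _); rewrite ?prime_gt1 ?prime_gt0. Qed.

Lemma act_ei a i k : jw_act (xD a i) (dmon (ei k)) = (i == k)%:R *: dmon a.
Proof.
rewrite act_xD_dmon ?ei_valid //; have [->|/negPf ik] := eqVneq i k; last first.
  by rewrite /ei ik mul0n !scale0r.
rewrite /ei eqxx mul1n big1 => [|r _]; last by rewrite subnn addn0 binn.
by congr (_ *: _); apply: eq_dmon => r; rewrite subnn addn0.
Qed.

Lemma br_toral k a i :
  jw_br (xD (ei k) k) (xD a i) = ((a k)%:R - (i == k)%:R) *: xD a i.
Proof.
apply/ffunP => l; rewrite ffunE [RHS]ffunE [xD a i l]ffunE [xD _ _ l]ffunE.
rewrite !(fun_if (jw_act _)) !(lin0 (act_linearr _)) act_toral act_ei.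
have [->|li] := eqVneq l i; last first.
  rewrite scaler0 sub0r; have [lk|] := eqVneq l k; last by rewrite oppr0.
  by rewrite -lk eq_sym (negPf li) scale0r oppr0.
by rewrite scalerBl; case: eqP => // _; rewrite scale0r.
Qed.

Lemma br_linearr (E : jw K p n) : linear (jw_br E).
Proof.
move=> k F G; apply/ffunP => l; rewrite !ffunE (act_linearr E) (act_linearl _ k F G).
by rewrite opprD addrACA scalerBr.
Qed.

(** An operator that raises a degree [mu] with values below [m] has zero [m]-th iterate. *)
Lemma iter_act_nil (phi : O -> O) (mu : midx p n -> nat) (m : nat) f : linear phi ->
    (forall g, (mu g < m)%N) ->
    (forall g g' : midx p n, phi (dmon (fun r => g r)) g' != 0 -> (mu g < mu g')%N) ->
  iter m phi f = 0.
Proof.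
move=> phil mum muP; suff E (r : nat) (g : midx p n) : iter r phi f g != 0 -> (r <= mu g)%N.
  apply/ffunP => g; rewrite [RHS]ffunE; apply: contraTeq (mum g) => /E.
  by rewrite leqNgt.
elim: r g => // r IH g; rewrite iterS (dpow_expand (iter r phi f)) (lin_sum phil) sum_ffunE.
apply: contraNT; rewrite -leqNgt => mg; rewrite big1 // => g' _.
rewrite (linZ phil) ffunE; apply/eqP; apply: contraLR mg.
rewrite scaleoE mulf_eq0 negb_or -ltnNge => /andP[/IH rg' /muP].
exact: leq_ltn_trans.
Qed.

(** Applying [x^(a) D_i] adds [a r - (r == i)] to the [r]-th exponent. If [a <> ei i],
    then either some exponent strictly increases, or [a = 0] and the [i]-th exponent
    strictly decreases; exponents lie between [0] and [p - 1]. *)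
Lemma act_nil (a : midx p n) i f : ~ (forall r, a r = ei i r :> nat) ->
  iter p (jw_act (xD (fun r => a r) i)) f = 0.
Proof.
move=> ai.
have supp (g g' : midx p n) : jw_act (xD (fun r => a r) i) (dmon (fun r => g r)) g' != 0 ->
    (0 < g i)%N /\ forall r, (g' r = a r + (g r - (r == i)) :> nat)%N.
  rewrite act_xD_dmon ?midx_valid // ffunE dmonE scaleoE.
  have [gi|gi] := posnP (g i : nat); first by rewrite mul0n mul0r eqxx.
  case: (boolP [forall _, _]) => [/forallP E _|]; last by rewrite mulr0 eqxx.
  by split=> // r; apply/eqP.
have [/existsP[r ar]|na] := boolP [exists r, (ei i r < a r)%N].
  apply: (@iter_act_nil _ (fun g => g r)) => [|g|g g' /supp[gi E]].
  - exact: act_linearr.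
  - exact: ltn_ord.
  - rewrite E; move: ar; rewrite /ei; case: eqP => [->|_] ar; last by rewrite subn0 -addn1 addnC leq_add.
    by rewrite -[X in (X < _)%N](subnK gi) addnC ltn_add2r.
have a0 : a i = 0%N :> nat.
  apply/eqP; case: eqP => // ai0; case: ai => r.
  move: na; rewrite negb_exists => /forallP na.
  have := na i; have := na r; rewrite -!leqNgt /ei eqxx.
  by have [->|_] := eqVneq r i; lia.
apply: (@iter_act_nil _ (fun g => p.-1 - g i)%N) => [|g|g g' /supp[gi E]].
- exact: act_linearr.
- by rewrite (leq_ltn_trans (leq_subr _ _)) // prednK // prime_gt0.
- have := ltn_ord (g i); rewrite E a0 eqxx add0n; lia.
Qed.

Lemma natr_frob m : (m%:R : K) ^+ p = m%:R.
Proof. by have := pFrobenius_aut_nat charK m; rewrite pFrobenius_autE. Qed.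

Lemma act_toralX k f :
  iter p (jw_act (xD (ei k) k)) f = jw_act (xD (ei k) k) f.
Proof.
have L m : linear (iter m (jw_act (xD (ei k) k))).
  by elim: m => [|m IH] c f1 f2 //; rewrite !iterS IH act_linearr.
move: f; apply: (linear_dmon_eq (L p) (act_linearr _)) => g; rewrite act_toral.
have E m : iter m (jw_act (xD (ei k) k)) (dmon (fun r => g r))
    = ((g k)%:R ^+ m) *: dmon (fun r => g r).
  elim: m => [|m IH]; first by rewrite scale1r.
  by rewrite iterS IH (linZ (act_linearr _)) act_toral scalerA exprSr.
by rewrite E natr_frob.
Qed.

(** The divided powers form a module, by [act_br], [act_toralX] and [act_nil]. Matrices
    provide the target ring of the lift. *)
Lemma ujw_rep : exists R : ujw n charK -> O -> O,
  [/\ forall z, linear (R z), forall f, linear (R^~ f), forall f, R 1 f = f,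
      forall z w f, R (z * w) f = R z (R w f) & forall E f, R (ujw_in charK E) f = jw_act E f].
Proof.
have [M cardM] : exists M, #|{: midx p n}| = M.+1.
  exists #|{: midx p n}|.-1; rewrite prednK //; apply/card_gt0P.
  by exists [ffun=> Ordinal (prime_gt0 pr_p)].
pose idx (r : 'I_M.+1) : midx p n := enum_val (cast_ord (esym cardM) r).
pose rk (g : midx p n) : 'I_M.+1 := cast_ord cardM (enum_rank g).
have idxK : cancel idx rk by move=> r; rewrite /idx /rk enum_valK cast_ordKV.
have rkK : cancel rk idx by move=> g; rewrite /idx /rk cast_ordK enum_rankK.
pose X (r : 'I_M.+1) : O := dmon (fun s => idx r s).
pose mx (phi : O -> O) : 'M[K]_M.+1 := \matrix_(r, s) phi (X s) (idx r).
have Xsum f : f = \sum_r f (idx r) *: X r.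
  rewrite {1}(dpow_expand f) (reindex idx) //=.
  by exists rk => r _; [exact: idxK | exact: rkK].
have mxM phi psi : linear phi -> mx phi *m mx psi = mx (phi \o psi).
  move=> phil; apply/matrixP => r s; rewrite !mxE /= [psi (X s) in RHS]Xsum (lin_sum phil).
  rewrite sum_ffunE; apply: eq_bigr => t _; rewrite !mxE (linZ phil) ffunE.
  exact: mulrC.
have mxM' phi psi : linear phi -> mx phi * mx psi = mx (phi \o psi) := @mxM phi psi.
have mx1 : mx id = 1%:M.
  apply/matrixP => r s; rewrite !mxE /X dmon_midx (inj_eq (can_inj idxK)).
  by [].
have mxX m (phi : O -> O) : linear phi -> mx phi ^+ m = mx (iter m phi).
  move=> phil; elim: m => [|m IH]; first by rewrite mx1.
  by rewrite exprS IH mxM'.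
pose ap (B : 'M[K]_M.+1) f : O := \sum_r (\sum_s B r s * f (idx s)) *: X r.
have apE B f r : ap B f (idx r) = \sum_s B r s * f (idx s).
  rewrite /ap sum_ffunE (bigD1 r) //= ffunE /X dmon_midx eqxx scaleoE mulr1.
  rewrite [X in _ + X]big1 ?addr0 // => t tr; rewrite ffunE dmon_midx (inj_eq (can_inj idxK)).
  by rewrite eq_sym (negPf tr) scaleoE mulr0.
have apM B C f : ap (B *m C) f = ap B (ap C f).
  apply: eq_bigr => r _; congr (_ *: _); under [RHS]eq_bigr => s _ do rewrite apE mulr_sumr.
  rewrite exchange_big; apply: eq_bigr => s _ /=; rewrite mxE mulr_suml.
  by apply: eq_bigr => t _; rewrite mulrA.
have ap1 f : ap 1%:M f = f.
  rewrite {2}[f]Xsum; apply: eq_bigr => r _; congr (_ *: _).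
  rewrite (bigD1 r) //= mxE eqxx mul1r big1 ?addr0 // => s sr.
  by rewrite mxE eq_sym (negPf sr) mul0r.
have apmx phi f : linear phi -> ap (mx phi) f = phi f.
  move=> phil; rewrite [RHS]Xsum; apply: eq_bigr => r _; congr (_ *: _).
  rewrite [f in RHS]Xsum (lin_sum phil) sum_ffunE; apply: eq_bigr => s _.
  by rewrite mxE (linZ phil) ffunE; apply: mulrC.
have [||||G [Gl GM GE]] := @ujw_lift K p n charK 'M[K]_M.+1 (fun E => mx (jw_act E)).
- move=> k E F; apply/matrixP => r s; rewrite !mxE act_linearl !ffunE.
  by [].
- move=> E F; rewrite !mxM'; try exact: act_linearr.
  by apply/matrixP => r s; rewrite !mxE act_br // !ffunE.
- move=> i; rewrite mxX; last exact: act_linearr.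
  by apply/matrixP => r s; rewrite !mxE act_toralX.
- move=> a i ai; rewrite mxX; last exact: act_linearr.
  by apply/matrixP => r s; rewrite !mxE act_nil // ffunE.
exists (fun z f => ap (G z) f); split=> [z|f|f|z w f|E f].
- move=> k f g; rewrite /ap scaler_sumr -big_split; apply: eq_bigr => r _ /=.
  rewrite scalerA -scalerDl mulr_sumr -big_split /=; congr (_ *: _).
  apply: eq_bigr => s _; rewrite !ffunE mulrDr; congr (_ + _).
  by rewrite scaleoE mulrCA.
- move=> k z w; rewrite Gl /ap scaler_sumr -big_split; apply: eq_bigr => r _ /=.
  rewrite scalerA -scalerDl mulr_sumr -big_split /=; congr (_ *: _).
  by apply: eq_bigr => s _; rewrite !mxE mulrDl mulrA.
- by rewrite GM.1 ap1.
- by rewrite GM.2 apM.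
- by rewrite GE apmx //; apply: act_linearr.
Qed.
End WittAlgebra.

(** * The restricted Poincare-Birkhoff-Witt theorem *)

Section PBW.
Variables (K : fieldType) (p : nat) (charK : p \in [pchar K]).
Variables (U : augAlgType K) (J : finType) (Y : J -> U).
Let pr_p : prime p := pcharf_prime charK.
Implicit Types (w v s : seq J) (x y z : U) (m : nat).

Definition word w : U := \prod_(j <- w) Y j.

Lemma word_cons j w : word (j :: w) = Y j * word w.
Proof. by rewrite /word big_cons. Qed.
Lemma word_cat w v : word (w ++ v) = word w * word v.
Proof. by rewrite /word big_cat. Qed.
Lemma word_nil : word [::] = 1.
Proof. by rewrite /word big_nil. Qed.

(** The filtration of the algebra by the length of words: the span of the words of length
    less than [m]. *)
Inductive short m : U -> Prop :=
| short0 : short m 0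
| short_add k w x : (size w < m)%N -> short m x -> short m (k *: word w + x).

Lemma shortD m x y : short m x -> short m y -> short m (x + y).
Proof. by elim=> [|k w z sw _ IH] sy; rewrite ?add0r // -addrA; constructor; auto. Qed.
Lemma shortZ m k x : short m x -> short m (k *: x).
Proof.
elim=> [|k' w z sw _ IH]; first by rewrite scaler0; constructor.
by rewrite scalerDr scalerA; constructor.
Qed.
Lemma short_sum m (I : Type) (r : seq I) (F : I -> U) :
  (forall i, short m (F i)) -> short m (\sum_(i <- r) F i).
Proof. by move=> sF; elim/big_ind: _ => //; [constructor | exact: shortD]. Qed.
Lemma short_word m w : (size w < m)%N -> short m (word w).
Proof. by move=> sw; rewrite -[word w]scale1r -[_ *: _]addr0; do 2?constructor. Qed.
Lemma short_mul m j x : short m x -> short m.+1 (Y j * x).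
Proof.
elim=> [|k w z sw _ IH]; first by rewrite mulr0; constructor.
by rewrite mulrDr -scalerAr -word_cons; constructor.
Qed.
Lemma short_le m m' x : (m <= m')%N -> short m x -> short m' x.
Proof.
move=> mm'; elim=> [|k w z sw _ IH]; constructor => //.
exact: leq_trans mm'.
Qed.

Section Spanning.
Variables (c : J -> J -> J -> K) (e : J -> J -> K).
Hypothesis Ybr : forall i j, Y i * Y j - Y j * Y i = \sum_l c i j l *: Y l.
Hypothesis Yp : forall i, Y i ^+ p = \sum_l e i l *: Y l.

(** Each exchange of neighbours costs a bracket, a combination of shorter words. *)
Lemma word_insert i w v :
  short (size (w ++ v)).+1 (word (i :: w ++ v) - word (w ++ i :: v)).
Proof.
elim: w => [|j w IH] /=; first by rewrite subrr; constructor.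
rewrite !word_cons -[X in short _ X](subrKA (Y j * (Y i * word (w ++ v)))).
apply: shortD.
  rewrite !mulrA -mulrBl Ybr mulr_suml; apply: short_sum => l.
  by rewrite -scalerAl -word_cons; apply/shortZ/short_word.
by rewrite -mulrBr; apply: short_mul; rewrite -word_cons.
Qed.

Lemma word_perm w v : perm_eq w v -> short (size w) (word w - word v).
Proof.
elim: w v => [|i w IH] v wv.
  by move: wv; rewrite perm_sym => /perm_nilP->; rewrite subrr; constructor.
have iv : i \in v by rewrite -(perm_mem wv) mem_head.
case/splitPr: iv wv => v1 v2 wv.
have wv' : perm_eq w (v1 ++ v2).
  by rewrite -(perm_cons i) (perm_trans wv) // perm_sym -cat1s -(cat1s i v2) perm_catCA.
rewrite -[X in short _ X](subrKA (word (i :: v1 ++ v2))); apply: shortD.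
  by rewrite !word_cons -mulrBr; apply/short_mul/IH.
by have := word_insert i v1 v2; rewrite /= (perm_size wv').
Qed.

Definition ordered (a : J -> nat) : seq J := flatten [seq nseq (a j) j | j <- enum J].

Lemma count_ordered a j : count_mem j (ordered a) = a j.
Proof.
rewrite /ordered count_flatten -map_comp sumnE big_map big_enum /= (bigD1 j) //=.
rewrite count_nseq /= eqxx mul1n big1 ?addn0 // => i ij.
by rewrite count_nseq /= (negPf ij) mul0n.
Qed.
Lemma perm_ordered w : perm_eq w (ordered (fun j => count_mem j w)).
Proof. by rewrite /perm_eq; apply/allP => j _; rewrite /= count_ordered. Qed.

Lemma word_pow j m : word (nseq m j) = Y j ^+ m.
Proof. by elim: m => [|m IH]; rewrite ?word_nil // /= word_cons IH exprS. Qed.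

(** Modulo shorter words the occurrences of [j] may be brought together, and a factor
    [Y j ^+ p] is a combination of single letters. *)
Lemma word_reduce j w : (p <= count_mem j w)%N -> short (size w) (word w).
Proof.
move=> pj; pose w' := filter (predC1 j) w.
have wE : perm_eq w (nseq (count_mem j w) j ++ w').
  have /permPl wE := perm_filterC (pred1 j) w; rewrite perm_sym in wE.
  apply: perm_trans wE _.
  rewrite perm_cat2r (_ : filter _ _ = nseq (count_mem j w) j) ?perm_refl //.
  rewrite -size_filter; apply/all_pred1P; exact: filter_all.
rewrite -(subrK (word (nseq (count_mem j w) j ++ w')) (word w)).
apply: shortD; first exact: word_perm.
have := perm_size wE; rewrite size_cat size_nseq => ->.
rewrite -{2}(subnKC pj) nseqD -catA word_cat word_pow Yp mulr_suml.
apply: short_sum => l; rewrite -scalerAl; apply: shortZ; rewrite -word_cons.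
apply: short_word; rewrite /= size_cat size_nseq; by move: pj (prime_gt1 pr_p); clear; move: (count_mem j w) (size w') => c1 c2; lia.
Qed.

Local Notation expo := {ffun J -> 'I_p}.
Definition basis_word (a : expo) := word (ordered (fun j => a j)).
Definition pbw (k : {ffun expo -> K^o}) : U := \sum_a k a *: basis_word a.

Lemma pbw_linear : linear pbw.
Proof.
move=> r k k'; rewrite /pbw scaler_sumr -big_split; apply: eq_bigr => a _ /=.
by rewrite !ffunE scalerDl scalerA.
Qed.

(** Induction on the length: modulo shorter words, a word is ordered, and it is itself
    short when a letter occurs at least [p] times. *)
Lemma pbw_short m x : short m x -> exists k, x = pbw k.
Proof.
elim: m x => [|m IHm] x.
  by case=> // ; exists 0; rewrite (lin0 pbw_linear).
elim=> [|r w z wm _ [k ->]]; first by exists 0; rewrite (lin0 pbw_linear).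
suff [k' ->] : exists k', word w = pbw k' by exists (r *: k' + k); rewrite pbw_linear.
have sE y : short (size w) y -> exists k', y = pbw k'.
  by move=> sy; apply/IHm/(short_le _ sy).
have [/forallP small|] := boolP [forall j, (count_mem j w < p)%N]; last first.
  by rewrite negb_forall => /existsP[j]; rewrite -leqNgt => /word_reduce/sE.
pose a : expo := [ffun j => Ordinal (small j)].
have [k' wE] := sE _ (word_perm (perm_ordered w)).
exists (k' + [ffun b => (b == a)%:R]); rewrite (linD pbw_linear) -wE.
rewrite /pbw (bigD1 a) //= ffunE eqxx scale1r big1 ?addr0 => [|b /negPf ba]; last first.
  by rewrite ffunE ba scale0r.
have aE : ordered (fun j => a j) = ordered (fun j => count_mem j w).
  by rewrite /ordered; congr flatten; apply: eq_map => j; rewrite ffunE.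
by rewrite /basis_word aE subrK.
Qed.

Hypothesis gen : forall P : U -> Prop, P 0 ->
  (forall k w x, P x -> P (k *: word w + x)) -> forall x, P x.

Lemma pbw_surj x : exists k, x = pbw k.
Proof.
have [m /pbw_short//] : exists m, short m x.
elim/gen: x => [|k w x [m sx]]; first by exists 0; constructor.
exists (maxn (size w).+1 m); constructor; first by rewrite leq_max leqnn.
by apply: short_le sx; rewrite leq_maxr.
Qed.
End Spanning.

Section Independence.
Variable D0 : U -> tensor U U.
Hypotheses (D0l : linear D0) (D0M : monoid_morphism D0).
Hypothesis D0Y : forall j, D0 (Y j) = Y j ⊗ 1 + 1 ⊗ Y j.

(** [(f ⊗ id) D0], the contraction of the coproduct by a linear form [f]. *)
Definition contract (f : U -> K) x : U := tlift (fun y z : U => f y *: z) (D0 x).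

Section Contract.
Variable f : U -> K.
Hypothesis fl : scalar f.
Let bl z : linear (fun y => f y *: z).
Proof. by move=> a y y'; rewrite fl scalerDl scalerA. Qed.
Let br y : linear (fun z => f y *: z).
Proof. by move=> a z z'; rewrite scalerDr !scalerA mulrC. Qed.
Lemma contract_linear : linear (contract f).
Proof. by move=> a x y; rewrite /contract D0l (tlift_linear bl br). Qed.
Lemma contract1 : contract f 1 = f 1 *: 1.
Proof. by rewrite /contract D0M.1 tens1 tliftE. Qed.
Let fj_scalar j : scalar (fun y => f (Y j * y)).
Proof. by move=> a y z; rewrite mulrDr -scalerAr fl. Qed.
(** [D0 (Y j)] is primitive, so [Y j] goes into one of the two factors. *)
Lemma contract_mul j x : contract f (Y j * x)
  = contract (fun y => f (Y j * y)) x + Y j * contract f x.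
Proof.
have L := tlift_linear bl br.
have bl' z : linear (fun y : U => f (Y j * y) *: z).
  by move=> a y y'; rewrite fj_scalar scalerDl scalerA.
have br' y : linear (fun z => f (Y j * y) *: z).
  by move=> a z z'; rewrite scalerDr !scalerA mulrC.
have L' := tlift_linear bl' br'.
rewrite /contract D0M.2 D0Y; elim/tens_ind: (D0 x) => [|y z u IH].
  by rewrite mulr0 (lin0 L) (lin0 L') mulr0 addr0.
rewrite mulrDr (linD L) IH (linD L) (linD L') mulrDr addrACA; congr (_ + _).
rewrite mulrDl !tensM !mul1r (linD L) !(tliftE bl br) (tliftE bl' br').
by rewrite scalerAr.
Qed.
End Contract.

Lemma contract_word w f : scalar f ->
  short (size w) (contract f (word w) - f 1 *: word w).
Proof.
elim: w f => [|j w IH] f fl.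
  by rewrite word_nil contract1 // subrr; constructor.
have fjl : scalar (fun y => f (Y j * y)).
  by move=> a y z; rewrite mulrDr -scalerAr fl.
rewrite word_cons contract_mul // -addrA scalerAr -mulrBr; apply: shortD.
  rewrite -[X in short _ X](subrK (f (Y j * 1) *: word w)); apply: shortD.
    by apply: short_le (IH _ fjl).
  exact/shortZ/short_word.
exact/short_mul/IH.
Qed.

(** The derivation of words that replaces a letter [Y j] by the scalar [f (Y j)]: the
    leading term of the contraction by a form that vanishes at [1]. *)
Fixpoint del (f : U -> K) w : U :=
  if w is j :: w' then f (Y j) *: word w' + Y j * del f w' else 0.

Lemma contract_del w f : scalar f -> f 1 = 0 ->
  short (size w).-1 (contract f (word w) - del f w).
Proof.
move=> fl f1; elim: w => [|j w IH] /=.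
  by rewrite word_nil contract1 // f1 scale0r subrr; constructor.
have fjl : scalar (fun y => f (Y j * y)).
  by move=> a y z; rewrite mulrDr -scalerAr fl.
rewrite word_cons contract_mul // opprD addrACA -mulrBr; apply: shortD.
  by have := contract_word w fjl; rewrite mulr1.
case: w IH => [|i w] IH; last exact: short_mul.
by rewrite word_nil contract1 // f1 scale0r subrr mulr0; constructor.
Qed.

Variable xi : J -> U -> K.
Hypotheses (xil : forall j, scalar (xi j)) (xi1 : forall j, xi j 1 = 0).
Hypothesis xiY : forall j i, xi j (Y i) = (i == j)%:R.

(** The convolution product of the forms [xi j] for [j] in [s]. *)
Fixpoint xis s : U -> K := if s is j :: s' then xis s' \o contract (xi j) else @aug K U.

Lemma xis_scalar s : scalar (xis s).
Proof.
elim: s => [|j s IH] a x y /=; first exact: aug_scalar.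
by rewrite (contract_linear (xil j)) IH.
Qed.
Let xisD s : {morph (xis s) : x y / x + y}.
Proof. by move=> x y; apply: (@linD K U K^o _ (xis_scalar s)). Qed.
Let xisZ s k x : xis s (k *: x) = k * xis s x.
Proof. by apply: (@linZ K U K^o _ (xis_scalar s)). Qed.
Let xis0 s : xis s 0 = 0.
Proof. by apply: (@lin0 K U K^o _ (xis_scalar s)). Qed.
Let xis_sum s I (r : seq I) (F : I -> U) : xis s (\sum_(i <- r) F i) = \sum_(i <- r) xis s (F i).
Proof. by apply: (@lin_sum K U K^o _ (xis_scalar s)). Qed.

Lemma xis_short s x : short (size s) x -> xis s x = 0.
Proof.
elim: s x => [|j s IH] x; first by case=> // ; rewrite xis0.
elim=> [|k w z ws _ IHz]; first by rewrite xis0.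
rewrite xisD xisZ IHz addr0 /= IH ?mulr0 //.
apply: (@short_le (size w)) => //; have := contract_word w (xil j).
by rewrite xi1 scale0r subr0.
Qed.

(** The leading term of the contraction by [xi i] removes the letter [i] in every possible
    way. Each removal leaves a word of the same class as [s], and the number of removals
    builds up the factorial of the multiplicity of [i]. *)
Lemma xis_word s w : size w = size s ->
  xis s (word w) = (perm_eq s w)%:R * (\prod_j (count_mem j s)`!)%:R.
Proof.
elim: s w => [|i s IH] w sw.
  rewrite (size0nil sw) word_nil /= aug_monoid.1 mul1r.
  by rewrite big1 // => j _; rewrite fact0.
have -> : xis (i :: s) (word w) = xis s (del (xi i) w).
  apply/eqP; rewrite -subr_eq0 /=; apply/eqP.
  rewrite -(@linB K U K^o _ (xis_scalar s)); apply: xis_short.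
  by have := contract_del w (xil i) (xi1 i); rewrite sw.
set P := (\prod_j (count_mem j s)`!)%N.
have E u : size (u ++ w) = (size s).+1 -> xis s (word u * del (xi i) w)
    = (count_mem i w * perm_eq (i :: s) (u ++ w) * P)%:R.
  elim: w {sw} u => [|j w IHw] u /= sw; first by rewrite mulr0 xis0.
  rewrite xiY mulrDr -scalerAr -word_cat xisD xisZ IH; last first.
    by move: sw; rewrite !size_cat /= addnS => -[].
  have -> : word u * (Y j * del (xi i) w) = word (rcons u j) * del (xi i) w.
    by rewrite -cats1 word_cat word_cons word_nil mulr1 mulrA.
  rewrite IHw cat_rcons // !natrM -/P natrD !mulrDl; congr (_ + _).
  have [->|] := eqVneq j i; last by rewrite !mul0r.
  rewrite !mul1r; congr (_%:R * _); congr nat_of_bool.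
  by rewrite perm_sym [RHS]perm_sym -(cat1s i w) perm_catCA /= perm_cons.
have := E [::]; rewrite word_nil mul1r /= => -> //.
have [swp|] := boolP (perm_eq _ _); last by rewrite muln0 mul0n mul0r.
rewrite muln1 mul1r; congr (_%:R); rewrite -(permP swp) /= eqxx add1n.
rewrite [RHS](bigD1 i) //= eqxx factS /P (bigD1 i) //= mulnA; congr (_ * _)%N.
by apply: eq_bigr => j /negPf ji; rewrite eq_sym ji.
Qed.

(** A maximal monomial of a relation is isolated by the convolution product of the forms
    of its letters; its coefficient gets multiplied by factorials of numbers less than
    [p], which are nonzero in [K]. *)
Lemma pbw_inj k : pbw k = 0 -> k = 0.
Proof.
move=> k0; apply/ffunP => a0; rewrite [RHS]ffunE; apply/eqP; apply: contraT => ka0.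
pose sz (a : {ffun J -> 'I_p}) := size (ordered (fun j => a j)).
have [a ka amax] := @arg_maxnP _ a0 (fun a => k a != 0) sz ka0.
have := congr1 (xis (ordered (fun j => a j))) k0; rewrite xis0 /pbw xis_sum.
rewrite (bigD1 a) //= xisZ xis_word // perm_refl mul1r [X in _ + X]big1 ?addr0 => [/eqP|b ba].
  rewrite mulf_eq0 (negPf ka) /= -(dvdn_pcharf charK) => /idPn[].
  elim/big_ind: _ => [|u v pu pv|j _]; first by rewrite Euclid_dvd1.
    by rewrite Euclid_dvdM // negb_or pu.
  by rewrite count_ordered prime_ndvd_fact.
rewrite xisZ; have [->|kb] := eqVneq (k b) 0; first by rewrite mul0r.
have : (sz b <= sz a)%N := amax _ kb; rewrite leq_eqVlt => /orP[/eqP sab|sab]; last first.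
  by rewrite xis_short ?mulr0 //; apply: short_word.
rewrite xis_word // (_ : perm_eq _ _ = false) ?mul0r ?mulr0 //.
apply: contraNF ba => /permP ab; apply/eqP/ffunP => j; apply/val_inj => /=.
by have := ab (pred1 j); rewrite !count_ordered.
Qed.
End Independence.
End PBW.

(** * Bases and dimensions *)

Section Bases.
Variable K : fieldType.

Definition has_basis (M : lmodType K) (I : finType) :=
  exists (b : I -> M) (c : I -> M -> K),
    [/\ forall i, scalar (c i), forall i j, c i (b j) = (i == j)%:R
      & forall x, x = \sum_i c i x *: b i].

Lemma has_basis_bij (M : lmodType K) (I : finType) (F : {ffun I -> K^o} -> M) :
    linear F -> (forall k, F k = 0 -> k = 0) -> (forall x, exists k, x = F k) ->
  has_basis M I.
Proof.
move=> Fl Finj Fsurj; pose c i x : K := projT1 (cid (Fsurj x)) i.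
have FK x : F [ffun i => c i x] = x.
  by rewrite [RHS](projT2 (cid (Fsurj x))); congr F; apply/ffunP => i; rewrite ffunE.
have KF k i : c i (F k) = k i.
  have /Finj/ffunP/(_ i) : F ([ffun i => c i (F k)] - k) = 0.
    by rewrite (linB Fl) FK subrr.
  by rewrite !ffunE => /subr0_eq.
exists (fun j => F [ffun i => (i == j)%:R]), c; split=> [i a x y|i j|x].
- by rewrite -{1}(FK x) -{1}(FK y) -Fl KF !ffunE.
- by rewrite KF ffunE.
- under eq_bigr => i _ do rewrite -(linZ Fl).
  rewrite -(lin_sum Fl) -{1}(FK x); congr F; apply/ffunP => i.
  rewrite sum_ffunE (bigD1 i) //= !ffunE eqxx [_ *: _]mulr1 big1 ?addr0 // => l li.
  by rewrite !ffunE eq_sym (negPf li) [_ *: _]mulr0.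
Qed.

Lemma basis_vector_axiom (M : lmodType K) (I : finType) :
  has_basis M I -> inhabited (Vector.axiom #|I| M).
Proof.
move=> [b [c [cl cb cE]]]; constructor.
exists (fun x => \row_r c (enum_val r) x).
  by move=> a x y; apply/rowP => r; rewrite !mxE cl.
have cs i (F : I -> M) : c i (\sum_l F l) = \sum_l c i (F l).
  exact: (@lin_sum K M K^o (c i) (cl i)).
exists (fun v : 'rV_#|I| => \sum_i v 0 (enum_rank i) *: b i) => [x|v].
  by rewrite {2}(cE x); apply: eq_bigr => i _; rewrite mxE enum_rankK.
apply/rowP => r; rewrite mxE cs (bigD1 (enum_val r)) //=.
rewrite (@linZ K M K^o _ (cl _)) cb eqxx enum_valK [_ *: _]mulr1.
rewrite big1 ?addr0 // => i ir.
by rewrite (@linZ K M K^o _ (cl _)) cb eq_sym (negPf ir) [_ *: _]mulr0.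
Qed.

Lemma vector_axiom_basis (M : lmodType K) d :
  Vector.axiom d M -> has_basis M 'I_d.
Proof.
move=> [f fl [f' fK f'K]].
apply: (@has_basis_bij _ _ (fun k : {ffun 'I_d -> K^o} => f' (\row_i k i))).
- move=> a k k'; apply: (can_inj fK); rewrite fl !f'K.
  by apply/rowP => i; rewrite !mxE !ffunE.
- move=> k /(congr1 f); rewrite f'K (lin0 fl) => /rowP k0.
  by apply/ffunP => i; have := k0 i; rewrite !mxE ffunE.
- move=> x; exists [ffun i => f x 0 i]; rewrite -[LHS]fK; congr f'.
  by apply/rowP => i; rewrite mxE ffunE.
Qed.

Lemma tensor_basis (M N : lmodType K) (I J : finType) :
  has_basis M I -> has_basis N J -> has_basis (tensor M N) (I * J)%type.
Proof.
move=> [b [c [cl cb cE]]] [b' [c' [cl' cb' cE']]].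
pose C (r : I * J) : tensor M N -> K^o := tlift (fun x y => c r.1 x * c' r.2 y : K^o).
have Cl r y : linear (fun x : M => c r.1 x * c' r.2 y : K^o).
  by move=> a x x'; rewrite cl mulrDl scalerAl.
have Cr (r : I * J) x : linear (fun y : N => c r.1 x * c' r.2 y : K^o).
  by move=> a y y'; rewrite cl' mulrDr scalerAr.
exists (fun r => b r.1 ⊗ b' r.2), C; split=> [r|r s|x].
- exact: (tlift_linear (Cl r) (Cr r)).
- rewrite /C (tliftE (Cl r) (Cr r)) cb cb' -natrM mulnb.
  by case: r s => [i j] [i' j'].
- have L r : linear (C r) by exact: (tlift_linear (Cl r) (Cr r)).
  elim/tens_ind: x => [|x y u IH].
    by rewrite big1 // => r _; rewrite (lin0 (L r)) scale0r.
  rewrite {1}IH; under [RHS]eq_bigr => r _ do rewrite (linD (L r)) scalerDl.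
  rewrite big_split /=; congr (_ + _).
  rewrite {1}(cE x) {1}(cE' y) tens_suml.
  rewrite -(pair_bigA _ (fun i j => C (i, j) (x ⊗ y) *: (b i ⊗ b' j))) /=.
  apply: eq_bigr => i _; rewrite tens_sumr; apply: eq_bigr => j _.
  by rewrite /C (tliftE (Cl (i, j)) (Cr (i, j))) /= tensZl tensZr scalerA.
Qed.
End Bases.

Section JW.
Variables (K : fieldType) (p n : nat) (charK : p \in [pchar K]).
Let pr_p : prime p := pcharf_prime charK.
Local Notation u := (ujw n charK).
Local Notation J := (midx p n * 'I_n)%type.
Local Notation xDm s := (xD K p (fun r => (s : J).1 r) s.2).

Lemma jw_expand (E : jw K p n) : E = \sum_(s : J) E s.2 s.1 *: xDm s.
Proof.
apply/ffunP => i; apply/ffunP => a; rewrite !sum_ffunE.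
rewrite (bigD1 (a, i)) //= !ffunE eqxx dmon_midx eqxx [_ *: _]mulr1.
rewrite big1 ?addr0 // => -[b l] /= bl; rewrite !ffunE /=.
case: eqP => il; last by rewrite ffunE [_ *: _]mulr0.
rewrite dmon_midx; case: eqP => ab; last by rewrite [_ *: _]mulr0.
by move: bl; rewrite il ab eqxx.
Qed.

Lemma dpowZ (k : K) (f : dpow K p n) (a : midx p n) : (k *: f) a = k * f a.
Proof. by rewrite ffunE. Qed.
Lemma dpowD (f g : dpow K p n) (a : midx p n) : (f + g) a = f a + g a.
Proof. by rewrite ffunE. Qed.

(** [x ⊗ 1] and [1 ⊗ y] commute, hence [x |-> x ⊗ 1 + 1 ⊗ x] respects brackets and
    [p]-th powers, and extends to the enveloping algebras. *)
Section Primitive.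
Variables (A : comNzRingType) (B : augAlgType A).
Hypothesis pB : p%:R = 0 :> A.
Let prim (x : B) := x ⊗ 1 + 1 ⊗ x.

Lemma prim_lin a x y : prim (a *: x + y) = a *: prim x + prim y.
Proof. by rewrite /prim tens_linearl tens_linearr scalerDr addrACA. Qed.
Lemma prim_br x y : prim (x * y - y * x) = prim x * prim y - prim y * prim x.
Proof.
have E v w : prim v * prim w = (v * w) ⊗ 1 + 1 ⊗ (v * w) + (v ⊗ w + w ⊗ v).
  rewrite /prim mulrDl !mulrDr !tensM !(mul1r, mulr1) -!addrA; congr (_ + _).
  by rewrite addrC -addrA [w ⊗ v + _]addrC -addrA.
rewrite !E [y ⊗ x + _]addrC opprD addrACA subrr addr0 /prim.
by rewrite tensDl tensDr tensNl tensNr addrACA opprD.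
Qed.
(** The Frobenius map is additive on commuting elements. *)
Lemma prim_pow x : prim (x ^+ p) = prim x ^+ p.
Proof.
have chT : p \in [pchar (tensor B B)].
  by rewrite inE pr_p -(scaler_nat p (1 : tensor B B)) pB scale0r eqxx.
have c : GRing.comm (x ⊗ 1) (1 ⊗ x : tensor B B).
  by rewrite /GRing.comm !tensM !(mul1r, mulr1).
have := pFrobenius_autD_comm chT c; rewrite !pFrobenius_autE => ->.
have El m : (x ⊗ 1 : tensor B B) ^+ m = (x ^+ m) ⊗ 1.
  by elim: m => [|m IH]; rewrite ?tens1 // !exprS IH tensM mulr1.
have Er m : (1 ⊗ x : tensor B B) ^+ m = 1 ⊗ (x ^+ m).
  by elim: m => [|m IH]; rewrite ?tens1 // !exprS IH tensM mulr1.
by rewrite El Er.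
Qed.
End Primitive.

Local Notation O := (dpow K p n).

Lemma ujw_coproduct : exists D0 : u -> tensor u u,
  [/\ linear D0, monoid_morphism D0 &
     forall E, D0 (ujw_in charK E) = ujw_in charK E ⊗ 1 + 1 ⊗ ujw_in charK E].
Proof.
have pK : p%:R = 0 :> K := pcharf0 charK.
apply: ujw_lift => [k E F|E F|i|a i ai].
- by rewrite ujw_in_linear prim_lin.
- by rewrite ujw_in_br prim_br.
- by rewrite -prim_pow // ujw_in_toral.
- by rewrite -prim_pow // ujw_in_nil // tens0l tens0r addr0.
Qed.

(** The forms [xi] are matrix coefficients of the natural module, corrected by the
    augmentation: [x^(b) D_l] maps the [i]-th variable to [x^(b)] if [l = i] and to [0]
    otherwise, so the coefficient of [x^(a)] in this image detects [x^(a) D_i]. *)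
Lemma ujw_basis : has_basis u {ffun J -> 'I_p}.
Proof.
pose Y (s : J) : u := ujw_in charK (xDm s).
have Yl : linear (@ujw_in K p n charK) := ujw_in_linear charK.
have YE E : ujw_in charK E = \sum_s E s.2 s.1 *: Y s.
  by rewrite {1}(jw_expand E) (lin_sum Yl); apply: eq_bigr => s _; rewrite (linZ Yl).
have [D0 [D0l D0M D0Y]] := ujw_coproduct.
have [R [Rl RlU R1 RM RE]] := ujw_rep n charK.
pose xi (s : J) (z : u) : K :=
  (R z (dmon K p (ei s.2))) s.1 - aug z * (R 1 (dmon K p (ei s.2))) s.1.
have Ybr i j : Y i * Y j - Y j * Y i
    = \sum_l jw_br (xDm i) (xDm j) l.2 l.1 *: Y l.
  by rewrite -YE /Y ujw_in_br.
pose Yp (i : J) := if [forall r, i.1 r == ei i.2 r :> nat] then Y i else 0.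
have YpE i : Y i ^+ p = Yp i.
  rewrite /Yp /Y; case: ifP => [/forallP E|/negbT ni].
    have -> : xDm i = xD K p (ei i.2) i.2.
      apply/ffunP => r; rewrite !ffunE; congr (if _ then _ else _).
      by apply: eq_dmon => l; apply/eqP.
    exact: ujw_in_toral.
  by apply: ujw_in_nil => E; case/negP: ni; apply/forallP => r; rewrite E.
have Ypow i : Y i ^+ p
    = \sum_l ((l == i) && [forall r, i.1 r == ei i.2 r :> nat])%:R *: Y l.
  rewrite YpE (bigD1 i) //= eqxx big1 ?addr0 => [|l /negPf->]; last by rewrite scale0r.
  by rewrite /Yp; case: ifP; rewrite ?scale1r ?scale0r.
apply: (@has_basis_bij _ _ _ (pbw Y)).
- exact: pbw_linear.
- apply: (pbw_inj charK D0l D0M (fun s => D0Y _) (xi := xi)) => [s k z w|s|s r].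
  + rewrite /xi RlU !ffunE aug_scalar mulrDl mulrBr opprD addrACA.
    by rewrite mulrA.
  + by rewrite /xi aug_monoid.1 mul1r subrr.
  + rewrite /xi RE ujw_aug_in mul0r subr0 (act_ei charK) dpowZ dmon_midx.
    rewrite -natrM mulnb; case: s r => [a i] [b l] /=.
    by rewrite xpair_eqE andbC [a == b]eq_sym.
- apply: (pbw_surj charK Ybr Ypow) => P P0 PD; apply: ujw_ind => // k s z Pz.
  have PD' : forall (k : K) s' s z, P z ->
      P (k *: (word Y s' * \prod_(x <- s) ujw_in charK x) + z).
    move=> {k s z Pz} k s' s; elim: s k s' => [|E s IH] k s' z Pz.
      by rewrite big_nil mulr1; apply: PD.
    rewrite big_cons YE mulr_suml mulr_sumr scaler_sumr.
    elim: (index_enum _) => [|l r IHr]; first by rewrite big_nil add0r.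
    rewrite big_cons -addrA -scalerAl -scalerAr scalerA mulrA.
    have -> : word Y s' * Y l = word Y (rcons s' l).
      by rewrite -cats1 word_cat /word big_seq1.
    exact: IH.
  by have := PD' k [::] s z Pz; rewrite word_nil mul1r.
Qed.
End JW.

(** * Truncated polynomials *)

Section TruncatedPolynomials.
Variables (K : fieldType) (p : nat) (charK : p \in [pchar K]) (q : K).
Let p_gt1 : (1 < p)%N := prime_gt1 (pcharf_prime charK).

Lemma size_trunc : size ('X^p - q *: 'X : {poly K}) = p.+1.
Proof.
rewrite size_polyDl ?size_polyXn // size_polyN (leq_ltn_trans (size_scale_leq _ _)) //.
by rewrite size_polyX.
Qed.

Lemma mk_monic_trunc : mk_monic ('X^p - q *: 'X : {poly K}) = 'X^p - q *: 'X.
Proof.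
rewrite /mk_monic size_trunc ltnS (ltnW p_gt1) monicE lead_coefE size_trunc /=.
by rewrite coefB coefXn eqxx coefZ coefX (gtn_eqF p_gt1) mulr0 subr0 eqxx.
Qed.

Lemma ktrunc_basis : has_basis (ktrunc p q : lmodType K) 'I_p.
Proof.
have D : (size (mk_monic ('X^p - q *: 'X : {poly K}))).-1 = p.
  by rewrite mk_monic_trunc size_trunc.
have : has_basis (ktrunc p q : lmodType K) 'I_(size (mk_monic ('X^p - q *: 'X : {poly K}))).-1.
  apply: vector_axiom_basis.
  exists (@npoly_rV K _); first by move=> a x y; rewrite /npoly_rV /= linearP.
  by exists (@rVnpoly K _); [exact: npoly_rV_K | exact: rVnpolyK].
by rewrite D.
Qed.

Lemma ktrunc_t_neq0 : ktrunc_t p q != 0.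
Proof.
apply/eqP => /(congr1 val); rewrite [LHS]in_qpoly_small; last first.
  by rewrite mk_monic_trunc size_trunc size_polyX.
by apply/eqP; rewrite polyX_eq0.
Qed.
End TruncatedPolynomials.

(** * The primitive Hopf structure of the scalar extension *)

Section Assembly.
Variables (K : fieldType) (p n : nat) (charK : p \in [pchar K]) (A : comAlgType K).
Let pr_p : prime p := pcharf_prime charK.
Local Notation u := (ujw n charK).
Local Notation H := (ujwA n charK A).
Local Notation j := (@ujwA_in K p n charK A).
Local Notation J := (midx p n * 'I_n)%type.

Lemma natr_scalar (m : nat) : m%:R = (m%:R : K)%:A :> A.
Proof. by rewrite scaler_nat. Qed.

Lemma pcharA : p \in [pchar A].
Proof. by rewrite inE pr_p natr_scalar (pcharf0 charK) scale0r eqxx. Qed.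

Lemma ujwA_in0 : j 0 = 0.
Proof. by rewrite /ujwA_in (lin0 (ujw_in_linear charK)) tens0l. Qed.
Lemma ujwA_inZ (k : K) x : j (k *: x) = (k%:A : A) *: j x.
Proof. by rewrite -[k *: x]addr0 ujwA_in_semilinear ujwA_in0 addr0. Qed.
Lemma ujwA_in_sum (I : Type) (r : seq I) (F : I -> jw K p n) :
  j (\sum_(i <- r) F i) = \sum_(i <- r) j (F i).
Proof.
elim: r => [|i r IH]; first by rewrite !big_nil ujwA_in0.
by rewrite !big_cons -IH -[F i]scale1r ujwA_in_semilinear !scale1r.
Qed.

Lemma ujwA_gen_ind (P : H -> Prop) : P 0 -> P 1 ->
  (forall a y z, P y -> P z -> P (a *: y + z)) ->
  (forall (s : J) y, P y -> P (j (xD K p (fun r => s.1 r) s.2) * y)) -> forall y, P y.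
Proof.
move=> P0 P1 PD PM.
have PZ a y : P y -> P (a *: y) by move=> Py; rewrite -[_ *: _]addr0; apply: PD.
have PE E y : P y -> P (j E * y).
  move=> Py; rewrite (jw_expand E) ujwA_in_sum mulr_suml.
  elim: (index_enum _) => [|s r IH]; first by rewrite big_nil.
  by rewrite big_cons ujwA_inZ -scalerAl; apply: PD => //; apply: PM.
apply: ujwA_ind => // a s z Pz; apply: PD => //.
by elim: s => [|E s IH]; rewrite ?big_nil // big_cons; apply: PE.
Qed.

Lemma ujwA_coproduct : exists D0 : H -> tensor H H,
  [/\ linear D0, monoid_morphism D0 & forall E, D0 (j E) = j E ⊗ 1 + 1 ⊗ j E].
Proof.
have pA : p%:R = 0 :> A := pcharf0 pcharA.
apply: ujwA_lift => [k E F|E F|i|a i ai].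
- by rewrite ujwA_in_semilinear prim_lin.
- by rewrite ujwA_in_br prim_br.
- by rewrite -(prim_pow charK pA) ujwA_in_toral.
- by rewrite -(prim_pow charK pA) ujwA_in_nil // tens0l tens0r addr0.
Qed.

Lemma ujwA_antipode : exists S0 : H -> H,
  [/\ linear S0, S0 1 = 1, forall y z, S0 (y * z) = S0 z * S0 y & forall E, S0 (j E) = - j E].
Proof.
have chH : p \in [pchar H].
  by rewrite inE pr_p (pB pcharA H) eqxx.
have oppX (x : H) : (- x) ^+ p = - (x ^+ p).
  by have := pFrobenius_autN chH x; rewrite !pFrobenius_autE.
have [||||S0 [S0l [S01 S0M] S0E]] :=
    @ujwA_lift K p n charK A (opp_alg H) (fun E => - j E : H).
- by move=> k E F; rewrite ujwA_in_semilinear opprD -scalerN.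
- move=> E F; rewrite ujwA_in_br.
  transitivity ((- j F) * (- j E) - (- j E) * (- j F)); last by [].
  by rewrite !mulrNN opprB.
- by move=> i; rewrite opp_expE oppX ujwA_in_toral.
- by move=> a i ai; rewrite opp_expE oppX ujwA_in_nil // oppr0.
by exists S0; split.
Qed.

(** A matrix coefficient of the natural module, extended to the scalars [A]. *)
Lemma ujwA_coef (f : dpow K p n) (c : midx p n) : exists chi : H -> A^o,
  linear chi /\ forall E, chi (j E) = (jw_act E f c)%:A.
Proof.
have [R [Rl RlU R1 RM RE]] := ujw_rep n charK.
pose F (z : u) (a : A) : A := R z f c *: a.
have Fl a : linear (F^~ a).
  by move=> k z w; rewrite /F RlU dpowD dpowZ scalerDl scalerA.
have Fr z : linear (F z).
  by move=> k a b; rewrite /F scalerDr !scalerA mulrC.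
have L := tlift_linear Fl Fr.
exists (tlift F); split=> [a y z|E]; last by rewrite /ujwA_in (tliftE Fl Fr) /F RE.
rewrite [LHS](linD L); congr (_ + _); rewrite ujwA_scaleE.
elim/tens_ind: y => [|x b y IH]; first by rewrite mulr0 (lin0 L) scaler0.
rewrite mulrDr (linD L) IH (linD L) scalerDr; congr (_ + _).
rewrite ujwA_mulE mul1r !(tliftE Fl Fr) /F.
by rewrite -[RHS]/(a * (_ *: b)) scalerAr.
Qed.
End Assembly.

(** * The twist by [h = x_k D_k] and [e = 2 x_k^(2) D_k] *)

Section TwistData.
Variables (K : fieldType) (p n : nat) (charK : p \in [pchar K]) (A : comAlgType K).
Variable k : 'I_n.
Let pr_p : prime p := pcharf_prime charK.
Let chA : p \in [pchar A] := pcharA charK A.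
Local Notation H := (ujwA n charK A).
Local Notation j := (@ujwA_in K p n charK A).
Local Notation h := (xD K p (ei k) k).
Local Notation e := (2%:R *: xD K p (fun r => 2 * ei k r)%N k).

Lemma br_h_e : jw_br h e = e.
Proof.
rewrite (linZ (br_linearr _)) (br_toral charK) /ei !eqxx muln1.
have -> : (2 - 1 : K) = 1 by ring.
by rewrite scale1r.
Qed.

Lemma ujwA_weight X (m : int) :
  jw_br h X = m%:~R *: X -> weight (j h) (m%:~R : 'F_p) (j X).
Proof.
move=> hX; have := congr1 j hX; rewrite ujwA_in_br ujwA_inZ => E.
rewrite /weight mulrDr mulr_algr (of_Fp_int chA); apply/eqP; rewrite addrC -subr_eq E.
by rewrite scaler_int.
Qed.

(** If [p = 2] then [e = 0]; otherwise [x_k^(2)] is a basis monomial, so a relation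
    applies. *)
Lemma ujwA_e_nil : j e ^+ p = 0.
Proof.
rewrite ujwA_inZ exprZn; have [p2|p2] := eqVneq p 2%N.
  by rewrite -{1}p2 (pcharf0 charK) scale0r expr0n gtn_eqF ?prime_gt0 // scale0r.
have p3 : (2 < p)%N by rewrite ltn_neqAle eq_sym p2 prime_gt1.
have v : @valid p n (fun r => 2 * ei k r)%N.
  by apply/forallP => r; rewrite /ei; case: (_ == _); rewrite ?muln1 ?muln0 ?prime_gt0.
have [a aE] := valid_midx v.
have -> : xD K p (fun r => 2 * ei k r)%N k = xD K p (fun r => a r) k.
  by apply/ffunP => r; rewrite !ffunE; congr (if _ then _ else _); apply: eq_dmon.
rewrite ujwA_in_nil ?scaler0 // => /(_ k); rewrite -aE /ei eqxx.
by [].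
Qed.

Variable t : A.
Local Notation T := (t *: j e : H).

Lemma T_nil : T ^+ p = 0.
Proof. by rewrite exprZn ujwA_e_nil scaler0. Qed.

Lemma T_weight : weight (j h) (1 : 'F_p) T.
Proof.
apply: weightZ; apply: (ujwA_weight (m := 1)).
by rewrite br_h_e scale1r.
Qed.

Lemma grp_unit : grp T \is a GRing.unit.
Proof.
apply/unitrP; exists (grp T ^+ p.-1).
by rewrite -exprSr -exprS prednK ?prime_gt0 // (grp_p chA T_nil).
Qed.

Lemma grpX_exprz (m : int) : grpX T (m%:~R : 'F_p) = grp T ^ m.
Proof.
case: m => m; first by rewrite -pmulrn (grpX_nat chA T_nil).
rewrite NegzE mulrNz -pmulrn; apply: (mulrI (x := grp T ^+ m.+1)).
  exact/unitrX/grp_unit.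
rewrite -(grpX_nat chA T_nil) (grpXVr chA T_nil) (grpX_nat chA T_nil).
by rewrite -exprnN divrr // unitrX ?grp_unit.
Qed.

(** [ad T] is [t ad e] on the image of the Lie algebra, and [l`!] is invertible in [K]. *)
Lemma divided_ad X l : (l < p)%N ->
  (t ^+ l *: j (ad_div e l X)) *+ l`! = iter l (adT T) (j X).
Proof.
move=> lp; have -> : (t ^+ l *: j (ad_div e l X)) *+ l`! = t ^+ l *: j (iter l (jw_br e) X).
  rewrite scalerMnr; congr (_ *: _); rewrite /ad_div ujwA_inZ -scaler_nat scalerA.
  rewrite natr_scalar -scalerAl mul1r scalerA divff ?scale1r //.
  by rewrite -(dvdn_pcharf charK) prime_ndvd_fact.
elim: l {lp} => [|l IH]; first by rewrite scale1r.
rewrite !iterS -IH ujwA_in_br /adT -!scalerAl -!scalerAr !scalerA -exprS mulrC.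
by rewrite -exprS scalerBr.
Qed.
(** [[h, D_k] = - D_k], and [D_k] maps the [k]-th variable to [1]. *)
Lemma ujwA_noncommutative : noncommutative H.
Proof.
exists (j h), (j (xD K p (fun=> 0%N) k)) => E.
have := ujwA_in_br charK A h (xD K p (fun=> 0%N) k).
rewrite E subrr (br_toral charK) eqxx sub0r ujwA_inZ => j0.
pose o : midx p n := [ffun=> Ordinal (prime_gt0 pr_p)].
have [chi [chil chiE]] := ujwA_coef charK A (dmon K p (ei k)) o.
have := congr1 chi j0; rewrite (linZ chil) (lin0 chil) chiE (act_ei charK) eqxx scale1r.
rewrite dmonE (_ : [forall _, _]) => [/eqP|]; last by apply/forallP => r; rewrite ffunE.
rewrite !mulr1n !scaleN1r scale1r oppr_eq0.
by rewrite (oner_eq0 A).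
Qed.

Lemma toral_coef : exists chi : H -> A^o, linear chi /\ chi (j h) = 1.
Proof.
have [a aE] := valid_midx (ei_valid charK k).
have [chi [chil chiE]] := ujwA_coef charK A (dmon K p (ei k)) a.
exists chi; split=> //; rewrite chiE (act_ei charK) eqxx scale1r.
by rewrite (@eq_dmon K p n _ _ aE) dmon_midx eqxx scale1r.
Qed.

(** [e] maps the [k]-th variable to [2 x_k^(2)]. *)
Lemma T_neq0 : p != 2%N -> t != 0 -> T != 0.
Proof.
move=> p2; apply: contraNneq => T0.
have p3 : (2 < p)%N by rewrite ltn_neqAle eq_sym p2 prime_gt1.
have v : @valid p n (fun r => 2 * ei k r)%N.
  by apply/forallP => r; rewrite /ei; case: (_ == _); rewrite ?muln1 ?muln0 ?prime_gt0.
have [a aE] := valid_midx v.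
have [chi [chil chiE]] := ujwA_coef charK A (dmon K p (ei k)) a.
have := congr1 chi T0; rewrite (lin0 chil) (linZ chil) ujwA_inZ (linZ chil) chiE.
rewrite (act_ei charK) eqxx scale1r (@eq_dmon K p n _ _ aE) dmon_midx eqxx scale1r => E.
have /eqP : t * ((2%:R : K)%:A * 1) = 0 := E.
rewrite mulr1 mulr_algr scaler_eq0 => /orP[|//].
by rewrite -(dvdn_pcharf charK) gtnNdvd.
Qed.

(** This holds over any commutative [K]-algebra [A] and for any [t] in [A], because
    [T ^+ p = t ^+ p e ^+ p = 0] whatever [t] is. *)
Lemma twisted_hopf : exists (Delta : H -> tensor H H) (S : H -> H) (eps : H -> A),
  [/\ is_hopf_algebra Delta eps S,
      (p != 2%N -> t != 0 -> noncocommutative Delta) &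
      forall (a : midx p n) (i : 'I_n),
        let X : jw K p n := xD K p (fun r => a r) i in
        let m : int := (a k)%:Z - ((i == k) : nat)%:Z in
        [/\ Delta (j X)
            = j X ⊗ (1 - T) ^ m
              + \sum_(l < p) (-1) ^+ l *:
                  (rising 0 (j h) l
                   ⊗ (t ^+ l *: ((1 - T) ^ (- (l : nat)%:Z) * j (ad_div e l X)))),
            S (j X)
            = - ((1 - T) ^ (- m) *
                 \sum_(l < p) t ^+ l *: (j (ad_div e l X) * rising 1 (j h) l)) &
            eps (j X) = 0]].
Proof.
have hp : j h ^+ p = j h by apply: ujwA_in_toral.
have [D0 [D0l D0M D0j]] := ujwA_coproduct n charK A.
have [S0 [S0l S01 S0M S0j]] := ujwA_antipode n charK A.
have jprim E : primitive D0 S0 (j E).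
  by split; [exact: D0j | exact: S0j | exact: ujwA_aug_in].
have Tprim : primitive D0 S0 T.
  split; first by rewrite (linZ D0l) D0j scalerDr -tensZl -tensZr.
    by rewrite (linZ S0l) S0j scalerN.
  by rewrite (@linZ A H A^o _ (@aug_scalar A H)) ujwA_aug_in scaler0.
pose X (s : midx p n * 'I_n) : jw K p n := xD K p (fun r => s.1 r) s.2.
pose m (s : midx p n * 'I_n) : int := (s.1 k)%:Z - ((s.2 == k) : nat)%:Z.
have Xwt s : weight (j h) ((m s)%:~R : 'F_p) (j (X s)).
  by apply: ujwA_weight; rewrite (br_toral charK) /m rmorphB /= -!pmulrn.
exists (twisted_coproduct p D0 (j h) T), (twisted_antipode p S0 (j h) T), (@aug A H); split.
- exact: (twist_hopf chA D0l D0M S0l S01 S0M hp T_nil T_weight (jprim h) Tprim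
    (fun s => jprim (X s)) Xwt (@ujwA_gen_ind K p n charK A)).
- move=> p2 t0; exists (j h); have [chi [chil chih]] := toral_coef.
  exact: (coproduct_noncocommutative chA hp T_nil T_weight (jprim h) chil chih (T_neq0 p2 t0)).
move=> a i; pose s : midx p n * 'I_n := (a, i).
have dE := @divided_ad (X s).
split; last exact: ujwA_aug_in.
- rewrite (coproduct_formula chA hp T_nil (jprim (X s)) (Xwt s) dE) -grpX_exprz.
  congr (_ + _); apply: eq_bigr => l _; congr (_ *: (_ ⊗ _)).
  by rewrite -grpX_exprz mulrNz -pmulrn -scalerAr.
- rewrite (antipode_formula chA hp T_nil T_weight (jprim (X s)) (Xwt s) dE) -grpX_exprz.
  by rewrite mulrNz; congr (- (_ * _)); apply: eq_bigr => l _; rewrite -scalerAl.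
Qed.
End TwistData.

(* If p = 2 then e = 0 and Delta is cocommutative; hence the guard p != 2. *)
Theorem theorem3p5 (K : fieldType) (p : nat) (charK : p \in [pchar K])
    (q : K) (n : nat) (k : 'I_n) :
  let A : comAlgType K := ktrunc p q in
  let H := ujwA n charK A in
  let t : A := ktrunc_t p q in
  let j : jw K p n -> H := ujwA_in charK A in
  let h : jw K p n := xD K p (ei k) k in
  let e : jw K p n := 2%:R *: xD K p (fun r => 2 * ei k r)%N k in
  let g : H := 1 - t *: j e in
  [/\ jw_br h e = e,
      g \is a GRing.unit,
      exists (Delta : H -> tensor H H) (S : H -> H) (eps : H -> A),
        [/\ is_hopf_algebra Delta eps S,
            noncommutative H,
            (p != 2%N -> noncocommutative Delta) &
            forall (a : midx p n) (i : 'I_n),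
              let X : jw K p n := xD K p (fun r => a r) i in
              let m : int := (a k)%:Z - ((i == k) : nat)%:Z in
              [/\ Delta (j X)
                  = j X ⊗ g ^ m
                    + \sum_(l < p) (-1) ^+ l *:
                        (rising 0 (j h) l
                         ⊗ (t ^+ l *: (g ^ (- (l : nat)%:Z) * j (ad_div e l X)))),
                  S (j X)
                  = - (g ^ (- m) *
                       \sum_(l < p) t ^+ l *:
                         (j (ad_div e l X) * rising 1 (j h) l)) &
                  eps (j X) = 0]] &
      inhabited (Vector.axiom (p ^ (1 + n * p ^ n)) (tensor (ujw n charK) A))].
Proof.
move=> A H t j h e g; split; [exact: br_h_e | exact: grp_unit | |].
- have [Delta [S [eps [hopf nc formulas]]]] := twisted_hopf charK k t.
  exists Delta, S, eps; split=> //; first exact: ujwA_noncommutative k.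
  by move=> p2; apply: nc (ktrunc_t_neq0 charK q).
- have := basis_vector_axiom (tensor_basis (ujw_basis n charK) (ktrunc_basis charK q)).
  rewrite card_prod card_ffun !card_ord card_prod card_ffun !card_ord.
  by rewrite -expnSr add1n mulnC.
Qed.
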